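(* Let $\tilde{\mathcal N}_h\subset\mathcal N_h$ be any subset of the set of nodes of the generalized finite element space $V_h\subset H^2_0(\Omega)$, let $\tilde V_h=\{v\in V_h: v(p)=0\ \forall p\in\mathcal N_h\setminus\tilde{\mathcal N}_h\}$, let $\tilde A_h:\tilde V_h\to\tilde V_h'$ be given by $\langle\tilde A_h v,w\rangle=a(v,w)$, and let $B_{\rm TL}=\sum_{j=0}^J I_jA_j^{-1}I_j^t:\tilde V_h'\to\tilde V_h$ be the two-level additive Schwarz preconditioner associated with the overlapping subdomains $D_1,\dots,D_J$ and the coarse space $\tilde V_0=\tilde T_h\Pi_hV_H$ (all as specified in the context). Then $$\kappa(B_{\rm TL}\tilde A_h)=\frac{\lambda_{\max}(B_{\rm TL}\tilde A_h)}{\lambda_{\min}(B_{\rm TL}\tilde A_h)}\le C\min\big((H/h)^4,\delta^{-4}\big),$$ where the positive constant $C$ is independent of $H$, $h$, $J$, $\delta$ and $\tilde{\mathcal N}_h$.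
   Context: Setting. $\Omega\subset\mathbb R^2$ is a bounded polygonal domain, and $a(v,w)=\int_\Omega D^2v:D^2w\,dx=\int_\Omega\sum_{i,j=1}^2\frac{\partial^2 v}{\partial x_i\partial x_j}\frac{\partial^2 w}{\partial x_i\partial x_j}\,dx$ for $v,w\in H^2_0(\Omega)$. Constants called $C$ (with or without subscripts) are positive and generic; $A\approx B$ means that $A$ and $B$ bound each other up to such constants, uniform over the family of discretizations and decompositions considered. Partition of unity method. $\{\Omega_i\}_{i=1}^n$ is an open cover of $\bar\Omega$ by open rectangles (patches) whose diameters are comparable to a mesh size $h$, and $\phi_1,\dots,\phi_n\in W^2_\infty(\mathbb R^2)$ are nonnegative functions (tensor products of one-dimensional flat-top functions) with $\mathrm{supp}\,\phi_i\subset\Omega_i$, $\sum_{i=1}^n\phi_i=1$ on $\Omega$, and $|\phi_i|_{W^m_\infty(\mathbb R^2)}\le C(\mathrm{diam}\,\Omega_i)^{-m}$ for $0\le m\le 2$. The flat-top region $\Omega_i^{\rm flat}\subset\Omega_i$ is the set where $\phi_i=1$. $V_i$ is a space of biquadratic polynomials on $\Omega_i$ satisfying the homogeneous Dirichlet boundary conditions of $H^2_0(\Omega)$ on $\partial\Omega$; its degrees of freedom are values at nodes lying in $\Omega_i^{\rm flat}$. The generalized finite element space is $V_h=\sum_{i=1}^n\phi_iV_i\subset H^2_0(\Omega)$. $\mathcal N_h$ is the set of all nodes corresponding to the degrees of freedom of the local basis functions; its cardinality is $\dim V_h$, and a function in $V_h$ is determined by its values on $\mathcal N_h$. The interpolation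 operator $\Pi_h:H^2_0(\Omega)\to V_h$ is $\Pi_h\zeta=\sum_{i=1}^n(\Pi_i\zeta)\phi_i$, where $\Pi_i$ is the nodal interpolation operator for $V_i$. The discretization has the following known properties, with constants independent of $h$: $$\sum_{m=0}^1h^m|\zeta-\Pi_h\zeta|_{H^m(\Omega)}+h^2|\Pi_h\zeta|_{H^2(\Omega)}\le C_\Pi h^2|\zeta|_{H^2(\Omega)}\quad\forall\,\zeta\in H^2_0(\Omega),$$ $$\|v\|_{L_2(\Omega)}^2\approx h^2\sum_{p\in\mathcal N_h}v(p)^2\quad\forall\,v\in V_h,$$ and the standard inverse estimates $|v|_{H^m(\Omega)}\le Ch^{-m}\|v\|_{L_2(\Omega)}$ for $v\in V_h$, $m=1,2$. Truncated space. For $\tilde{\mathcal N}_h\subset\mathcal N_h$, the truncation operator $\tilde T_h:V_h\to V_h$ is defined by $(\tilde T_hv)(p)=v(p)$ if $p\in\tilde{\mathcal N}_h$ and $(\tilde T_hv)(p)=0$ if $p\in\mathcal N_h\setminus\tilde{\mathcal N}_h$; it is a projection onto $\tilde V_h=\tilde T_hV_h$. $\langle\cdot,\cdot\rangle$ denotes the canonical duality pairing between a space and its dual. (The condition number is meaningful when $\tilde V_h\ne\{0\}$.) Domain decomposition. $D_1,\dots,D_J$ are overlapping subdomains forming a decomposition of $\Omega$ with $\mathrm{diam}\,D_j\approx H$ for all $j$; any point of $\Omega$ belongs to at most $N_c$ of the subdomains ($N_c$ a fixed number); the boundaries of $D_1,\dots,D_J$ are aligned with the boundaries of the patches underlying $V_h$.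 There is a partition of unity $\psi_1,\dots,\psi_J\in W^2_\infty(\mathbb R^2)$ with $\sum_{j=1}^J\psi_j=1$ on $\bar\Omega$, $\psi_j\ge0$, $\psi_j=0$ on $\Omega\setminus\bar D_j$, and $|\psi_j|_{W^k_\infty(\Omega)}\le C_\dag\delta^{-k}$ for $k=0,1,2$ and $1\le j\le J$, where $\delta\ge h$ measures the overlap among the subdomains (as an overlap width, $\delta$ is at most comparable to $H$). Preconditioner. For $1\le j\le J$, $\tilde V_j$ is the subspace of $\tilde V_h$ of functions vanishing at all nodes outside $D_j$. $V_H\subset H^2_0(\Omega)$ is a coarse generalized finite element space, of the same type as $V_h$ but associated with patches whose diameters are comparable to the diameters of the subdomains, i.e. to $H$ (with $h\le H$); it has the same properties as $V_h$ with $h$ replaced by $H$. The coarse space is $\tilde V_0=\tilde T_h\Pi_hV_H\subset\tilde V_h$. For $0\le j\le J$, $A_j:\tilde V_j\to\tilde V_j'$ is defined by $\langle A_jv,w\rangle=a(v,w)$ for all $v,w\in\tilde V_j$, $I_j:\tilde V_j\to\tilde V_h$ is the natural injection and $I_j^t:\tilde V_h'\to\tilde V_j'$ its transpose. $\lambda_{\max}$ and $\lambda_{\min}$ denote the largest and smallest eigenvalues. *)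

(* Defs.v *)
From HB Require Import structures.
From mathcomp Require Import all_boot all_order all_algebra.
From mathcomp Require Import all_classical all_reals all_analysis.
From mathcomp Require Import ess_sup_inf.
Set Implicit Arguments.
Unset Strict Implicit.
Unset Printing Implicit Defensive.
Import Order.TTheory GRing.Theory Num.Theory numFieldNormedType.Exports.
Local Open Scope classical_set_scope.
Local Open Scope ring_scope.

Notation plane R := (R * R)%type.

Section Plane.
Variable R : realType.

Definition mu2 :
  {measure set (measurableTypeR R * measurableTypeR R) -> \bar R} :=
  (lebesgue_measure \x lebesgue_measure)%E.

Definition eucl (x y : plane R) : R :=
  Num.sqrt ((x.1 - y.1) ^+ 2 + (x.2 - y.2) ^+ 2).

Definition diam (A : set (plane R)) : R :=
  sup [set d | exists x y, [/\ A x, A y & d = eucl x y]].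

Definition boundary (A : set (plane R)) : set (plane R) :=
  closure A `\` interior A.

Definition segment (p q : plane R) : set (plane R) :=
  [set (1 - t) *: p + t *: q | t in [set t : R | 0 <= t <= 1]].

(* [regopen] excludes slits. *)
Definition polygonal_domain (D : set (plane R)) : Prop :=
  [/\ open D, connected D, D !=set0, bounded_set D &
      regopen D /\
      exists s : seq (plane R * plane R),
        boundary D = \bigcup_(e in [set` s]) segment e.1 e.2].

Definition open_rect (a b : plane R) : set (plane R) :=
  [set x | (a.1 < x.1 < b.1) && (a.2 < x.2 < b.2)].

Definition supp_fun (f : plane R -> R) : set (plane R) :=
  closure [set x | f x != 0].

(* two-sided bound with constant K *)
Definition equiv_upto (K A B : R) : Prop := A <= K * B /\ B <= K * A.

End Plane.
Arguments mu2 {R}.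

Section Sobolev.
Variable R : realType.
Implicit Types (D : set (plane R)) (f g : plane R -> R) (s : seq 'I_2).

Definition unit_dir (i : 'I_2) : plane R := if i == ord0 then (1, 0) else (0, 1).

(* pderiv [:: i1; ...; ik] f = d/dx_i1 ... d/dx_ik f, classically *)
Definition pderiv s f : plane R -> R :=
  foldr (fun i g => 'D_(unit_dir i) g) f s.

Definition smooth f : Prop := forall s x, differentiable (pderiv s f) x.

(* C_c^oo(D) *)
Definition test_function D f : Prop :=
  [/\ smooth f, compact (supp_fun f) & supp_fun f `<=` D].

Definition loc_integrable D f : Prop :=
  forall A, compact A -> A `<=` D -> mu2.-integrable A (EFin \o f).

Definition is_weak_deriv D s f g : Prop :=
  [/\ loc_integrable D f, loc_integrable D g &
      forall phi, test_function D phi ->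
        \int[mu2]_(x in D) (f x * pderiv s phi x) =
        (-1) ^+ size s * \int[mu2]_(x in D) (g x * phi x)].

(* A representative of the weak derivative, which is unique up to a null set;
   to be used only when a weak derivative exists. *)
Definition weakD D s f : plane R -> R := xget (cst 0) (is_weak_deriv D s f).

(* H^m(D) *)
Definition Hspace D (m : nat) f : Prop :=
  forall s, (size s <= m)%N ->
    (exists g, is_weak_deriv D s f g) /\
    mu2.-integrable D (EFin \o (fun x => weakD D s f x ^+ 2)).

Definition L2norm D f : R := Num.sqrt (\int[mu2]_(x in D) (f x ^+ 2)).

(* |f|_{H^m(D)}, summing over all words of length m, so that
   |f|_{H^2}^2 = \int D^2 f : D^2 f *)
Definition Hsemi D (m : nat) f : R :=
  Num.sqrt (\sum_(s : m.-tuple 'I_2) \int[mu2]_(x in D) (weakD D s f x ^+ 2)).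

Definition Hnorm D (m : nat) f : R :=
  Num.sqrt (\sum_(k < m.+1) Hsemi D k f ^+ 2).

(* H^2_0(D): closure of C_c^oo(D) in H^2(D). Elements are extended by zero
   outside D and represented by the continuous function in their class
   (which exists by Sobolev embedding), so that nodal values make sense. *)
Definition H20 D f : Prop :=
  [/\ continuous f, (forall x, ~ D x -> f x = 0), Hspace D 2 f &
      forall e : R, 0 < e ->
        exists2 phi, test_function D phi & Hnorm D 2 (fun x => f x - phi x) < e].

(* |f|_{W^k_oo(D)} *)
Definition Wsemi D (k : nat) f : \bar R :=
  (\big[maxe/0]_(s : k.-tuple 'I_2)
     ess_sup mu2 (fun x => `|patch (cst 0%R) D (weakD D s f) x|%:E))%E.

(* W^2_oo(R^2), functions being given by their continuous representative *)
Definition W2oo f : Prop :=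
  continuous f /\
  forall k, (k <= 2)%N ->
    (forall s, size s = k -> exists g, is_weak_deriv setT s f g) /\
    (Wsemi setT k f < +oo)%E.

(* a(v,w) = \int_D D^2 v : D^2 w *)
Definition aform D (v w : plane R -> R) : R :=
  \int[mu2]_(x in D)
    (\sum_(i < 2) \sum_(j < 2)
       weakD D [:: i; j] v x * weakD D [:: i; j] w x).

End Sobolev.

Section PUM.
Variable R : realType.

(* n patches ]lo_i, hi_i[, partition of unity functions phi_i, local spaces V_i
   (of polynomials, as functions on the whole plane), and the nodes of V_i *)
Record pum := Pum {
  npatch : nat ;
  patch_lo : 'I_npatch -> plane R ;
  patch_hi : 'I_npatch -> plane R ;
  pu : 'I_npatch -> plane R -> R ;
  locspace : 'I_npatch -> set (plane R -> R) ;
  locnodes : 'I_npatch -> seq (plane R) }.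

Definition pum_patch (P : pum) (i : 'I_(npatch P)) : set (plane R) :=
  open_rect (patch_lo i) (patch_hi i).

Definition flat_region (P : pum) (i : 'I_(npatch P)) : set (plane R) :=
  [set x | pum_patch i x /\ pu i x = 1].

(* N_h *)
Definition nodes (P : pum) : set (plane R) :=
  [set p | exists i : 'I_(npatch P), p \in locnodes i].

(* V_h = \sum_i phi_i V_i, as functions on D extended by zero *)
Definition gfe_space (D : set (plane R)) (P : pum) : set (plane R -> R) :=
  [set v | exists2 q : 'I_(npatch P) -> plane R -> R,
     (forall i, locspace i (q i)) &
     v = patch (cst 0) D (fun x => \sum_i pu i x * q i x)].

Definition loc_interp (P : pum) (i : 'I_(npatch P)) (zeta : plane R -> R) :
    plane R -> R :=
  xget (cst 0) [set q | locspace i q /\ {in locnodes i, q =1 zeta}].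

(* Pi_h *)
Definition interp (D : set (plane R)) (P : pum) (zeta : plane R -> R) :
    plane R -> R :=
  patch (cst 0) D
    (fun x => \sum_(i < npatch P) loc_interp i zeta x * pu i x).

Definition flat_top (f : R -> R) : Prop :=
  (forall t, 0 <= f t <= 1) /\
  exists a b, a < b /\ forall t, a <= t <= b -> f t = 1.

Definition biquadratic (q : plane R -> R) : Prop :=
  exists c : 'M[R]_3,
    q = fun x => \sum_(k < 3) \sum_(l < 3) c k l * x.1 ^+ k * x.2 ^+ l.

Definition lin_subspace (V : set (plane R -> R)) : Prop :=
  V 0 /\ forall (c : R) u v, V u -> V v -> V (c *: u + v).

Definition is_local_space (D : set (plane R)) (P : pum) (i : 'I_(npatch P)) :
    Prop :=
  [/\ lin_subspace (locspace i),
      forall q, locspace i q -> biquadratic q,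
      (* v = 0 and grad v = 0 on the boundary of D *)
      forall q, locspace i q -> forall x, pum_patch i x -> boundary D x ->
        q x = 0 /\ forall j, 'D_(unit_dir R j) q x = 0,
      forall p, p \in locnodes i -> flat_region i p /\ D p &
      uniq (locnodes i) /\
      (* the nodal values are degrees of freedom of V_i *)
      forall c : plane R -> R,
        exists! q, locspace i q /\ {in locnodes i, q =1 c}].

Definition is_pum (D : set (plane R)) (K h : R) (P : pum) : Prop :=
  [/\ closure D `<=` \bigcup_i @pum_patch P i,
      forall i : 'I_(npatch P), equiv_upto K (diam (pum_patch i)) h,
      forall i : 'I_(npatch P),
        [/\ W2oo (pu i), forall x, 0 <= pu i x,
            exists f g, [/\ flat_top f, flat_top g &
                            forall x, pu i x = f x.1 * g x.2],
            supp_fun (pu i) `<=` pum_patch i &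
            forall m, (m <= 2)%N ->
              (Wsemi setT m (pu i) <= (K * diam (pum_patch i) ^- m)%:E)%E],
      forall x, D x -> \sum_(i < npatch P) pu i x = 1 &
      (forall i, @is_local_space D P i) /\ gfe_space D P `<=` H20 D].

(* the known properties of the discretization: interpolation error, discrete
   L_2 norm, inverse estimates *)
Definition pum_estimates (D : set (plane R)) (K h : R) (P : pum) : Prop :=
  [/\ forall zeta, H20 D zeta ->
        (\sum_(m < 2) h ^+ m * Hsemi D m (fun x => zeta x - interp D P zeta x))
        + h ^+ 2 * Hsemi D 2 (interp D P zeta)
        <= K * h ^+ 2 * Hsemi D 2 zeta,
      forall v, gfe_space D P v ->
        equiv_upto K (L2norm D v ^+ 2) (h ^+ 2 * \sum_(p \in nodes P) v p ^+ 2) &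
      forall v, gfe_space D P v -> forall m, (1 <= m <= 2)%N ->
        Hsemi D m v <= K * h ^- m * L2norm D v].

Definition pum_discretization (D : set (plane R)) (K h : R) (P : pum) : Prop :=
  is_pum D K h P /\ pum_estimates D K h P.

(* \tilde V_h *)
Definition trunc_space (D : set (plane R)) (P : pum) (N : set (plane R)) :
    set (plane R -> R) :=
  [set v | gfe_space D P v /\ forall p, nodes P p -> ~ N p -> v p = 0].

(* \tilde T_h *)
Definition truncation (D : set (plane R)) (P : pum) (N : set (plane R))
    (v : plane R -> R) : plane R -> R :=
  xget (cst 0) [set w | gfe_space D P w /\
    forall p, nodes P p -> (N p -> w p = v p) /\ (~ N p -> w p = 0)].

End PUM.

Section Schwarz.
Variable R : realType.

Definition overlapping_decomposition (D : set (plane R)) (K : R) (Nc : nat)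
    (H delta : R) (P : pum R) (J : nat) (sub : 'I_J -> set (plane R))
    (psi : 'I_J -> plane R -> R) : Prop :=
  [/\ forall j, polygonal_domain (sub j) /\ equiv_upto K (diam (sub j)) H,
      \bigcup_j sub j = D,
      forall x, D x -> (#|[pred j | `[< sub j x >]]| <= Nc)%N,
      (* alignment with the patches *)
      forall j, boundary (sub j) `<=`
        boundary D `|` \bigcup_i boundary (@pum_patch R P i) &
      [/\ forall x, closure D x -> \sum_j psi j x = 1,
          forall j x, 0 <= psi j x,
          forall j x, D x -> ~ closure (sub j) x -> psi j x = 0 &
          forall j, W2oo (psi j) /\
            forall k, (k <= 2)%N ->
              (Wsemi D k (psi j) <= (K * delta ^- k)%:E)%E]].

(* \tilde V_j for 1 <= j <= J *)
Definition local_trunc_space (D : set (plane R)) (P : pum R)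
    (N Dj : set (plane R)) : set (plane R -> R) :=
  [set v | trunc_space D P N v /\ forall p, nodes P p -> ~ Dj p -> v p = 0].

(* \tilde V_0 = \tilde T_h Pi_h V_H *)
Definition coarse_trunc_space (D : set (plane R)) (P PH : pum R)
    (N : set (plane R)) : set (plane R -> R) :=
  truncation D P N @` (interp D P @` gfe_space D PH).

(* A functional on a subspace V of functions is encoded as a function
   (plane R -> R) -> R with value 0 outside V, two functionals on V being then
   equal iff they agree on V. In particular restricting a functional to V is
   the transpose of the natural injection of V. *)
Definition restr_dual (V : set (plane R -> R)) (g : (plane R -> R) -> R) :
    (plane R -> R) -> R := patch (cst 0) V g.

(* <A v, w> = a(v, w) for w in V *)
Definition Aop (D : set (plane R)) (V : set (plane R -> R)) (v : plane R -> R) :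
    (plane R -> R) -> R := restr_dual V (aform D v).

Definition Ainv (D : set (plane R)) (V : set (plane R -> R)) :
    ((plane R -> R) -> R) -> plane R -> R := 'pinv_(fun=> 0) V (Aop D V).

(* B_TL = \sum_(0 <= j <= J) I_j A_j^{-1} I_j^t *)
Definition B_TL (D : set (plane R)) (V0 : set (plane R -> R)) (J : nat)
    (V : 'I_J -> set (plane R -> R)) (g : (plane R -> R) -> R) : plane R -> R :=
  Ainv D V0 (restr_dual V0 g) + \sum_j Ainv D (V j) (restr_dual (V j) g).

(* B_TL \tilde A_h : \tilde V_h -> \tilde V_h *)
Definition precond_op (D : set (plane R)) (P PH : pum R) (N : set (plane R))
    (J : nat) (sub : 'I_J -> set (plane R)) (v : plane R -> R) : plane R -> R :=
  B_TL D (coarse_trunc_space D P PH N)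
    (fun j => local_trunc_space D P N (sub j))
    (Aop D (trunc_space D P N) v).

Definition is_eigenvalue (V : set (plane R -> R))
    (T : (plane R -> R) -> plane R -> R) (l : R) : Prop :=
  exists v, [/\ V v, v <> 0 & T v = l *: v].

Definition is_lambda_max V T (l : R) : Prop :=
  is_eigenvalue V T l /\ forall l', is_eigenvalue V T l' -> l' <= l.

Definition is_lambda_min V T (l : R) : Prop :=
  is_eigenvalue V T l /\ forall l', is_eigenvalue V T l' -> l <= l'.

End Schwarz.

(* Main.v *)
(** Additive Schwarz theory reduces the bound to two facts.  First, the energy
    of a sum of local components is at most M times the sum of their energies,
    where M bounds the number of components whose second derivatives are
    non-zero at a point; this gives lambda_max <= 2 + 2 M.  The bound on M needs
    nodes to be separated by a multiple of h: a nodal basis function jumps by 1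
    between two nodes although the inverse estimates control it in H^1 and H^2,
    and a Hoelder inequality for test functions turns the jump into a distance.

    Second, every v splits as v_0 + sum_j v_j with total energy at most C0
    a(v, v); this gives lambda_min >= 1 / C0.  Taking v_0 to be the truncated
    interpolant of the coarse interpolant of v, and v_j with the nodal values of
    psi_j (v - v_0), the inverse estimates give C0 = C (H / h)^4.  Taking v_0 = 0
    and v_j the interpolant of psi_j v gives C0 = C delta^-4.  Here psi_j v need
    not be in H^2_0 in any convenient way, so v is replaced by a close test
    function phi and psi_j by its convolution with a smooth bump: the product is
    a test function, the derivatives of the convolution inherit the bounds on
    the weak derivatives of psi_j, and the Poincare inequality absorbs the lower
    order terms.  Nodal values survive the passage from v to phi because the
    interpolation estimate, applied to v - phi, controls them; no Sobolev
    embedding is used. *)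
Require Import Defs.
From HB Require Import structures.
From mathcomp Require Import all_boot all_order all_algebra.
From mathcomp Require Import all_classical all_reals all_analysis.
From mathcomp Require Import ess_sup_inf measurable_realfun.
From mathcomp Require Import ring lra.
Set Implicit Arguments.
Unset Strict Implicit.
Unset Printing Implicit Defensive.
Import Order.TTheory GRing.Theory Num.Theory numFieldNormedType.Exports.
Local Open Scope classical_set_scope.
Local Open Scope ring_scope.

(** * Boxes, measurability and integrability in the plane *)

Section PlaneMeasure.
Variable R : realType.
Local Notation T2 := (measurableTypeR R * measurableTypeR R)%type.

(** The obstacle is uniformity in [J]: sums over subdomains may cost [Nc] but never [J], although
    neither construction respects the subdomains. Interpolation spreads a function with nodes in D_j
    over every patch carrying such a node, so overlap is counted through the nodes near a point,
    each of which lies in at most [Nc] subdomains. Convolution enlarges supports as well; a duality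
    argument still bounds the sum over j of squared derivatives at a point by [Nc] times the squared
    bound of one derivative, because the multiplicity is used under the integral, for the weak
    derivatives of psi_j themselves. It holds there almost everywhere since, inside the domain, the
    subdomain boundaries lie on patch boundaries, which are null sets. [J] does enter the accuracy
    of mollification at the nodes, but that error tends to 0 while [J] and h are fixed. The extreme
    eigenvalues come from finite-dimensional coordinates: in the nodal basis the preconditioned
    operator is a sum of projections orthogonal for the stiffness matrix, hence self-adjoint for it,
    and Rayleigh quotients attain their extrema on a compact sphere. *)

Definition cbox (a b : plane R) : set (plane R) := `[a.1, b.1] `*` `[a.2, b.2].

Lemma cboxP (a b x : plane R) :
  cbox a b x <-> (a.1 <= x.1 <= b.1) /\ (a.2 <= x.2 <= b.2).
Proof. by rewrite /cbox /= !in_itv /=. Qed.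

Lemma open_rect_sub_cbox (a b : plane R) : open_rect a b `<=` cbox a b.
Proof.
move=> x /andP[/andP[h1 h2] /andP[h3 h4]]; apply/cboxP.
by rewrite !ltW.
Qed.

(** Rational boxes form a countable base. The closed boxes stay inside the set while the open ones
    already cover it, so local integrability is available on each of them. *)
Lemma open_bigcup_rect (A : set (plane R)) : open A ->
  exists a b : nat -> plane R,
    (forall k, cbox (a k) (b k) `<=` A) /\
    A `<=` \bigcup_k open_rect (a k) (b k).
Proof.
move=> oA.
(* Codes that decode to nothing, and boxes that leave [A], are replaced by the empty box with lower
   corner (1, 1) and upper corner (0, 0). *)
pose q (k : nat) : plane R * plane R :=
  if (unpickle k : option (rat * rat * (rat * rat))%type) is Some (a, b) then
    ((ratr a.1, ratr a.2), (ratr b.1, ratr b.2)) else ((1, 1), (0, 0)).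
pose q' k := if `[< cbox (q k).1 (q k).2 `<=` A >] then q k
             else ((1, 1), (0, 0)).
exists (fun k => (q' k).1), (fun k => (q' k).2); split.
  move=> k; rewrite /q'; case: asboolP => // _ x /cboxP /= [/andP[h1 h2] _].
  by have := le_trans h1 h2; rewrite ler10.
move=> x Ax; have [e /= e0 eA] := (proj1 (@nbhs_ballP _ _ _ _)) (oA _ Ax).
have rr (t : R) : exists c d : rat, [/\ t - e < ratr c, ratr c < t, t < ratr d & ratr d < t + e].
  have tl : t - e < t by rewrite ltrBlDr ltrDl.
  have tr : t < t + e by rewrite ltrDl.
  have [c] := rat_in_itvoo tl.
  rewrite in_itv /= => /andP[c1 c2].
  have [d] := rat_in_itvoo tr.
  by rewrite in_itv /= => /andP[d1 d2]; exists c, d.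
have [c1 [d1 [h1 h2 h3 h4]]] := rr x.1.
have [c2 [d2 [g1 g2 g3 g4]]] := rr x.2.
exists (pickle ((c1, c2), (d1, d2))) => //.
have qE : q (pickle ((c1, c2), (d1, d2))) =
  ((ratr c1, ratr c2), (ratr d1, ratr d2)) by rewrite /q pickleK.
rewrite /q' qE; case: asboolP => [_|]; first by rewrite /open_rect /= h2 h3 g2 g3.
case=> y /cboxP /= [/andP[y1 y2] /andP[y3 y4]]; apply: eA.
split => /=; rewrite -ball_normE /ball_ /=.
  by rewrite ltr_distlC; apply/andP; split; [apply: lt_le_trans y1|apply: le_lt_trans y2 _].
by rewrite ltr_distlC; apply/andP; split; [apply: lt_le_trans y3|apply: le_lt_trans y4 _].
Qed.

Lemma cbox_measurable (a b : plane R) : measurable (cbox a b : set T2).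
Proof. by apply: measurableX; exact: measurable_itv. Qed.

Lemma open_rectE (a b : plane R) : open_rect a b = `]a.1, b.1[ `*` `]a.2, b.2[.
Proof.
by apply/seteqP; split => [x /andP[h1 h2]|x [/= h1 h2]]; [split|apply/andP; split];
  rewrite /= ?in_itv //; move: h1 h2; rewrite /= !in_itv.
Qed.

Lemma open_rect_measurable (a b : plane R) : measurable (open_rect a b : set T2).
Proof. by rewrite open_rectE; apply: measurableX; exact: measurable_itv. Qed.

Lemma cbox_compact (a b : plane R) : compact (cbox a b).
Proof. by apply: compact_setX; exact: segment_compact. Qed.

(** The product sigma-algebra is generated by products of measurable sets; an open set belongs to it
    as a countable union of boxes. *)
Lemma open_measurable2 (A : set (plane R)) : open A -> measurable (A : set T2).
Proof.
move=> /open_bigcup_rect[a [b [h1 h2]]].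
have -> : A = \bigcup_k cbox (a k) (b k).
  apply/seteqP; split => [x /h2[k _ kx]|x [k _ /h1]//].
  by exists k => //; exact: open_rect_sub_cbox.
by apply: bigcup_measurable => k _; exact: cbox_measurable.
Qed.

Lemma closed_measurable2 (A : set (plane R)) : closed A -> measurable (A : set T2).
Proof.
by move=> /closed_openC /open_measurable2 /measurableC; rewrite setCK.
Qed.

Lemma compact_measurable2 (A : set (plane R)) : compact A -> measurable (A : set T2).
Proof. by move=> /compact_closed cA; apply: closed_measurable2; apply: cA; exact: norm_hausdorff. Qed.

Lemma continuous_measurable2 (f : plane R -> R) (D : set T2) : measurable D ->
  continuous f -> measurable_fun D (f : T2 -> R).
Proof.
move=> mD cf; apply: (@measurable_funS _ _ _ _ setT) => //.
apply: (measurability _ (RGenOpens.measurableE R)) => //= _ [_ [a [b ->] <-]].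
rewrite setTI; apply: open_measurable2.
by move/continuousP : cf; apply; exact: interval_open.
Qed.

Lemma cbox_mu2_fin (a b : plane R) : (mu2 (cbox a b : set T2) < +oo)%E.
Proof.
have -> : mu2 (cbox a b : set T2) =
    (lebesgue_measure (`[a.1, b.1] : set R) * lebesgue_measure (`[a.2, b.2] : set R))%E.
  by apply: product_measure1E; exact: measurable_itv.
rewrite !lebesgue_measure_itv /=.
by case: ifP => _; case: ifP => _; rewrite ?mul0e ?mule0 ?ltry // -!EFinB -EFinM ltry.
Qed.

Lemma compact_sub_cbox (A : set (plane R)) : bounded_set A ->
  exists2 L : R, 0 < L & A `<=` cbox (- L, - L) (L, L).
Proof.
move=> [M [Mr hM]]; exists (`|M| + 1); first by rewrite ltr_wpDl.
move=> x Ax; have := hM (`|M| + 1); rewrite ltr_pwDr ?ler_norm //.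
move=> /(_ isT x Ax) /=; rewrite prod_normE /= ge_max => /andP[h1 h2].
by apply/cboxP => /=; rewrite -!ler_norml.
Qed.

Lemma compact_mu2_fin (A : set (plane R)) : compact A -> (mu2 (A : set T2) < +oo)%E.
Proof.
move=> cA; have [L L0 AL] := compact_sub_cbox (compact_bounded cA).
apply: le_lt_trans (cbox_mu2_fin (- L, - L) (L, L)).
by apply: le_measure => //; rewrite inE; [exact: compact_measurable2|exact: cbox_measurable].
Qed.

Lemma compact_integrable (A : set (plane R)) (f : plane R -> R) : compact A ->
  continuous f -> mu2.-integrable (A : set T2) (EFin \o f).
Proof.
move=> cA cf; have mA := compact_measurable2 cA.
apply: measurable_bounded_integrable => //; first exact: compact_mu2_fin.
  exact: continuous_measurable2.
have : compact (f @` A) by apply: continuous_compact => //; apply: continuous_subspaceT.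
move=> /compact_bounded [M [Mr hM]]; exists M; split => // y My x Ax /=.
by apply: (hM y My); exists x.
Qed.

End PlaneMeasure.

(** * Smooth functions of one variable and a smooth step *)

Section Smooth1.
Variable R : realType.
Implicit Types f g : R -> R.

(** The derivative is quantified existentially rather than computed by [derive1], so an induction on
    [n] can supply an explicit formula for it. *)
Fixpoint Cn1 (n : nat) f : Prop :=
  if n is m.+1 then exists2 f', (forall t : R, is_derive t 1 f (f' t)) & Cn1 m f'
  else True.

Definition smooth1 f := forall n, Cn1 n f.

Lemma Cn1W n f : Cn1 n.+1 f -> Cn1 n f.
Proof.
elim: n f => [//|n IH] f [f' h1 h2]; exists f' => //; exact: IH.
Qed.

Lemma derive1_ext f g : (forall t : R, is_derive t 1 f (g t)) -> (derive1 f) = g.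
Proof. by move=> h; apply/funext => t; rewrite derive1E; have -> := @derive_val _ _ _ _ _ _ _ (h t). Qed.

Lemma smooth1_derive1 f : smooth1 f -> smooth1 (derive1 f).
Proof. by move=> h n; have [f' h1 h2] := h n.+1; rewrite (derive1_ext h1). Qed.

Lemma smooth1_is_derive f (t : R) : smooth1 f -> is_derive t 1 f ((derive1 f) t).
Proof. by move=> h; have [f' h1 h2] := h 1%N; rewrite (derive1_ext h1). Qed.

Lemma smooth1S f g : (forall t : R, is_derive t 1 f (g t)) -> smooth1 g -> smooth1 f.
Proof. by move=> h1 h2 [//|n]; exists g. Qed.

Lemma smooth1_continuous f : smooth1 f -> continuous f.
Proof.
move=> sf t; apply: differentiable_continuous; apply/derivable1_diffP.
exact: (@ex_derive _ _ _ _ _ _ _ (smooth1_is_derive t sf)).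
Qed.

Lemma smooth1_cst (c : R) : smooth1 (fun=> c).
Proof.
move=> n; elim: n c => [//|n IH] c; exists (fun=> 0) => // t; exact: is_derive_cst.
Qed.

Lemma smooth1_id : smooth1 (fun t : R => t).
Proof.
by apply: (@smooth1S _ (fun=> 1)); exact: smooth1_cst.
Qed.

Lemma Cn1D n f g : Cn1 n f -> Cn1 n g -> Cn1 n (fun t => f t + g t).
Proof.
elim: n f g => [//|n IH] f g [f' f1 f2] [g' g1 g2].
exists (fun t => f' t + g' t); last exact: IH.
by move=> t; apply: is_deriveD.
Qed.

Lemma is_derive_mul f g (t df dg : R) : is_derive t 1 f df -> is_derive t 1 g dg ->
  is_derive t 1 (fun t => f t * g t) (f t * dg + df * g t).
Proof.
move=> h1 h2; have h := @is_deriveM _ _ f g t 1 _ _ h1 h2.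
by apply: (is_derive_eq h); rewrite /GRing.scale /= [g t * _]mulrC.
Qed.

Lemma Cn1M n f g : Cn1 n f -> Cn1 n g -> Cn1 n (fun t => f t * g t).
Proof.
elim: n f g => [//|n IH] f g F G; have F0 := Cn1W F; have G0 := Cn1W G.
case: F G => [f' f1 f2] [g' g1 g2].
exists (fun t => f t * g' t + f' t * g t); last by apply: Cn1D; exact: IH.
by move=> t; exact: is_derive_mul.
Qed.

Lemma smooth1M f g : smooth1 f -> smooth1 g -> smooth1 (fun t => f t * g t).
Proof. by move=> h1 h2 n; apply: Cn1M. Qed.

Lemma smooth1Z (c : R) f : smooth1 f -> smooth1 (fun t => c * f t).
Proof. by move=> h; apply: smooth1M => //; exact: smooth1_cst. Qed.

Lemma is_derive_affine f (df a b t : R) : is_derive (a * t + b) 1 f df ->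
  is_derive t 1 (fun t => f (a * t + b)) (a * df).
Proof.
move=> h; rewrite mulrC.
apply: (@is_derive1_comp _ f (fun t => a * t + b)) => //.
by apply: is_derive_eq; rewrite addr0 /GRing.scale /= mulr1.
Qed.

Lemma Cn1_affine n f (a b : R) : Cn1 n f -> Cn1 n (fun t => f (a * t + b)).
Proof.
elim: n f => [//|n IH] f [f' f1 f2]; exists (fun t => a * f' (a * t + b)).
  by move=> t; exact: is_derive_affine.
by apply: Cn1M; [exact: smooth1_cst|exact: IH].
Qed.

Lemma smooth1_affine f (a b : R) : smooth1 f -> smooth1 (fun t => f (a * t + b)).
Proof. by move=> h n; apply: Cn1_affine. Qed.

Lemma derive1_affine f (a b : R) : smooth1 f ->
  derive1 (fun t => f (a * t + b)) = fun t => a * (derive1 f) (a * t + b).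
Proof.
move=> sf; apply: derive1_ext => t; apply: is_derive_affine; exact: smooth1_is_derive.
Qed.

(* The family t^-k exp(-1/t) (t > 0) is closed under differentiation. *)
Definition flat_exp (k : nat) (t : R) : R :=
  if 0 < t then t ^- k * expR (- t^-1) else 0.

Lemma flat_exp_ge0 k t : 0 <= flat_exp k t.
Proof.
by rewrite /flat_exp; case: ifP => // t0; rewrite mulr_ge0 ?expR_ge0 // invr_ge0 exprn_ge0 // ltW.
Qed.

(** By its series, the exponential at 1/t exceeds the term of degree k + 1. The resulting linear
    decay at 0 is all that differentiability there requires. *)
Lemma flat_exp_bound k t : flat_exp k t <= (k.+1)`!%:R * `|t|.
Proof.
rewrite /flat_exp; case: ifP => t0; last by rewrite mulr_ge0.
rewrite (gtr0_norm t0) expRN ler_pdivrMr ?expR_gt0 //.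
have := @expR_ge1Dxn _ t^-1 k; rewrite invr_ge0 (ltW t0) => /(_ isT) h.
have h' : t^-1 ^+ k.+1 / (k.+1)`!%:R <= expR t^-1 by apply: le_trans h; rewrite lerDr.
have f0 : 0 < (k.+1)`!%:R :> R by rewrite ltr0n fact_gt0.
have tf : 0 <= (k.+1)`!%:R * t by rewrite mulr_ge0 // ltW.
apply: le_trans (ler_wpM2l tf h').
rewrite exprS exprVn [X in _ <= X](_ : _ = t ^- k * (t * t^-1) * ((k.+1)`!%:R / (k.+1)`!%:R)); last by ring.
by rewrite !divff ?gt_eqF // !mulr1.
Qed.

Lemma flat_exp_is_derive (k : nat) (t : R) :
  is_derive t 1 (flat_exp k) (- k%:R * flat_exp k.+1 t + flat_exp k.+2 t : R).
Proof.
have [t0|t0|<-] := ltgtP 0 t.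
- have hV : is_derive t 1 (fun t : R => t^-1) (- t^-1 ^+ 2).
    have t0' : id t != 0 by rewrite gt_eqF.
    have := is_deriveV t0' (is_derive_id t 1) => /is_derive_eq; apply.
    by rewrite /GRing.scale /= mulr1 exprVn.
  have hN : is_derive t 1 (fun t : R => - t^-1) (t^-1 ^+ 2).
    by have := is_deriveN hV => /is_derive_eq; apply; rewrite opprK.
  have hX : is_derive t 1 (fun t : R => t^-1 ^+ k) (k%:R * t^-1 ^+ k.-1 * - t^-1 ^+ 2).
    have := is_deriveX k hV => /is_derive_eq.
    have -> : (fun t : R => t^-1 ^+ k) = (fun t : R => t^-1) ^+ k.
      by apply/funext => y; rewrite fctE.
    apply.
    by rewrite /GRing.scale /= -mulr_natl.
  have hE := @is_derive1_comp _ expR _ t _ _ (is_derive_expR _) hN.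
  have hM := is_derive_mul hX hE.
  have : is_derive t 1 (flat_exp k) (t^-1 ^+ k * (expR (- t^-1) * t^-1 ^+ 2) +
        k%:R * t^-1 ^+ k.-1 * - t^-1 ^+ 2 * (expR \o (fun t0 => - t0^-1)) t).
    apply: near_eq_is_derive hM.
    near=> y; rewrite /flat_exp ifT ?exprVn //.
    by near: y; apply: lt_nbhsr.
  move=> /is_derive_eq; apply.
  rewrite /flat_exp t0 /= -!exprVn.
  by case: k {hX hM} => [|k] /=; rewrite !exprS ?expr0; ring.
- have h0 := @is_derive_cst _ R R (0 : R) t 1.
  have : is_derive t 1 (flat_exp k) (0 : R).
    apply: near_eq_is_derive h0.
    near=> y; rewrite /flat_exp ifF //; apply/negbTE; rewrite -leNgt ltW //.
    by near: y; apply: lt_nbhsl.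
  move=> /is_derive_eq; apply.
  by rewrite /flat_exp !ifF ?mulr0 ?addr0 //; apply/negbTE; rewrite -leNgt ltW.
(* At 0 the difference quotient of [flat_exp k] is [flat_exp k.+1], which the linear bound sends to
   0. *)
- have e0 j : flat_exp j 0 = 0 by rewrite /flat_exp ltxx.
  rewrite !e0 mulr0 addr0.
  have hl : (fun h => h^-1 *: (flat_exp k (h *: (1 : R) + 0) - flat_exp k 0)) x @[x --> 0^'] --> (0 : R).
    apply/cvgrPdist_le => /= e e_gt0.
    have M0 : 0 < (k.+2)`!%:R :> R by rewrite ltr0n fact_gt0.
    near=> h; rewrite e0 addr0 subr0 sub0r normrN /GRing.scale /= mulr1.
    have -> : h^-1 * flat_exp k h = flat_exp k.+1 h.
      rewrite /flat_exp; case: ifP => h0; last by rewrite mulr0.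
      by rewrite mulrA -!exprVn exprS.
    rewrite ger0_norm ?flat_exp_ge0 //; apply: le_trans (flat_exp_bound _ _) _.
    rewrite mulrC -ler_pdivlMr //.
    by near: h; apply: dnbhs0_le; rewrite divr_gt0.
  apply: DeriveDef; first by apply/cvg_ex; exists 0.
  exact: cvg_lim.
Unshelve. all: end_near.
Qed.

Lemma smooth1_flat_exp k : smooth1 (flat_exp k).
Proof.
move=> n; elim: n k => [//|n IH] k.
exists (fun t => - k%:R * flat_exp k.+1 t + flat_exp k.+2 t); first exact: flat_exp_is_derive.
by apply: Cn1D => //; apply: Cn1M => //; exact: smooth1_cst.
Qed.

Lemma is_derive_continuous (F f : R -> R) :
  (forall t : R, is_derive t 1 F (f t)) -> continuous F.
Proof.
move=> h t; apply: differentiable_continuous; apply/derivable1_diffP.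
exact: (@ex_derive _ _ _ _ _ _ _ (h t)).
Qed.

Lemma MVT_ex (F f : R -> R) (a b : R) : a <= b ->
  (forall t : R, is_derive t 1 F (f t)) ->
  exists2 c, a <= c <= b & F b - F a = f c * (b - a).
Proof.
rewrite le_eqVlt => /orP[/eqP <-|ab] h.
  by exists a; rewrite ?lexx // !subrr mulr0.
have hc : {within `[a, b], continuous F}.
  by apply: continuous_subspaceT; exact: is_derive_continuous h.
have hd (x : R) : x \in `]a, b[ -> is_derive x 1 F (f x) by move=> _.
have [c] := MVT ab hd hc.
by rewrite in_itv /= => /andP[/ltW h1 /ltW h2] ->; exists c; rewrite ?h1.
Qed.

Lemma antiderivative (f : R -> R) : continuous f -> (forall t : R, t <= 0 -> f t = 0) ->
  exists F : R -> R, (forall t : R, is_derive t 1 F (f t)) /\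
    (forall t : R, t <= 0 -> F t = 0).
Proof.
(* Any negative lower limit would do: [f] vanishes up to 0, and for [t] at most -1 the function [F]
   is locally 0. *)
move=> cf f0; pose F (t : R) := \int[lebesgue_measure]_(x in `[-1, t]) f x.
have F0 (t : R) : t <= 0 -> F t = 0.
  move=> t0; rewrite /F (_ : Rintegral _ _ _ = \int[lebesgue_measure]_(x in `[-1, t]) (cst 0) x).
    by rewrite Rintegral_cst ?measurable_itv // mul0r.
  apply: eq_Rintegral => x; rewrite inE /= in_itv /= => /andP[_ xt].
  by rewrite f0 // (le_trans xt).
exists F; split=> // t.
have [t1|t1] := ltP (-1) t.
  have t2 : t < t + 1 by rewrite ltrDl.
  have hI : lebesgue_measure.-integrable `[-1, t + 1] (EFin \o f).
    apply: continuous_compact_integrable; first exact: segment_compact.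
    exact: continuous_subspaceT.
  have hl : (BLeft (-1)%R < BRight t)%E by rewrite lte_fin.
  have [d1 d2] := continuous_FTC1 t2 hI hl (cf t).
  by rewrite -d2 derive1E; apply: derivableP.
have h0 := @is_derive_cst _ R R (0 : R) t 1.
rewrite f0; last by apply: le_trans t1 _; rewrite lerN10.
apply: near_eq_is_derive h0.
near=> y; rewrite F0 //; apply: ltW; near: y; apply: lt_nbhsl.
by apply: le_lt_trans t1 _; rewrite ltrN10.
Unshelve. all: end_near.
Qed.

(** The antiderivative of the bump exp(-1/t) exp(-1/(1-t)) on ]0, 1[, divided by its total mass.
    Monotonicity is recorded because it makes the derivative a nonnegative mollifier density. *)
Lemma step_exists : exists th : R -> R, [/\ smooth1 th,
  forall t : R, t <= 0 -> th t = 0, forall t : R, 1 <= t -> th t = 1 &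
  forall s t : R, s <= t -> th s <= th t].
Proof.
pose b (t : R) := flat_exp 0 t * flat_exp 0 (- 1 * t + 1).
have sb : smooth1 b.
  by apply: smooth1M; [|apply: smooth1_affine]; exact: smooth1_flat_exp.
have b_ge0 (t : R) : 0 <= b t by rewrite mulr_ge0 ?flat_exp_ge0.
have e0 (t : R) : t <= 0 -> flat_exp 0 t = 0 by move=> t0; rewrite /flat_exp ifF // le_gtF.
have egt0 (t : R) : 0 < t -> 0 < flat_exp 0 t.
  by move=> t0; rewrite /flat_exp t0 expr0 invr1 mul1r expR_gt0.
have b0 (t : R) : t <= 0 -> b t = 0 by move=> /e0 h; rewrite /b h mul0r.
have b1 (t : R) : 1 <= t -> b t = 0 by move=> h; rewrite /b [X in _ * X]e0 ?mulr0 //; lra.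
have [F [dF F0]] := antiderivative (smooth1_continuous sb) b0.
have Fm (s t : R) : s <= t -> F s <= F t.
  move=> st; have [c _ h] := MVT_ex st dF.
  by rewrite -subr_ge0 h mulr_ge0 ?subr_ge0.
have F1 (t : R) : 1 <= t -> F t = F 1.
  move=> t1; have [c /andP[c1 _] h] := MVT_ex t1 dF.
  by move: h; rewrite b1 // mul0r => /eqP; rewrite subr_eq0 => /eqP.
(* The mass is positive since the bump is positive on the interval [1/4, 1/2]. *)
have F1_gt0 : 0 < F 1.
  have h12 : 4^-1 <= 2^-1 :> R by lra.
  have [c c12 h] := MVT_ex h12 dF.
  have F4 : 0 <= F 4^-1 by rewrite -(F0 0) // Fm //; lra.
  have F2 : F 2^-1 <= F 1 by rewrite Fm //; lra.
  have bc : 0 < b c by rewrite /b mulr_gt0 ?egt0 //; lra.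
  by apply: lt_le_trans F2; apply: le_lt_trans F4 _; rewrite -subr_gt0 h mulr_gt0 //; lra.
exists (fun t : R => (F 1)^-1 * F t); split.
- by apply: smooth1Z; apply: smooth1S sb.
- by move=> t /F0 ->; rewrite mulr0.
- by move=> t /F1 ->; rewrite mulVf // gt_eqF.
- by move=> s t st; rewrite ler_wpM2l ?Fm // invr_ge0 ltW.
Qed.

Definition step : R -> R := sval (cid step_exists).

Lemma smooth1_step : smooth1 step.
Proof. by rewrite /step; case: cid => th /= []. Qed.

Lemma step_le0 (t : R) : t <= 0 -> step t = 0.
Proof. by rewrite /step; case: cid => th /= [_ h _ _]; exact: h. Qed.

Lemma step_ge1 (t : R) : 1 <= t -> step t = 1.
Proof. by rewrite /step; case: cid => th /= [_ _ h _]; exact: h. Qed.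

Lemma step_homo (s t : R) : s <= t -> step s <= step t.
Proof. by rewrite /step; case: cid => th /= [_ _ _ h]; exact: h. Qed.

Lemma step_itv01 (t : R) : 0 <= step t <= 1.
Proof.
have [t0|/ltW t0] := leP t 0; first by rewrite step_le0 ?lexx ?ler01.
have [t1|/ltW t1] := leP 1 t; first by rewrite step_ge1 ?lexx ?ler01.
by rewrite -{1}(step_le0 (lexx 0)) -(step_ge1 (lexx 1)) !step_homo.
Qed.

End Smooth1.

(** * Smooth functions and test functions of two variables *)

Section Smooth2.
Variable R : realType.
Implicit Types (F G : plane R -> R) (f g : R -> R) (x : plane R) (s : seq 'I_2).
Local Notation e := (unit_dir R).

(** Smoothness graded by the order of differentiation, which makes closure under sums and products
    provable by induction; [smooth] itself quantifies over whole words of directions. *)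
Fixpoint Cn2 (n : nat) F : Prop :=
  (forall x, differentiable F x) /\
  (if n is m.+1 then forall i, Cn2 m ('D_(e i) F) else True).

Lemma smooth_derive F i : smooth F -> smooth ('D_(e i) F).
Proof.
by move=> h s x; have := h (rcons s i) x; rewrite /pderiv -cats1 foldr_cat.
Qed.

Lemma smooth_pderiv F s : smooth F -> smooth (pderiv s F).
Proof. by move=> h; elim: s => [//|i s IH] /=; exact: smooth_derive. Qed.

Lemma smooth_differentiable F x : smooth F -> differentiable F x.
Proof. by move=> h; exact: (h [::]). Qed.

Lemma smooth_continuous F : smooth F -> continuous F.
Proof. by move=> h x; apply: differentiable_continuous; exact: smooth_differentiable. Qed.

Lemma smooth_derivable F x v : smooth F -> derivable F x v.
Proof. by move=> h; apply: diff_derivable; exact: smooth_differentiable. Qed.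

Lemma smoothP F : smooth F <-> forall n, Cn2 n F.
Proof.
split => [h n|h s].
  elim: n F h => [|n IH] F h /=; split=> //; do ?by move=> x; exact: smooth_differentiable.
  by move=> i; apply: IH; exact: smooth_derive.
elim/last_ind: s F h => [|s i IH] F h x; first by case: (h 0%N).
rewrite /pderiv -cats1 foldr_cat; apply: (IH ('D_(e i) F)) => n.
by have [_ h'] := h n.+1; exact: h'.
Qed.

Lemma Cn2_diff n F x : Cn2 n F -> differentiable F x.
Proof. by case: n => [|n] []. Qed.

Lemma Cn2W n F : Cn2 n.+1 F -> Cn2 n F.
Proof.
elim: n F => [|n IH] F [h1 h2] //; split => // i; exact: IH.
Qed.

Lemma derive_add F G v : (forall x, differentiable F x) -> (forall x, differentiable G x) ->
  'D_v (fun x => F x + G x) = fun x => 'D_v F x + 'D_v G x.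
Proof.
move=> hF hG; apply/funext => x.
by apply: (@deriveD _ _ _ F G); exact: diff_derivable.
Qed.

Lemma derive_mul F G v : (forall x, differentiable F x) -> (forall x, differentiable G x) ->
  'D_v (fun x => F x * G x) = fun x => F x * 'D_v G x + 'D_v F x * G x.
Proof.
move=> hF hG; apply/funext => x.
have -> : 'D_v (fun x => F x * G x) x = F x *: 'D_v G x + G x *: 'D_v F x.
  by apply: (@deriveM _ _ F G); exact: diff_derivable.
by rewrite /GRing.scale /= [G x * _]mulrC.
Qed.

Lemma Cn2D n F G : Cn2 n F -> Cn2 n G -> Cn2 n (fun x => F x + G x).
Proof.
elim: n F G => [|n IH] F G [F1 F2] [G1 G2]; (split; first by move=> x; apply: differentiableD).
  by [].
by move=> i; rewrite derive_add //; apply: IH; [exact: F2|exact: G2].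
Qed.

Lemma Cn2M n F G : Cn2 n F -> Cn2 n G -> Cn2 n (fun x => F x * G x).
Proof.
elim: n F G => [|n IH] F G hF hG.
  by split => // x; apply: differentiableM; [exact: Cn2_diff hF|exact: Cn2_diff hG].
split => [x|i]; first by apply: differentiableM; [exact: Cn2_diff hF|exact: Cn2_diff hG].
rewrite derive_mul; [|by move=> x; exact: Cn2_diff hF|by move=> x; exact: Cn2_diff hG].
have [hF' hG'] := (Cn2W hF, Cn2W hG); case: hF hG => [_ hF] [_ hG].
by apply: Cn2D; apply: IH => //; [exact: hG|exact: hF].
Qed.

Lemma smoothD F G : smooth F -> smooth G -> smooth (fun x => F x + G x).
Proof. by move=> /smoothP h1 /smoothP h2; apply/smoothP => n; exact: Cn2D. Qed.

Lemma smoothM F G : smooth F -> smooth G -> smooth (fun x => F x * G x).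
Proof. by move=> /smoothP h1 /smoothP h2; apply/smoothP => n; exact: Cn2M. Qed.

(** [F] along the line through [x] parallel to axis [i]; the coordinate [i] of [x] is forgotten.
    Slices carry one-variable calculus over to partial derivatives. *)
Definition slice (i : 'I_2) F x (t : R) : R := if i == ord0 then F (t, x.2) else F (x.1, t).
Definition coord (i : 'I_2) x : R := if i == ord0 then x.1 else x.2.

Lemma derive_slice i F x : 'D_(e i) F x = derive1 (slice i F x) (coord i x).
Proof.
rewrite derive1E /derive; congr lim.
suff -> : (fun h => h^-1 *: (F (h *: e i + x) - F x)) =
   (fun h => h^-1 *: (slice i F x (h *: (1 : R) + coord i x) - slice i F x (coord i x))) by [].
apply/funext => h; rewrite /slice /coord /unit_dir.
case: x => x1 x2; case: eqVneq => _ /=; congr (_ *: (F _ - _)).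
  by congr pair => /=; rewrite scaler0 add0r.
by congr pair => /=; rewrite scaler0 add0r.
Qed.

Lemma derivable_slice i F x : derivable F x (e i) -> derivable (slice i F x) (coord i x) 1.
Proof.
rewrite /derivable.
suff -> : (fun h => h^-1 *: (F (h *: e i + x) - F x)) =
   (fun h => h^-1 *: (slice i F x (h *: (1 : R) + coord i x) - slice i F x (coord i x))) by [].
apply/funext => h; rewrite /slice /coord /unit_dir.
case: x => x1 x2; case: eqVneq => _ /=; congr (_ *: (F _ - _)).
  by congr pair => /=; rewrite scaler0 add0r.
by congr pair => /=; rewrite scaler0 add0r.
Qed.

Lemma differentiable_fst x : differentiable (fst : plane R -> R) x.
Proof. by apply: linear_differentiable => y; exact: cvg_fst. Qed.

Lemma differentiable_snd x : differentiable (snd : plane R -> R) x.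
Proof. by apply: linear_differentiable => y; exact: cvg_snd. Qed.

Lemma differentiable_tensor f g x : (forall t, derivable f t 1) -> (forall t, derivable g t 1) ->
  differentiable (fun x => f x.1 * g x.2) x.
Proof.
move=> hf hg; apply: differentiableM.
  by apply: differentiable_comp; [exact: differentiable_fst|apply/derivable1_diffP; exact: hf].
by apply: differentiable_comp; [exact: differentiable_snd|apply/derivable1_diffP; exact: hg].
Qed.

Lemma derive_tensor i f g : smooth1 f -> smooth1 g ->
  'D_(e i) (fun x => f x.1 * g x.2) =
  fun x => if i == ord0 then derive1 f x.1 * g x.2 else f x.1 * derive1 g x.2.
Proof.
move=> sf sg; apply/funext => x; rewrite derive_slice derive1E /slice /coord.
case: ifP => _ /=.
  have h := is_derive_mul (smooth1_is_derive x.1 sf) (@is_derive_cst _ R R (g x.2) x.1 1).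
  by have -> := @derive_val _ _ _ _ _ _ _ h; rewrite mulr0 add0r.
have h := is_derive_mul (@is_derive_cst _ R R (f x.1) x.2 1) (smooth1_is_derive x.2 sg).
by have -> := @derive_val _ _ _ _ _ _ _ h; rewrite mul0r addr0.
Qed.

Lemma smooth_tensor f g : smooth1 f -> smooth1 g -> smooth (fun x => f x.1 * g x.2).
Proof.
move=> sf sg; apply/smoothP => n.
elim: n f g sf sg => [|n IH] f g sf sg; (split; first move=> x).
- by apply: differentiable_tensor => t; apply: (@ex_derive _ _ _ _ _ _ _ (smooth1_is_derive t _)).
- by [].
- by apply: differentiable_tensor => t; apply: (@ex_derive _ _ _ _ _ _ _ (smooth1_is_derive t _)).
move=> i; rewrite derive_tensor //; case: (i == ord0); apply: IH => //; exact: smooth1_derive1.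
Qed.

Lemma smooth_cst (c : R) : smooth (fun=> c).
Proof.
have -> : (fun=> c) = (fun x : plane R => (fun=> c) x.1 * (fun=> 1) x.2).
  by apply/funext => x; rewrite mulr1.
exact: (smooth_tensor (smooth1_cst c) (smooth1_cst 1)).
Qed.

Lemma smoothZ (c : R) F : smooth F -> smooth (fun x => c * F x).
Proof. by move=> h; apply: smoothM => //; exact: smooth_cst. Qed.

Lemma pderivD s F G : smooth F -> smooth G ->
  pderiv s (fun x => F x + G x) = fun x => pderiv s F x + pderiv s G x.
Proof.
move=> hF hG; elim: s => [//|i s IH] /=; rewrite IH derive_add // => x;
  by apply: smooth_differentiable; exact: smooth_pderiv.
Qed.

Lemma pderivZ s (c : R) F : smooth F ->
  pderiv s (fun x => c * F x) = fun x => c * pderiv s F x.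
Proof.
move=> hF; elim: s => [//|i s IH] /=; rewrite IH derive_mul.
- by apply/funext => x; rewrite derive_cst mul0r addr0.
- by move=> x; exact: differentiable_cst.
- by move=> x; apply: smooth_differentiable; exact: smooth_pderiv.
Qed.

Implicit Types D : set (plane R).

Lemma supp_fun_sub F (A : set (plane R)) : closed A ->
  (forall x, ~ A x -> F x = 0) -> supp_fun F `<=` A.
Proof.
move=> /closure_id cA h; rewrite cA; apply: closure_subset => x /= Fx.
by apply: contrapT => /h F0; rewrite F0 eqxx in Fx.
Qed.

Lemma supp_fun0 F x : ~ supp_fun F x -> F x = 0.
Proof.
move=> h; apply: contrapT => /eqP Fx; apply: h; exact: subset_closure.
Qed.

Lemma supp_fun_closed F : closed (supp_fun F).
Proof. exact: closed_closure. Qed.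

(** Off its closed support [F] vanishes in a whole neighbourhood of the point, hence so does its
    derivative at the point. *)
Lemma supp_derive F i : supp_fun ('D_(e i) F) `<=` supp_fun F.
Proof.
apply: supp_fun_sub; first exact: supp_fun_closed.
move=> x Fx; have : \near x, cst 0 x = F x.
  have : nbhs x (~` supp_fun F).
    by apply: open_nbhs_nbhs; split => //; apply: closed_openC; exact: supp_fun_closed.
  by apply: filterS => y /= /supp_fun0.
by move=> /near_eq_derive <-; rewrite derive_cst.
Qed.

Lemma test_derive D F i : test_function D F -> test_function D ('D_(e i) F).
Proof.
move=> [h1 h2 h3]; split.
- exact: smooth_derive.
- by apply: subclosed_compact h2 _; [exact: supp_fun_closed|exact: supp_derive].
- by apply: subset_trans h3; exact: supp_derive.
Qed.

Lemma test_pderiv D F s : test_function D F -> test_function D (pderiv s F).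
Proof. by move=> h; elim: s => [//|i s IH] /=; exact: test_derive. Qed.

Lemma test_sub D D' F : D `<=` D' -> test_function D F -> test_function D' F.
Proof. by move=> h [h1 h2 h3]; split => //; exact: subset_trans h. Qed.

Lemma test_out D F x : test_function D F -> ~ D x -> F x = 0.
Proof. by move=> [_ _ h] Dx; apply: supp_fun0 => /h. Qed.

Lemma test_mul D F G : smooth F -> test_function D G -> test_function D (fun x => F x * G x).
Proof.
move=> sF [h1 h2 h3].
have sub : supp_fun (fun x => F x * G x) `<=` supp_fun G.
  by apply: supp_fun_sub => [|x /supp_fun0 ->]; [exact: supp_fun_closed|rewrite mulr0].
split; [exact: smoothM| |exact: subset_trans h3].
by apply: subclosed_compact h2 _ => //; exact: supp_fun_closed.
Qed.

Lemma test_add D F G : test_function D F -> test_function D G ->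
  test_function D (fun x => F x + G x).
Proof.
move=> [h1 h2 h3] [g1 g2 g3].
have sub : supp_fun (fun x => F x + G x) `<=` supp_fun F `|` supp_fun G.
  apply: supp_fun_sub => [|x]; first by apply: closedU; exact: supp_fun_closed.
  by move=> /not_orP[/supp_fun0 -> /supp_fun0 ->]; rewrite addr0.
split; [exact: smoothD| |by apply: subset_trans sub _ => x [/h3|/g3]].
apply: subclosed_compact sub => //; first exact: supp_fun_closed.
exact: compactU.
Qed.

Lemma test_scale D (c : R) F : test_function D F -> test_function D (fun x => c * F x).
Proof. by move=> h; apply: (@test_mul D (fun=> c)) => //; exact: smooth_cst. Qed.

Lemma test0 D : test_function D (fun=> 0).
Proof.
have s0 : supp_fun (fun _ : plane R => 0 : R) = set0.
  rewrite -subset0; apply: supp_fun_sub => //; exact: closed0.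
by split; [exact: smooth_cst|rewrite s0; exact: compact0|rewrite s0].
Qed.

Lemma test_tensor D (a b : plane R) f g : smooth1 f -> smooth1 g ->
  (forall t, ~ (a.1 <= t <= b.1) -> f t = 0) ->
  (forall t, ~ (a.2 <= t <= b.2) -> g t = 0) -> cbox a b `<=` D ->
  test_function D (fun x => f x.1 * g x.2).
Proof.
move=> sf sg f0 g0 sub.
have h : supp_fun (fun x => f x.1 * g x.2) `<=` cbox a b.
  apply: supp_fun_sub.
    by apply: compact_closed; [exact: norm_hausdorff|exact: cbox_compact].
  move=> x hx; have [h1|/f0 ->] := pselect (a.1 <= x.1 <= b.1); last by rewrite mul0r.
  have [h2|/g0 ->] := pselect (a.2 <= x.2 <= b.2); last by rewrite mulr0.
  by exfalso; apply: hx; apply/cboxP.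
split; [exact: smooth_tensor| |exact: subset_trans sub].
by apply: subclosed_compact h; [exact: supp_fun_closed|exact: cbox_compact].
Qed.

Lemma cc_integrable F (K : set (plane R)) (A : set (plane R)) : compact K -> continuous F ->
  (forall x, ~ K x -> F x = 0) -> 
  measurable (A : set (measurableTypeR R * measurableTypeR R)) ->
  mu2.-integrable A (EFin \o F).
Proof.
move=> cK cF F0 mA; apply: (@integrableS _ _ _ _ setT) => //.
have -> : EFin \o F = (EFin \o F) \_ K.
  apply/funext => x; rewrite /patch; case: ifPn => // /negP xK.
  by rewrite /= F0 // => Kx; apply: xK; rewrite inE.
have /integrable_mkcond := compact_integrable cK cF.
by apply; exact: compact_measurable2.
Qed.

Lemma test_integrable D F (A : set (plane R)) : test_function D F ->
  measurable (A : set (measurableTypeR R * measurableTypeR R)) ->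
  mu2.-integrable A (EFin \o F).
Proof.
move=> [h1 h2 h3]; apply: cc_integrable h2 _ _; first exact: smooth_continuous.
by move=> x /supp_fun0.
Qed.

Lemma FTC2_Rintegral (G g : R -> R) (a b : R) : a < b ->
  (forall t : R, is_derive t 1 G (g t)) -> continuous g ->
  \int[lebesgue_measure]_(t in `[a, b]) g t = G b - G a.
Proof.
move=> ab dG cg; have cG := is_derive_continuous dG.
rewrite /Rintegral (@continuous_FTC2 _ g G a b ab) //.
- exact: continuous_subspaceT.
- split.
  + by move=> t _; apply: (@ex_derive _ _ _ _ _ _ _ (dG t)).
  + by apply: cvg_at_right_filter; exact: cG.
  + by apply: cvg_at_left_filter; exact: cG.
- by move=> t _; rewrite (derive1_ext dG).
Qed.

Lemma Rintegral_support (g : R -> R) (a b : R) :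
  (forall t, ~ (a <= t <= b) -> g t = 0) ->
  \int[lebesgue_measure]_t g t = \int[lebesgue_measure]_(t in `[a, b]) g t.
Proof.
move=> g0; rewrite [RHS]Rintegral_mkcond; apply: eq_Rintegral => t _.
rewrite /patch; case: ifPn => // /negP ht; rewrite g0 // => tab; apply: ht.
by rewrite inE /= in_itv.
Qed.

Lemma cc1_integrable (g : R -> R) (a b : R) : continuous g ->
  (forall t, ~ (a <= t <= b) -> g t = 0) ->
  lebesgue_measure.-integrable setT (EFin \o g).
Proof.
move=> cg g0.
have -> : EFin \o g = (EFin \o g) \_ `[a, b].
  apply/funext => t; rewrite /patch; case: ifPn => // /negP ht.
  by rewrite /= g0 // => tab; apply: ht; rewrite inE /= in_itv.
have : lebesgue_measure.-integrable `[a, b] (EFin \o g).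
  by apply: continuous_compact_integrable; [exact: segment_compact|exact: continuous_subspaceT].
by move=> /integrable_mkcond; apply; exact: measurable_itv.
Qed.

Lemma slice_continuous F i x : continuous F -> continuous (slice i F x).
Proof.
move=> cF t; rewrite /slice; case: (i == ord0); apply: continuous_comp (cF _).
  exact: (cvg_pair cvg_id (cvg_cst x.2)).
exact: (cvg_pair (cvg_cst x.1) cvg_id).
Qed.

Section Fubini.
Variables (F : plane R -> R) (L : R).
Hypothesis cF : continuous F.
Hypothesis F0 : forall x, ~ cbox (- L, - L) (L, L) x -> F x = 0.

Let slice_out i x t : ~ (- L <= t <= L) -> slice i F x t = 0.
Proof.
by move=> h; rewrite /slice; case: (i == ord0); apply: F0 => /cboxP /= [].
Qed.

Let iF : mu2.-integrable setT (EFin \o F).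
Proof. by apply: cc_integrable F0 _ => //; exact: cbox_compact. Qed.

Lemma Rfubini12 : \int[mu2]_x F x =
  \int[lebesgue_measure]_s \int[lebesgue_measure]_t F (s, t).
Proof.
rewrite /Rintegral -(integral12_prod_meas1 iF); congr fine.
apply: eq_integral => s _; rewrite /fubini_F /Rintegral fineK //.
pose r : R := s.
have := cc1_integrable (@slice_continuous F (lift ord0 ord0) (r, r) cF) (@slice_out _ _).
by move/integrable_fin_num; apply.
Qed.

Lemma Rfubini21 : \int[mu2]_x F x =
  \int[lebesgue_measure]_t \int[lebesgue_measure]_s F (s, t).
Proof.
rewrite /Rintegral -(integral21_prod_meas1 iF); congr fine.
apply: eq_integral => s _; rewrite /fubini_G /Rintegral fineK //.
pose r : R := s.
have := cc1_integrable (@slice_continuous F ord0 (r, r) cF) (@slice_out _ _).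
by move/integrable_fin_num; apply.
Qed.

End Fubini.

Lemma is_derive_slice F i x t : smooth F ->
  is_derive (t : R) 1 (slice i F x) (slice i ('D_(e i) F) x t).
Proof.
move=> sF.
pose y : plane R := if i == ord0 then (t, x.2) else (x.1, t).
have hs G : slice i G y = slice i G x.
  by apply/funext => u; rewrite /slice /y; case: (i == ord0).
have hc : coord i y = t by rewrite /coord /y; case: (i == ord0).
have := derivable_slice (@smooth_derivable F y (e i) sF).
rewrite hs hc => /derivableP /is_derive_eq; apply.
rewrite -derive1E -hc -hs -derive_slice /slice /y /coord.
by case: (i == ord0).
Qed.

Lemma test_cbox D F : test_function D F -> exists2 L : R, 0 < L &
  forall s x, ~ cbox (- L, - L) (L, L) x -> pderiv s F x = 0.
Proof.
move=> [sF cF _].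
have [L L0 h] := compact_sub_cbox (compact_bounded cF).
exists L => // s x Lx; apply: supp_fun0 => sx; apply/Lx/h.
by elim: s sx => [//|i s IH] /= /supp_derive.
Qed.

Lemma Rintegral_eq0 d (T : measurableType d) (mu : {measure set T -> \bar R})
    (A : set T) (f : T -> R) : (forall t, A t -> f t = 0) ->
  \int[mu]_(t in A) f t = 0.
Proof. by move=> h; rewrite /Rintegral integral0_eq // => t /h ->. Qed.

(** Fubini with the inner integral along axis [i], where the fundamental theorem of calculus leaves
    only values outside the support. Integration by parts is this applied to a product. *)
Lemma Rintegral_derive0 D F i : test_function D F -> \int[mu2]_x 'D_(e i) F x = 0.
Proof.
move=> tF; have [sF _ _] := tF; have [L L0 hL] := test_cbox tF.
have cD : continuous ('D_(e i) F).
  by apply: smooth_continuous; case: (test_derive i tF).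
have D0 := hL [:: i]; rewrite /= in D0.
have z x : \int[lebesgue_measure]_t slice i ('D_(e i) F) x t = 0.
  have out G t : (forall x, ~ cbox (- L, - L) (L, L) x -> G x = 0) ->
      ~ (- L <= t <= L) -> slice i G x t = 0.
    by move=> G0 h; rewrite /slice; case: (i == ord0); apply: G0 => /cboxP /= [].
  (* The interval exceeds the supporting box by 1 on each side, so that [F] is zero at both
     endpoints. *)
  have L1 : - L - 1 < L + 1 by lra.
  rewrite (@Rintegral_support _ (- L - 1) (L + 1)).
    rewrite (FTC2_Rintegral L1 (fun t => is_derive_slice i x t sF)).
      by rewrite !out ?subrr //; [exact: (hL [::])|lra|exact: (hL [::])|lra].
    exact: slice_continuous.
  by move=> t ht; apply: out => // h; apply: ht; move: h => /andP[h1 h2]; apply/andP; split; lra.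
case: (eqVneq i ord0) => [i0|i0].
  rewrite (Rfubini21 cD D0); apply: Rintegral_eq0 => t _.
  by rewrite -[RHS](z (0, t)) /slice i0 eqxx.
rewrite (Rfubini12 cD D0); apply: Rintegral_eq0 => s _.
by rewrite -[RHS](z (s, 0)) /slice (negbTE i0).
Qed.

Lemma Rintegral_test_sub D F (A : set (plane R)) : test_function D F -> D `<=` A ->
  \int[mu2]_(x in A) F x = \int[mu2]_x F x.
Proof.
move=> tF DA; rewrite Rintegral_mkcond; apply: eq_Rintegral => x _.
rewrite /patch; case: ifPn => // /negP hx; rewrite (test_out tF) // => /DA Ax.
by apply: hx; rewrite inE.
Qed.

Lemma Rintegral_by_parts D F G i : smooth F -> test_function D G ->
  \int[mu2]_x (F x * 'D_(e i) G x) = - \int[mu2]_x ('D_(e i) F x * G x).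
Proof.
move=> sF tG; have [sG _ _] := tG.
have := Rintegral_derive0 i (test_mul sF tG).
rewrite derive_mul; [|by move=> x; exact: smooth_differentiable..].
rewrite RintegralD //.
- by move/eqP; rewrite addr_eq0 => /eqP.
- by apply: (test_integrable (D := D)) => //; apply: test_mul => //; exact: test_derive.
- by apply: (test_integrable (D := D)) => //; apply: test_mul => //; exact: smooth_derive.
Qed.

(** Each integration by parts removes the outermost letter acting on the test function and makes it
    the innermost one acting on [F], so the word is reversed. *)
Lemma is_weak_deriv_smooth D s F : smooth F -> is_weak_deriv D s F (pderiv (rev s) F).
Proof.
move=> sF; split.
- by move=> A cA _; apply: compact_integrable => //; exact: smooth_continuous.
- by move=> A cA _; apply: compact_integrable => //; apply: smooth_continuous; exact: smooth_pderiv.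
move=> phi tphi.
rewrite (Rintegral_test_sub (test_mul sF (test_pderiv s tphi))) //.
rewrite (Rintegral_test_sub (test_mul (smooth_pderiv (rev s) sF) tphi)) //.
elim: s F sF => [|i s IH] F sF; first by rewrite /= expr0 mul1r.
rewrite /= (Rintegral_by_parts i sF (test_pderiv s tphi)) IH; last exact: smooth_derive.
rewrite exprS mulN1r mulNr; congr (- (_ * _)); apply: eq_Rintegral => x _.
by rewrite rev_cons /pderiv -cats1 foldr_cat.
Qed.

Lemma fst_tensor : (fst : plane R -> R) = fun x => (fun t => t) x.1 * (fun=> 1) x.2.
Proof. by apply/funext => x; rewrite mulr1. Qed.

Lemma smooth_fst : smooth (fst : plane R -> R).
Proof.
rewrite fst_tensor; exact: (smooth_tensor (@smooth1_id R) (smooth1_cst 1)).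
Qed.

Lemma derive_fst x : 'D_(e ord0) (fst : plane R -> R) x = 1.
Proof. by rewrite derive_slice /slice /coord /= derive1_id. Qed.

Lemma derive_smoothM F G v x : smooth F -> smooth G ->
  'D_v (fun x => F x * G x) x = F x * 'D_v G x + 'D_v F x * G x.
Proof.
move=> sF sG.
have dF y : differentiable F y by exact: smooth_differentiable.
have dG y : differentiable G y by exact: smooth_differentiable.
by have /(congr1 (fun h => h x)) := derive_mul v dF dG.
Qed.

(** The first partial derivative of x1 F^2 integrates to 0, which expresses the integral of F^2
    through x1, F and the derivative of F; Young's inequality absorbs half of it. *)
Lemma test_poincare D F (L : R) : test_function D F -> 0 <= L ->
  D `<=` cbox (- L, - L) (L, L) ->
  \int[mu2]_x (F x ^+ 2) <= 4 * L ^+ 2 * \int[mu2]_x ('D_(e ord0) F x ^+ 2).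
Proof.
move=> tF L0 DL; have [sF _ _] := tF.
pose G x := F x * F x.
have tG : test_function D G by apply: test_mul.
have sG : smooth G by case: tG.
have tF' := test_derive ord0 tF; have [sF' _ _] := tF'.
have := Rintegral_derive0 ord0 (test_mul smooth_fst tG).
under eq_Rintegral do rewrite (derive_smoothM _ _ smooth_fst sG) (derive_smoothM _ _ sF sF) derive_fst.
move=> h0.
have tF2 : test_function D (fun x => F x ^+ 2).
  by under eq_fun do rewrite expr2; exact: test_mul.
have tF'2 : test_function D (fun x => 'D_(e ord0) F x ^+ 2).
  by under eq_fun do rewrite expr2; exact: test_mul.
have iF2 := test_integrable tF2 measurableT.
have iF'2 := test_integrable tF'2 measurableT.
(* Pointwise the integrand lies below the derivative of x1 F^2: expand the square of F + 2 x1 dF and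
   use |x1| <= L. *)
have : \int[mu2]_x (2^-1 * F x ^+ 2 + (- (2 * L ^+ 2)) * 'D_(e ord0) F x ^+ 2) <= 0.
  rewrite -[leRHS]h0; apply: le_Rintegral => //.
  - by apply: (test_integrable (D := D)) => //; apply: test_add; exact: test_scale.
  - apply: (test_integrable (D := D)) => //; apply: test_add.
      by apply: test_mul; [exact: smooth_fst|apply: test_add; apply: test_mul].
    exact: (test_scale 1 tG).
  move=> x _ /=; rewrite /G.
  have [Dx|Dx] := pselect (D x); last first.
    by rewrite !(test_out tF') // (test_out tF) //; lra.
  have /cboxP /= [/andP[x1 x2] _] := DL x Dx.
  have lem (f g y : R) : - L <= y <= L ->
      2^-1 * f ^+ 2 + - (2 * L ^+ 2) * g ^+ 2 <= y * (f * g + g * f) + 1 * (f * f).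
    move=> /andP[y1 y2]; have h1 : 0 <= (f + 2 * y * g) ^+ 2 by exact: sqr_ge0.
    have h2 : 0 <= (L ^+ 2 - y ^+ 2) * g ^+ 2.
      by rewrite subr_sqr; apply: mulr_ge0 (sqr_ge0 _); apply: mulr_ge0; rewrite ?subr_ge0 // -lerBlDl sub0r.
    by move: h1 h2; rewrite !expr2; nra.
  by apply: lem; rewrite x1.
rewrite RintegralD //; [|exact: (test_integrable (test_scale _ tF2))|exact: (test_integrable (test_scale _ tF'2))].
rewrite !RintegralZl //; lra.
Qed.

End Smooth2.

(** * The fundamental lemma of the calculus of variations *)

Section WeakDerivatives.
Variable R : realType.
Implicit Types (D U : set (plane R)) (f g : plane R -> R) (s : seq 'I_2).
Local Notation e := (unit_dir R).
Local Notation T2 := (measurableTypeR R * measurableTypeR R)%type.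

Definition open_rects : set (set (plane R)) :=
  [set A | exists a b, A = open_rect a b].

Lemma plane_bigcup_rect : \bigcup_n open_rect (- n%:R, - n%:R) (n%:R, n%:R) = [set: plane R].
Proof.
apply/seteqP; split => // x _.
have cx : compact [set x] by exact: compact_set1.
have [L L0 h] := compact_sub_cbox (compact_bounded cx).
have /cboxP /= [/andP[h1 h2] /andP[h3 h4]] := h x erefl.
exists (Num.truncn L).+1 => //; have := truncnS_gt L; rewrite /open_rect /= => ?.
by apply/andP; split; apply/andP; split; lra.
Qed.

Lemma open_rects_strip0 (a b : R) : <<s open_rects >> (`]a, b[ `*` setT).
Proof.
have -> : `]a, b[ `*` setT = \bigcup_n (open_rect (a, - n%:R) (b, n%:R) : set (plane R)).
  apply/seteqP; split => x /=.
    move=> [/= xab _].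
    have : setT x by []. 
    rewrite -plane_bigcup_rect => -[n _] /andP[_ h]; exists n => //.
    by rewrite /open_rect /= h andbT; move: xab; rewrite in_itv.
  by move=> [n _ /andP[/= h _]]; split => //; rewrite /= in_itv.
by apply: (@bigcupT_measurable _ (g_sigma_algebraType open_rects)) => n;
  apply: sub_sigma_algebra; eexists; eexists; reflexivity.
Qed.

Lemma open_rects_strip1 (a b : R) : <<s open_rects >> (setT `*` `]a, b[).
Proof.
have -> : setT `*` `]a, b[ = \bigcup_n (open_rect (- n%:R, a) (n%:R, b) : set (plane R)).
  apply/seteqP; split => x /=.
    move=> [/= _ xab].
    have : setT x by []. 
    rewrite -plane_bigcup_rect => -[n _] /andP[h _]; exists n => //.
    by rewrite /open_rect /= h; move: xab; rewrite in_itv.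
  by move=> [n _ /andP[_ /= h]]; split => //; rewrite /= in_itv.
by apply: (@bigcupT_measurable _ (g_sigma_algebraType open_rects)) => n;
  apply: sub_sigma_algebra; eexists; eexists; reflexivity.
Qed.

(** Open rectangles are closed under intersection, so this generator allows Dynkin induction over
    measurable sets. *)
Lemma measurable2E : @measurable _ T2 = <<s open_rects >>.
Proof.
rewrite eqEsubset; split; last first.
  apply: smallest_sub; first exact: sigma_algebra_measurable.
  by move=> _ [a [b ->]]; exact: open_rect_measurable.
have m1 : measurable_fun setT (fst : g_sigma_algebraType open_rects -> R).
  apply: (measurability _ (RGenOpens.measurableE R)) => //= _ [_ [a [b ->] <-]].
  rewrite setTI (_ : _ @^-1` _ = `]a, b[ `*` setT); first exact: open_rects_strip0.
  by apply/seteqP; split => x //= [].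
have m2 : measurable_fun setT (snd : g_sigma_algebraType open_rects -> R).
  apply: (measurability _ (RGenOpens.measurableE R)) => //= _ [_ [a [b ->] <-]].
  rewrite setTI (_ : _ @^-1` _ = setT `*` `]a, b[); first exact: open_rects_strip1.
  by apply/seteqP; split => x //= [].
apply: smallest_sub; first exact: smallest_sigma_algebra.
by move=> _ [[A mA <-]|[A mA <-]]; [exact: m1|exact: m2].
Qed.

(** Smooth functions converging pointwise to the indicator of ]a, b[ as the slopes of the two steps
    grow with [n]. *)
Definition bump (a b : R) (n : nat) (t : R) : R :=
  step (n%:R * t + - (n%:R * a)) * step (- n%:R * t + n%:R * b).

Lemma smooth1_bump a b n : smooth1 (bump a b n).
Proof. by apply: smooth1M; apply: smooth1_affine; exact: smooth1_step. Qed.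

Lemma bump_out a b n t : ~ (a < t < b) -> bump a b n t = 0.
Proof.
move=> h; rewrite /bump; have [ta|ta] := leP t a.
  rewrite step_le0 ?mul0r //.
  by rewrite -mulrBr mulr_ge0_le0 // subr_le0.
have [tb|tb] := leP b t; last by exfalso; apply: h; rewrite ta.
rewrite [X in _ * X]step_le0 ?mulr0 //.
by rewrite mulNr addrC -mulrBr mulr_ge0_le0 // subr_le0.
Qed.

Lemma bump_itv01 a b n t : 0 <= bump a b n t <= 1.
Proof.
have /andP[h1 h2] := step_itv01 (n%:R * t + - (n%:R * a)).
have /andP[h3 h4] := step_itv01 (- n%:R * t + n%:R * b).
by rewrite /bump mulr_ge0 //= mulr_ile1.
Qed.

Lemma bump_near1 (a b t : R) : a < t < b -> \forall n \near \oo, bump a b n t = 1.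
Proof.
move=> /andP[ta tb].
have A0 : 0 < t - a by rewrite subr_gt0.
have B0 : 0 < b - t by rewrite subr_gt0.
near=> n; rewrite /bump !step_ge1 ?mulr1 //.
  rewrite mulNr addrC -mulrBr -ler_pdivrMr //.
  by near: n; exact: nbhs_infty_ger.
rewrite -mulrBr -ler_pdivrMr //.
by near: n; exact: nbhs_infty_ger.
Unshelve. all: end_near.
Qed.

Definition bump2 (a b : plane R) (n : nat) (x : plane R) : R :=
  bump a.1 b.1 n x.1 * bump a.2 b.2 n x.2.

Lemma test_bump2 a b n U : cbox a b `<=` U -> test_function U (bump2 a b n).
Proof.
move=> h; apply: (test_tensor (a := a) (b := b)) => //; try exact: smooth1_bump.
  by move=> t ht; apply: bump_out => /andP[h1 h2]; apply: ht; rewrite !ltW.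
by move=> t ht; apply: bump_out => /andP[h1 h2]; apply: ht; rewrite !ltW.
Qed.

Lemma bump2_itv01 a b n x : 0 <= bump2 a b n x <= 1.
Proof.
have /andP[h1 h2] := bump_itv01 a.1 b.1 n x.1.
have /andP[h3 h4] := bump_itv01 a.2 b.2 n x.2.
by rewrite /bump2 mulr_ge0 //= mulr_ile1.
Qed.

Lemma bump2_out a b n x : ~ open_rect a b x -> bump2 a b n x = 0.
Proof.
move=> h; rewrite /bump2; have [h1|/bump_out ->] := pselect (a.1 < x.1 < b.1); last by rewrite mul0r.
have [h2|/bump_out ->] := pselect (a.2 < x.2 < b.2); last by rewrite mulr0.
by exfalso; apply: h; rewrite /open_rect /= h1.
Qed.

Lemma bump2_near1 a b x : open_rect a b x -> \forall n \near \oo, bump2 a b n x = 1.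
Proof.
move=> /andP[/bump_near1 h1 /bump_near1 h2]; near=> n.
by rewrite /bump2 (near h1 n) // (near h2 n) // mulr1.
Unshelve. all: end_near.
Qed.

Lemma integrable_mul_bounded (A : set T2) (f g : T2 -> R) (M : R) : measurable A ->
  mu2.-integrable A (EFin \o f) -> measurable_fun A g -> (forall x, A x -> `|g x| <= M) ->
  mu2.-integrable A (EFin \o (fun x => f x * g x)).
Proof.
move=> mA fi mg gM; have mf : measurable_fun A f.
  by have /integrableP [/measurable_EFinP] := fi.
have fM : mu2.-integrable A (EFin \o (fun x => M * f x)).
  by have := integrableZl mA M fi; apply: eq_integrable => // x _; rewrite /= EFinM.
apply: (le_integrable mA _ _ fM).
  by apply/measurable_EFinP; apply: measurable_funM.
move=> x Ax /=; rewrite lee_fin !normrM mulrC ler_wpM2r //.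
by apply: le_trans (gM x Ax) (ler_norm _).
Qed.

(** Dominated convergence, with dominating function |g|: the products of [g] with the bumps converge
    to [g] times the indicator of the rectangle. *)
Lemma dubois_rect U g a b : open U -> loc_integrable U g ->
  (forall phi, test_function U phi -> \int[mu2]_(x in U) (g x * phi x) = 0) ->
  cbox a b `<=` U -> (\int[mu2]_(x in open_rect a b) (g x)%:E = 0)%E.
Proof.
move=> oU lg h0 abU.
pose Q : set T2 := cbox a b.
have mQ : measurable Q by exact: cbox_measurable.
have gi : mu2.-integrable Q (EFin \o g) by apply: lg => //; exact: cbox_compact.
have mg : measurable_fun Q g by have /integrableP [/measurable_EFinP] := gi.
have mb n : measurable_fun Q (bump2 a b n : T2 -> R).
  by apply: continuous_measurable2 => //; apply: smooth_continuous; case: (test_bump2 n abU).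
have gbi n : mu2.-integrable Q (EFin \o (fun x => g x * bump2 a b n x)).
  apply: (@integrable_mul_bounded _ _ _ 1) => // x _.
  by have /andP[h1 h2] := bump2_itv01 a b n x; rewrite ger0_norm.
have z n : (\int[mu2]_(x in Q) (g x * bump2 a b n x)%:E = 0)%E.
  have := h0 _ (test_bump2 n abU); rewrite /Rintegral.
  have -> : (\int[mu2]_(x in U) (g x * bump2 a b n x)%:E = \int[mu2]_(x in Q) (g x * bump2 a b n x)%:E)%E.
    rewrite [RHS]integral_mkcond [LHS]integral_mkcond; apply: eq_integral => x _.
    rewrite /patch; have [xU|xU] := pselect (U x); have [xQ|xQ] := pselect (Q x).
    - by rewrite !mem_set.
    - by rewrite mem_set // memNset // bump2_out ?mulr0 // => /open_rect_sub_cbox.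
    - by have := xU (abU _ xQ).
    - by rewrite !memNset.
  have := integrable_fin_num mQ (gbi n).
  by move=> /fineK <- /= ->.
have mr : measurable (open_rect a b : set T2) by exact: open_rect_measurable.
have hQ : open_rect a b `<=` Q by exact: open_rect_sub_cbox.
have -> : (\int[mu2]_(x in open_rect a b) (g x)%:E =
    \int[mu2]_(x in Q) ((EFin \o g) \_ (open_rect a b)) x)%E.
  rewrite [LHS]integral_mkcond [RHS]integral_mkcond; apply: eq_integral => x _.
  rewrite /patch; have [xr|xr] := pselect (open_rect a b x).
    by rewrite !mem_set //; exact: hQ.
  by rewrite (memNset xr); case: ifP.
have mgr : measurable_fun Q ((EFin \o g) \_ (open_rect a b)).
  apply/(measurable_restrict _ mr mQ).
  by apply: (measurable_funS mQ); [exact: subIsetl|apply/measurable_EFinP].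
have [|||||_ _] := @dominated_convergence _ _ _ mu2 Q mQ
   (fun n x => (g x * bump2 a b n x)%:E) ((EFin \o g) \_ (open_rect a b)) (fun x => `|g x|%:E).
- by move=> n; apply/measurable_EFinP; apply: measurable_funM.
- exact: mgr.
- apply/aeW => x Qx; rewrite /patch; case: ifPn => [|/negP]; rewrite inE => xr.
    apply: cvg_near_cst; have := bump2_near1 xr; apply: filterS => n ->.
    by rewrite mulr1.
  apply: cvg_near_cst; near=> n; rewrite bump2_out ?mulr0 //.
- by have := integrable_abse gi; apply: eq_integrable.
- apply/aeW => x n Qx /=; rewrite lee_fin normrM ler_piMr //.
  by have /andP[h1 h2] := bump2_itv01 a b n x; rewrite ger0_norm.
under eq_fun do rewrite z.
by move=> /cvg_lim <- //; rewrite lim_cst.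
Unshelve. all: end_near.
Qed.

Lemma open_rectI (a b c d : plane R) : open_rect a b `&` open_rect c d =
  open_rect (Num.max a.1 c.1, Num.max a.2 c.2) (Num.min b.1 d.1, Num.min b.2 d.2).
Proof.
apply/seteqP; split => x; rewrite /open_rect /= !gt_max !lt_min.
  by move=> [/andP[/andP[-> ->] /andP[-> ->]] /andP[/andP[-> ->] /andP[-> ->]]].
by move=> /andP[/andP[/andP[-> ->] /andP[-> ->]] /andP[/andP[-> ->] /andP[-> ->]]].
Qed.

(** The integral of [g] vanishes over every open subrectangle, hence by Dynkin induction over every
    measurable part of the rectangle, and a function with this property is 0 almost everywhere. *)
Lemma dubois_rect_ae U g a b : open U -> loc_integrable U g ->
  (forall phi, test_function U phi -> \int[mu2]_(x in U) (g x * phi x) = 0) ->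
  cbox a b `<=` U -> \forall x \ae mu2, open_rect a b x -> g x = 0.
Proof.
move=> oU lg h0 abU.
pose Q : set T2 := open_rect a b.
have mQ : measurable Q by exact: open_rect_measurable.
have QU : cbox a b `<=` U by [].
have gi : mu2.-integrable Q (EFin \o g).
  apply: (@integrableS _ _ _ _ (cbox a b : set T2)) => //.
  - exact: cbox_measurable.
  - exact: open_rect_sub_cbox.
  - by apply: lg => //; exact: cbox_compact.
pose P (E : set T2) := (\int[mu2]_(x in E `&` Q) (g x)%:E = 0)%E.
have PT : P setT by rewrite /P setTI; exact: dubois_rect abU.
have PE : forall E : set T2, measurable E -> P E.
  move=> E mE; apply: (@dynkin_induction _ T2 open_rects P measurable2E) => //.
  - move=> _ _ [a1 [b1 ->]] [a2 [b2 ->]].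
    by rewrite open_rectI; eexists; eexists; reflexivity.
  - move=> _ [c [d ->]]; rewrite /P.
    rewrite open_rectI.
    apply: (dubois_rect oU lg h0); apply: subset_trans abU => x.
    move=> /cboxP /= []; rewrite !ge_max !le_min.
    move=> /andP[/andP[_ h1] /andP[_ h2]] /andP[/andP[_ h3] /andP[_ h4]].
    by apply/cboxP; rewrite h1 h2 h3 h4.
  - move=> S mS PS; rewrite /P.
    have hd : [disjoint S `&` Q & ~` S `&` Q].
      by apply/disj_setPS => x [[Sx _] [nSx _]].
    have hU : (S `&` Q) `|` (~` S `&` Q) = Q by rewrite -setIUl setUv setTI.
    have hh : (\int[mu2]_(x in Q) (g x)%:E = \int[mu2]_(x in S `&` Q) (g x)%:E +
        \int[mu2]_(x in ~` S `&` Q) (g x)%:E)%E.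
      rewrite -{1}hU; apply: integral_setU => //.
      - exact: measurableI.
      - by apply: measurableI => //; exact: measurableC.
      - by rewrite hU; have /integrableP [] := gi.
    move: PT; rewrite /P setTI hh; move: PS; rewrite /P => ->.
    by rewrite add0e.
  - move=> F mF tF hF; rewrite /P setI_bigcupl.
    rewrite integral_bigcup.
    + by rewrite eseries0 // => i _ _; exact: hF.
    + by apply: trivIset_setIr.
    + by move=> k; apply: measurableI.
    + rewrite -setI_bigcupl; apply: integrableS gi => //.
      by apply: measurableI => //; exact: bigcup_measurable.
  - by rewrite -measurable2E.
have := @integral_ae_eq _ _ _ mu2 Q mQ (cst 0%E) (EFin \o g) gi (measurable_cst _).
have h : forall E : set T2, E `<=` Q -> measurable E ->
    (\int[mu2]_(x in E) (EFin \o g) x)%E = (\int[mu2]_(x in E) cst 0%E x)%E.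
  move=> E EQ mE; have := PE E mE; rewrite /P (setIidl EQ) integral0.
  by move=> <-.
by move=> /(_ h); rewrite /ae_eq; apply: filterS => x hx Qx; have [] := hx Qx.
Qed.

Lemma ae2_sub (P Q : plane R -> Prop) : (forall x, P x -> Q x) ->
  (\forall x \ae mu2, P x) -> \forall x \ae mu2, Q x.
Proof. by move=> PQ; apply: (@filterS T2 (almost_everywhere mu2)) => x; exact: PQ. Qed.

Lemma ae2_and (P Q : plane R -> Prop) :
  (\forall x \ae mu2, P x) -> (\forall x \ae mu2, Q x) -> \forall x \ae mu2, P x /\ Q x.
Proof. by move=> hP hQ; apply: (@filterI T2 (almost_everywhere mu2)). Qed.

Lemma dubois U g : open U -> loc_integrable U g ->
  (forall phi, test_function U phi -> \int[mu2]_(x in U) (g x * phi x) = 0) ->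
  \forall x \ae mu2, U x -> g x = 0.
Proof.
move=> oU lg h0; have [a [b [h1 h2]]] := open_bigcup_rect oU.
have h (k : nat) : \forall x \ae mu2, open_rect (a k) (b k) x -> g x = 0.
  by apply: (dubois_rect_ae oU).
have : \forall x \ae mu2, forall k, open_rect (a k) (b k) x -> g x = 0.
  exact: (@ae_foralln _ _ _ mu2).
by apply: ae2_sub => x hx /h2 [k _]; exact: hx.
Qed.

(** * Calculus of weak derivatives *)

Lemma loc_integrable_measurable D f : open D -> loc_integrable D f ->
  measurable_fun (D : set T2) (f : T2 -> R).
Proof.
move=> oD lf; have [a [b [h1 h2]]] := open_bigcup_rect oD.
have -> : D = \bigcup_k cbox (a k) (b k).
  apply/seteqP; split => [x /h2[k _ kx]|x [k _ /h1]//].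
  by exists k => //; exact: open_rect_sub_cbox.
apply/(measurable_fun_bigcup _ (fun k => cbox_measurable (a k) (b k))) => k.
have /integrableP [/measurable_EFinP //] := lf _ (@cbox_compact R (a k) (b k)) (h1 k).
Qed.

Lemma loc_integrable_lin D (c : R) f g : loc_integrable D f -> loc_integrable D g ->
  loc_integrable D (fun x => c * f x + g x).
Proof.
move=> lf lg A cA AD; have mA := compact_measurable2 cA.
have h := integrableD mA (integrableZl mA c (lf A cA AD)) (lg A cA AD).
by apply: eq_integrable h => // x _; rewrite /= EFinD EFinM.
Qed.

Lemma loc_integrable_sub D U f : D `<=` U -> loc_integrable U f -> loc_integrable D f.
Proof. by move=> DU lf A cA AD; apply: lf => //; exact: subset_trans DU. Qed.

Lemma loc_integrable_mul_test D f (phi : plane R -> R) (A : set T2) : loc_integrable D f ->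
  test_function D phi -> measurable A -> mu2.-integrable A (EFin \o (fun x => f x * phi x)).
Proof.
move=> lf [sp cp Dp] mA; apply: (@integrableS _ _ _ _ setT) => //.
pose K : set T2 := supp_fun phi; have mK : measurable K by exact: compact_measurable2.
have -> : EFin \o (fun x => f x * phi x) = (EFin \o (fun x => f x * phi x)) \_ K.
  apply/funext => x; rewrite /patch; case: ifPn => // /negP xK.
  by rewrite /= (@supp_fun0 _ phi) ?mulr0 // => Kx; apply: xK; rewrite inE.
apply/(integrable_mkcond _ mK).
have /compact_bounded [M [Mr hM]] : compact (phi @` supp_fun phi).
  by apply: continuous_compact => //; apply: continuous_subspaceT; exact: smooth_continuous.
apply: (@integrable_mul_bounded _ _ _ (M + 1)) => //.
- exact: lf.
- by apply: continuous_measurable2 => //; exact: smooth_continuous.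
- by move=> x Kx; apply: (hM (M + 1)); [rewrite ltrDl|exists x].
Qed.

Lemma is_weak_deriv_lin D s (c : R) f f' g g' : open D ->
  is_weak_deriv D s f f' -> is_weak_deriv D s g g' ->
  is_weak_deriv D s (fun x => c * f x + g x) (fun x => c * f' x + g' x).
Proof.
move=> oD [lf lf' hf] [lg lg' hg]; split; try exact: loc_integrable_lin.
move=> phi tp; have mD := open_measurable2 oD.
have tp' := test_pderiv s tp.
have E (u v w : plane R -> R) : loc_integrable D u -> loc_integrable D v -> test_function D w ->
    \int[mu2]_(x in D) ((c * u x + v x) * w x) =
    c * \int[mu2]_(x in D) (u x * w x) + \int[mu2]_(x in D) (v x * w x).
  move=> lu lv tw.
  have iu := loc_integrable_mul_test lu tw mD.
  have iv := loc_integrable_mul_test lv tw mD.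
  rewrite -RintegralZl // -RintegralD //.
  - by apply: eq_Rintegral => x _; ring.
  - by have := integrableZl mD c iu; apply: eq_integrable => // x _; rewrite /= EFinM.
by rewrite !E // hf // hg //; ring.
Qed.

Lemma is_weak_deriv_sub D U s f g : open D -> open U -> D `<=` U -> is_weak_deriv U s f g ->
  is_weak_deriv D s f g.
Proof.
move=> oD oU DU [lf lg h]; split; try exact: loc_integrable_sub DU _.
move=> phi tp; have := h _ (test_sub DU tp).
have E (u w : plane R -> R) : test_function D w ->
    \int[mu2]_(x in U) (u x * w x) = \int[mu2]_(x in D) (u x * w x).
  move=> tw; rewrite Rintegral_mkcond [RHS]Rintegral_mkcond; apply: eq_Rintegral => x _.
  rewrite /patch; have [xD|xD] := pselect (D x); first by rewrite !mem_set //; exact: DU.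
  by rewrite (memNset xD) (test_out tw xD) mulr0; case: ifP.
by rewrite !E //; exact: test_pderiv.
Qed.

(** The difference of two weak derivatives is a weak derivative of 0, so it is orthogonal to all
    test functions once the sign [(-1) ^+ size s] is cancelled. *)
Lemma weak_deriv_unique D s f g g' : open D ->
  is_weak_deriv D s f g -> is_weak_deriv D s f g' ->
  \forall x \ae mu2, D x -> g x = g' x.
Proof.
move=> oD h h'.
have [lf lg hg] := is_weak_deriv_lin (-1) oD h h'.
suff : \forall x \ae mu2, D x -> -1 * g x + g' x = 0.
  by apply: ae2_sub => x hx Dx; have := hx Dx; lra.
apply: dubois => // phi tp.
have := hg phi tp; under eq_Rintegral do rewrite mulN1r addNr mul0r.
rewrite Rintegral_cst ?mul0r; last exact: open_measurable2.
move=> /esym/eqP; rewrite mulf_eq0 => /orP[|/eqP //].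
by rewrite expf_eq0 oppr_eq0 oner_eq0 andbF.
Qed.

Definition weakly_derivable D s f := exists g, is_weak_deriv D s f g.

Lemma weakDP D s f : weakly_derivable D s f -> is_weak_deriv D s f (weakD D s f).
Proof. by move=> [g hg]; rewrite /weakD; apply: xgetPex; exists g. Qed.

Lemma weakD_ae D s f g : open D -> is_weak_deriv D s f g ->
  \forall x \ae mu2, D x -> weakD D s f x = g x.
Proof. by move=> oD h; apply: (weak_deriv_unique oD _ h); apply: weakDP; exists g. Qed.

Lemma weakly_derivable_lin D s (c : R) f g : open D -> weakly_derivable D s f ->
  weakly_derivable D s g -> weakly_derivable D s (fun x => c * f x + g x).
Proof.
by move=> oD [f' hf] [g' hg]; exists (fun x => c * f' x + g' x); exact: is_weak_deriv_lin.
Qed.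

Lemma weakD_lin D s (c : R) f g : open D -> weakly_derivable D s f ->
  weakly_derivable D s g ->
  \forall x \ae mu2, D x -> weakD D s (fun x => c * f x + g x) x = c * weakD D s f x + weakD D s g x.
Proof. by move=> oD hf hg; apply: weakD_ae => //; apply: is_weak_deriv_lin => //; exact: weakDP. Qed.

(** Locality is what turns statements about supports into a count of non-zero derivatives at almost
    every point. *)
Lemma weakD_local D U s f : open D -> open U -> U `<=` D -> weakly_derivable D s f ->
  (forall x, U x -> f x = 0) -> \forall x \ae mu2, U x -> weakD D s f x = 0.
Proof.
move=> oD oU UD wf f0.
have [lf lg h] := is_weak_deriv_sub oU oD UD (weakDP wf).
apply: dubois => // phi tp.
have := h phi tp; rewrite (_ : \int[mu2]_(x in U) (f x * _) = 0); last first.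
  by apply: Rintegral_eq0 => x Ux; rewrite f0 ?mul0r.
move=> /esym/eqP; rewrite mulf_eq0 => /orP[|/eqP //].
by rewrite expf_eq0 oppr_eq0 oner_eq0 andbF.
Qed.

Lemma weakD_smooth D s f : open D -> smooth f ->
  \forall x \ae mu2, D x -> weakD D s f x = pderiv (rev s) f x.
Proof. by move=> oD sf; apply: weakD_ae => //; exact: is_weak_deriv_smooth. Qed.

Lemma is_weak_deriv_nil D f : loc_integrable D f -> is_weak_deriv D [::] f f.
Proof. by move=> lf; split => // phi _; rewrite expr0 mul1r. Qed.

Lemma weakD_measurable D s f : open D -> weakly_derivable D s f ->
  measurable_fun (D : set T2) (weakD D s f : T2 -> R).
Proof. by move=> oD /weakDP [_ h _]; exact: loc_integrable_measurable. Qed.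

Lemma continuous_loc_integrable D f : continuous f -> loc_integrable D f.
Proof. by move=> cf A cA _; exact: compact_integrable. Qed.

Lemma ae_integrable (A : set T2) (f g : T2 -> R) : measurable A ->
  mu2.-integrable A (EFin \o f) -> measurable_fun A g ->
  (\forall x \ae mu2, A x -> f x = g x) -> mu2.-integrable A (EFin \o g).
Proof.
move=> mA fi mg fg; apply/integrableP; split; first exact/measurable_EFinP.
have /integrableP [mf] := fi.
rewrite (_ : (\int[mu2]_(x in A) `|(EFin \o f) x|)%E = (\int[mu2]_(x in A) `|(EFin \o g) x|)%E) //.
apply: ae_eq_integral => //.
- exact: measurableT_comp.
- by apply: measurableT_comp => //; exact/measurable_EFinP.
- by apply: ae2_sub fg => x fg Ax; rewrite /= fg.
Qed.

Lemma ae_eq_Rintegral (A : set T2) (f g : T2 -> R) : measurable A ->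
  measurable_fun A f -> measurable_fun A g ->
  (\forall x \ae mu2, A x -> f x = g x) ->
  \int[mu2]_(x in A) f x = \int[mu2]_(x in A) g x.
Proof.
move=> mA mf mg fg; rewrite /Rintegral; congr fine; apply: ae_eq_integral => //.
- exact/measurable_EFinP.
- exact/measurable_EFinP.
- by apply: ae2_sub fg => x fg Ax; rewrite /= fg.
Qed.

Lemma integrable_le (A : set T2) (f g : T2 -> R) : measurable A ->
  mu2.-integrable A (EFin \o f) -> measurable_fun A g ->
  (forall x, A x -> `|g x| <= `|f x|) -> mu2.-integrable A (EFin \o g).
Proof.
move=> mA fi mg fg; apply: (le_integrable mA _ _ fi); first exact/measurable_EFinP.
by move=> x Ax /=; rewrite lee_fin fg.
Qed.

Lemma integrable_add (A : set T2) (f g : T2 -> R) : measurable A ->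
  mu2.-integrable A (EFin \o f) -> mu2.-integrable A (EFin \o g) ->
  mu2.-integrable A (EFin \o (fun x => f x + g x)).
Proof. by move=> mA fi gi; have := integrableD mA fi gi; apply: eq_integrable => // x _; rewrite /= EFinD. Qed.

Lemma integrable_scale (A : set T2) (c : R) (f : T2 -> R) : measurable A ->
  mu2.-integrable A (EFin \o f) -> mu2.-integrable A (EFin \o (fun x => c * f x)).
Proof. by move=> mA fi; have := integrableZl mA c fi; apply: eq_integrable => // x _; rewrite /= EFinM. Qed.

Lemma integrable_sum_R (I : Type) (r : seq I) (A : set T2) (f : I -> T2 -> R) : measurable A ->
  (forall i, mu2.-integrable A (EFin \o f i)) ->
  mu2.-integrable A (EFin \o (fun x => \sum_(i <- r) f i x)).
Proof.
move=> mA fi; elim: r => [|i r IH].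
  rewrite (_ : _ \o _ = cst 0%E); first exact: integrable0.
  by apply/funext => x; rewrite /= big_nil.
rewrite (_ : (fun _ => _) = fun x => f i x + \sum_(j <- r) f j x); first exact: integrable_add.
by apply/funext => x; rewrite big_cons.
Qed.

Lemma Rintegral_sum (I : Type) (r : seq I) (A : set T2) (f : I -> T2 -> R) : measurable A ->
  (forall i, mu2.-integrable A (EFin \o f i)) ->
  \int[mu2]_(x in A) (\sum_(i <- r) f i x) = \sum_(i <- r) \int[mu2]_(x in A) f i x.
Proof.
move=> mA fi; elim: r => [|i r IH].
  by rewrite big_nil; apply: Rintegral_eq0 => x _; rewrite big_nil.
rewrite big_cons -IH -RintegralD //; last exact: integrable_sum_R.
by apply: eq_Rintegral => x _; rewrite big_cons.
Qed.

Lemma integrable_mul_sq (A : set T2) (f g : T2 -> R) : measurable A ->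
  measurable_fun A f -> measurable_fun A g ->
  mu2.-integrable A (EFin \o (fun x => f x ^+ 2)) ->
  mu2.-integrable A (EFin \o (fun x => g x ^+ 2)) ->
  mu2.-integrable A (EFin \o (fun x => f x * g x)).
Proof.
move=> mA mf mg fi gi; apply: (integrable_le mA (integrable_add mA fi gi)).
  exact: measurable_funM.
move=> x _; rewrite (ger0_norm (addr_ge0 (sqr_ge0 (f x)) (sqr_ge0 (g x)))) ler_norml.
have := sqr_ge0 (f x + g x); have := sqr_ge0 (f x - g x).
have := sqr_ge0 (f x); have := sqr_ge0 (g x).
by rewrite !expr2; nra.
Qed.

(** * Squared Sobolev seminorms, Poincare inequalities and H^2_0 *)

Section Energy.
Variable D : set (plane R).
Hypothesis oD : open D.
Let mD : measurable (D : set T2) := open_measurable2 oD.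

(** Squared seminorms, split by words of directions, so that most estimates avoid square roots;
    [Hsemi_sqr] is the link to [Hsemi]. *)
Definition energy s f := \int[mu2]_(x in D) (weakD D s f x ^+ 2).
Definition Hsq m f := \sum_(s : m.-tuple 'I_2) energy s f.

Lemma energy_ge0 s f : 0 <= energy s f.
Proof. by apply: Rintegral_ge0 => x _; exact: sqr_ge0. Qed.

Lemma Hsq_ge0 m f : 0 <= Hsq m f.
Proof. by apply: sumr_ge0 => s _; exact: energy_ge0. Qed.

Lemma Hsemi_sqr m f : Hsemi D m f ^+ 2 = Hsq m f.
Proof. by rewrite sqr_sqrtr //; exact: Hsq_ge0. Qed.

Lemma Hspace_weakly_derivable m f s : Hspace D m f -> (size s <= m)%N -> weakly_derivable D s f.
Proof. by move=> h /h []. Qed.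

Lemma Hspace_measurable m f s : Hspace D m f -> (size s <= m)%N ->
  measurable_fun (D : set T2) (weakD D s f : T2 -> R).
Proof. by move=> h /(Hspace_weakly_derivable h) ?; apply: weakD_measurable. Qed.

Lemma Hspace_integrable m f s : Hspace D m f -> (size s <= m)%N ->
  mu2.-integrable D (EFin \o (fun x => weakD D s f x ^+ 2)).
Proof. by move=> h /h []. Qed.

Lemma Hspace_cross_integrable m f g s s' : Hspace D m f -> Hspace D m g ->
  (size s <= m)%N -> (size s' <= m)%N ->
  mu2.-integrable D (EFin \o (fun x => weakD D s f x * weakD D s' g x)).
Proof.
move=> hf hg hs hs'; apply: (integrable_mul_sq mD).
- exact: Hspace_measurable hs.
- exact: Hspace_measurable hs'.
- exact: Hspace_integrable hs.
- exact: Hspace_integrable hs'.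
Qed.

Lemma Hspace_lin m (c : R) f g : Hspace D m f -> Hspace D m g ->
  Hspace D m (fun x => c * f x + g x).
Proof.
move=> hf hg s hs.
have wf := Hspace_weakly_derivable hf hs; have wg := Hspace_weakly_derivable hg hs.
have w := weakly_derivable_lin c oD wf wg; split => //.
have i1 := Hspace_integrable hf hs; have i2 := Hspace_integrable hg hs.
have i12 := Hspace_cross_integrable hf hg hs hs.
apply: (ae_integrable mD (f := fun x => c ^+ 2 * weakD D s f x ^+ 2 +
   (2 * c * (weakD D s f x * weakD D s g x) + weakD D s g x ^+ 2))).
- apply: integrable_add => //; first exact: integrable_scale.
  by apply: integrable_add => //; exact: integrable_scale.
- by apply: measurable_funX; exact: weakD_measurable.
- by apply: ae2_sub (weakD_lin c oD wf wg) => x h Dx; rewrite h //; ring.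
Qed.

Lemma energy_lin m s (c : R) f g : Hspace D m f -> Hspace D m g -> (size s <= m)%N ->
  energy s (fun x => c * f x + g x) <= 2 * c ^+ 2 * energy s f + 2 * energy s g.
Proof.
move=> hf hg hs.
have wf := Hspace_weakly_derivable hf hs; have wg := Hspace_weakly_derivable hg hs.
have i1 := Hspace_integrable hf hs; have i2 := Hspace_integrable hg hs.
have hh := Hspace_lin c hf hg.
rewrite /energy -!RintegralZl // -RintegralD //; try exact: integrable_scale.
rewrite (@ae_eq_Rintegral _ _ (fun x => (c * weakD D s f x + weakD D s g x) ^+ 2)) //.
- apply: le_Rintegral => //.
  + apply: (ae_integrable mD (Hspace_integrable hh hs)).
      apply: measurable_funX; apply: measurable_funD.
        by apply: measurable_funM => //; exact: Hspace_measurable hs.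
      exact: Hspace_measurable hs.
    by apply: ae2_sub (weakD_lin c oD wf wg) => x h Dx; rewrite h.
  + by apply: integrable_add => //; exact: integrable_scale.
  + move=> x _; have := sqr_ge0 (c * weakD D s f x - weakD D s g x).
    by rewrite !expr2; nra.
- by apply: measurable_funX; exact: Hspace_measurable hs.
- apply: measurable_funX; apply: measurable_funD.
    by apply: measurable_funM => //; exact: Hspace_measurable hs.
  exact: Hspace_measurable hs.
- by apply: ae2_sub (weakD_lin c oD wf wg) => x h Dx; rewrite h.
Qed.

Lemma Hsq_lin m k (c : R) f g : Hspace D m f -> Hspace D m g -> (k <= m)%N ->
  Hsq k (fun x => c * f x + g x) <= 2 * c ^+ 2 * Hsq k f + 2 * Hsq k g.
Proof.
move=> hf hg km; rewrite /Hsq !mulr_sumr -big_split /=; apply: ler_sum => s _.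
by apply: (energy_lin (m := m)) => //; rewrite size_tuple.
Qed.

Lemma Hspace_sub m f g : Hspace D m f -> Hspace D m g -> Hspace D m (fun x => f x - g x).
Proof.
move=> hf hg; rewrite (_ : (fun _ => _) = fun x => -1 * g x + f x); first exact: Hspace_lin.
by apply/funext => x; ring.
Qed.

Lemma energy_smooth s (phi : plane R -> R) : smooth phi ->
  energy s phi = \int[mu2]_(x in D) (pderiv (rev s) phi x ^+ 2).
Proof.
move=> sp; apply: ae_eq_Rintegral => //.
- apply: measurable_funX; apply: weakD_measurable => //.
  by exists (pderiv (rev s) phi); exact: is_weak_deriv_smooth.
- by apply: measurable_funX; apply: continuous_measurable2 => //; apply: smooth_continuous;
    exact: smooth_pderiv.
- by apply: ae2_sub (weakD_smooth s oD sp) => x h Dx; rewrite h.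
Qed.

Opaque energy.

Let le_sub_aux (a b c : R) : a <= 2 * (-1) ^+ 2 * b + 2 * c -> a <= 2 * c + 2 * b.
Proof. lra. Qed.

Let le_add_aux (a b c : R) : a <= 2 * 1 ^+ 2 * b + 2 * c -> a <= 2 * b + 2 * c.
Proof. lra. Qed.

Lemma Hsq_sub m k f g : Hspace D m f -> Hspace D m g -> (k <= m)%N ->
  Hsq k (fun x => f x - g x) <= 2 * Hsq k f + 2 * Hsq k g.
Proof.
move=> hf hg km; rewrite (_ : (fun _ => _) = fun x => -1 * g x + f x).
  exact: le_sub_aux (Hsq_lin (-1) hg hf km).
by apply/funext => x; ring.
Qed.

Lemma Hsq_split m k f g : Hspace D m f -> Hspace D m g -> (k <= m)%N ->
  Hsq k f <= 2 * Hsq k (fun x => f x - g x) + 2 * Hsq k g.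
Proof.
move=> hf hg km.
rewrite {1}(_ : f = fun x => 1 * (f x - g x) + g x); last by apply/funext => x; ring.
exact: le_add_aux (Hsq_lin 1 (Hspace_sub hf hg) hg km).
Qed.

Lemma test_sqr phi s : test_function D phi -> test_function D (fun x => pderiv s phi x ^+ 2).
Proof.
move=> tp; under eq_fun do rewrite expr2.
by apply: test_mul; [apply: smooth_pderiv; case: tp|exact: test_pderiv].
Qed.

Lemma energy_test s phi : test_function D phi ->
  energy s phi = \int[mu2]_x (pderiv (rev s) phi x ^+ 2).
Proof.
move=> tp; rewrite energy_smooth; last by case: tp.
by apply: (Rintegral_test_sub (D := D)) => //; exact: test_sqr.
Qed.

Lemma test_Hspace m phi : test_function D phi -> Hspace D m phi.
Proof.
move=> tp s _; have [sp _ _] := tp.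
have w : is_weak_deriv D s phi (pderiv (rev s) phi) by exact: is_weak_deriv_smooth.
split; first by eexists; exact: w.
have mw : measurable_fun (D : set T2) (weakD D s phi : T2 -> R).
  by apply: weakD_measurable => //; eexists; exact: w.
apply: (ae_integrable mD (f := fun x => pderiv (rev s) phi x ^+ 2)).
- by apply: (test_integrable (D := D)) => //; exact: test_sqr.
- exact: measurable_funX.
- by apply: ae2_sub (weakD_smooth s oD sp) => x h Dx; rewrite h.
Qed.

Lemma big_tuple0 (F : seq 'I_2 -> R) : \sum_(s : 0.-tuple 'I_2) F s = F [::].
Proof.
rewrite (bigD1 [tuple]) //= big1 ?addr0 // => s /negP; case; apply/eqP; exact: tuple0.
Qed.

Lemma big_tupleS k (F : seq 'I_2 -> R) :
  \sum_(s : k.+1.-tuple 'I_2) F s = \sum_(i < 2) \sum_(s : k.-tuple 'I_2) F (i :: s).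
Proof.
rewrite pair_big /=.
rewrite (reindex (fun p : 'I_2 * k.-tuple 'I_2 => cons_tuple p.1 p.2)) //=.
exists (fun t : k.+1.-tuple 'I_2 => (thead t, behead_tuple t)).
  by move=> [i s] _; congr pair; apply/val_inj.
by move=> t _; rewrite [RHS]tuple_eta; apply/val_inj.
Qed.

Lemma Hsq0E f : Hsq 0 f = energy [::] f.
Proof. exact: (big_tuple0 (energy^~ f)). Qed.

Lemma Hsq1E f : Hsq 1 f = \sum_(i < 2) energy [:: i] f.
Proof.
rewrite /Hsq (big_tupleS 0 (energy^~ f)); apply: eq_bigr => i _.
exact: (big_tuple0 (fun s => energy (i :: s) f)).
Qed.

Lemma Hsq2E f : Hsq 2 f = \sum_(i < 2) \sum_(j < 2) energy [:: i; j] f.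
Proof.
rewrite /Hsq (big_tupleS 1 (energy^~ f)); apply: eq_bigr => i _.
rewrite (big_tupleS 0 (fun s => energy (i :: s) f)); apply: eq_bigr => j _.
exact: (big_tuple0 (fun s => energy (i :: j :: s) f)).
Qed.

Lemma test_poincare01 phi (L : R) : 0 <= L -> D `<=` cbox (- L, - L) (L, L) ->
  test_function D phi -> Hsq 0 phi <= 4 * L ^+ 2 * Hsq 1 phi.
Proof.
move=> L0 DL tp; rewrite Hsq0E Hsq1E big_ord_recl.
apply: (@le_trans _ _ (4 * L ^+ 2 * energy [:: ord0] phi)).
  by rewrite !energy_test //=; exact: test_poincare DL.
rewrite ler_wpM2l ?mulr_ge0 ?sqr_ge0 // lerDl sumr_ge0 // => i _; exact: energy_ge0.
Qed.

(** A derivative of a test function is a test function, so the inequality of order zero applies to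
    each; the new letter comes last since [energy_test] reverses words. *)
Lemma test_poincare12 phi (L : R) : 0 <= L -> D `<=` cbox (- L, - L) (L, L) ->
  test_function D phi -> Hsq 1 phi <= 4 * L ^+ 2 * Hsq 2 phi.
Proof.
move=> L0 DL tp; rewrite Hsq1E Hsq2E mulr_sumr; apply: ler_sum => i _.
rewrite big_ord_recl.
apply: (@le_trans _ _ (4 * L ^+ 2 * energy [:: i; ord0] phi)).
  by rewrite !energy_test //=; apply: test_poincare DL => //; exact: test_derive.
rewrite ler_wpM2l ?mulr_ge0 ?sqr_ge0 // lerDl sumr_ge0 // => j _; exact: energy_ge0.
Qed.

Lemma H20_approx f : H20 D f -> forall c : R, 0 < c ->
  exists2 phi, test_function D phi &
    forall k, (k <= 2)%N -> Hsq k (fun x => f x - phi x) <= c.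
Proof.
move=> [_ _ _ h] c c0; have [|phi tp hp] := h (Num.sqrt c); first by rewrite sqrtr_gt0.
exists phi => // k k2.
have : Hnorm D 2 (fun x => f x - phi x) ^+ 2 <= c.
  rewrite -(sqr_sqrtr (ltW c0)) ler_sqr ?nnegrE ?sqrtr_ge0 //; exact: ltW.
rewrite sqr_sqrtr; last by apply: sumr_ge0 => i _; exact: sqr_ge0.
apply: le_trans; have k3 : (k < 3)%N by [].
rewrite (bigD1 (Ordinal k3)) //= Hsemi_sqr lerDl.
by apply: sumr_ge0 => i _; exact: sqr_ge0.
Qed.

Lemma H20_Hspace f : H20 D f -> Hspace D 2 f.
Proof. by case. Qed.

Lemma H20_loc_integrable f : H20 D f -> loc_integrable D f.
Proof. by move=> [cf _ _ _]; exact: continuous_loc_integrable. Qed.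

Lemma H20_intro f : continuous f -> (forall x, ~ D x -> f x = 0) -> Hspace D 2 f ->
  (forall c : R, 0 < c -> exists2 phi, test_function D phi &
    forall k, (k <= 2)%N -> Hsq k (fun x => f x - phi x) <= c) -> H20 D f.
Proof.
move=> cf f0 hf h; split => // c c0.
(* Three squared seminorms of at most c^2/4 have a sum strictly below c^2. *)
have c1 : 0 < c ^+ 2 / 4 by rewrite divr_gt0 // exprn_gt0.
have [phi tp hp] := h _ c1; exists phi => //.
rewrite /Hnorm -[ltRHS](gtr0_norm c0) -sqrtr_sqr ltr_sqrt ?exprn_gt0 //.
rewrite !big_ord_recl big_ord0 !Hsemi_sqr /=.
have h0 := hp 0%N isT; have h1 := hp 1%N isT; have h2 := hp 2 isT.
move: h0 h1 h2; rewrite /bump /=; move: (Hsq _ _) (Hsq _ _) (Hsq _ _) => a b d h0 h1 h2.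
have c2 : 0 < c ^+ 2 by rewrite exprn_gt0.
lra.
Qed.

Lemma test_H20 phi : test_function D phi -> H20 D phi.
Proof.
move=> tp; apply: H20_intro.
- by apply: smooth_continuous; case: tp.
- by move=> x; exact: test_out.
- exact: test_Hspace.
move=> c c0; exists phi => // k _.
have -> : (fun x => phi x - phi x) = fun=> 0 by apply/funext => x; rewrite subrr.
rewrite /Hsq big1 ?ltW // => s _; rewrite energy_test; last exact: test0.
apply: Rintegral_eq0 => x _.
suff -> : pderiv (rev s) (fun _ : plane R => 0 : R) = fun=> 0 by rewrite expr0n.
by elim: (rev s) => [//|i r /= ->]; apply/funext => y; rewrite derive_cst.
Qed.

Lemma H20_lin (c : R) f g : H20 D f -> H20 D g -> H20 D (fun x => c * f x + g x).
Proof.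
move=> hf hg; have Hf := H20_Hspace hf; have Hg := H20_Hspace hg.
apply: H20_intro.
- have [cf _ _ _] := hf; have [cg _ _ _] := hg => x.
  by apply: cvgD; [apply: cvgM; [exact: cvg_cst|exact: cf]|exact: cg].
- by move=> x Dx; have [_ f0 _ _] := hf; have [_ g0 _ _] := hg; rewrite f0 // g0 // mulr0 addr0.
- exact: Hspace_lin.
move=> d d0.
(* An error of d / (2 c^2 + 2) for each summand adds up to exactly d in [Hsq_lin]. *)
have c2 : 0 < 2 * c ^+ 2 + 2 by have := sqr_ge0 c; lra.
have [phi tp hp] := H20_approx hf (divr_gt0 d0 c2).
have [psi ts hs] := H20_approx hg (divr_gt0 d0 c2).
exists (fun x => c * phi x + psi x); first by apply: test_add => //; exact: test_scale.
move=> k k2.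
rewrite (_ : (fun _ => _) = fun x => c * (f x - phi x) + (g x - psi x)); last first.
  by apply/funext => x; ring.
have := Hsq_lin c (Hspace_sub Hf (test_Hspace (m := 2) tp)) (Hspace_sub Hg (test_Hspace (m := 2) ts)) k2.
move=> /le_trans; apply; have := hp k k2; have := hs k k2.
move=> h1 h2.
rewrite [X in _ <= X](_ : d = 2 * c ^+ 2 * (d / (2 * c ^+ 2 + 2)) + 2 * (d / (2 * c ^+ 2 + 2))); last first.
  by rewrite -mulrDl mulrCA divff ?mulr1 // gt_eqF.
have a0 : 0 <= 2 * c ^+ 2 by rewrite mulr_ge0 // sqr_ge0.
exact: (lerD (ler_wpM2l a0 h2) (ler_wpM2l (ler0n R 2) h1)).
Qed.

Lemma H20_sub f g : H20 D f -> H20 D g -> H20 D (fun x => f x - g x).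
Proof.
move=> hf hg; rewrite (_ : (fun _ => _) = fun x => -1 * g x + f x); first exact: H20_lin.
by apply/funext => x; ring.
Qed.

Transparent energy.
Lemma energyE s f : energy s f = \int[mu2]_(x in D) (weakD D s f x * weakD D s f x).
Proof. by rewrite /energy; apply: eq_Rintegral => x _; rewrite expr2. Qed.
Opaque energy.
(** Density of test functions: the two passages between [f] and its approximation double the
    constant twice, whence 16 and 64 in place of 4 and 16. *)
Lemma H20_poincare (L : R) f : 0 <= L -> D `<=` cbox (- L, - L) (L, L) -> H20 D f ->
  Hsq 1 f <= 16 * L ^+ 2 * Hsq 2 f /\ Hsq 0 f <= 64 * L ^+ 4 * Hsq 2 f.
Proof.
move=> L0 DL hf; have Hf := H20_Hspace hf.
have L4 : 0 <= L ^+ 4 by exact: exprn_ge0.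
have L2 : 0 <= L ^+ 2 by exact: exprn_ge0.
have main (c : R) : 0 < c ->
    Hsq 1 f <= (2 + 16 * L ^+ 2) * c + 16 * L ^+ 2 * Hsq 2 f /\
    Hsq 0 f <= (2 + 64 * L ^+ 4) * c + 64 * L ^+ 4 * Hsq 2 f.
  move=> c0; have [phi tp hp] := H20_approx hf c0.
  have Hp := test_Hspace (m := 2) tp.
  have h1 := le_trans (test_poincare12 L0 DL tp) (lexx _).
  have h0 := test_poincare01 L0 DL tp.
  have d0 := hp 0%N isT; have d1 := hp 1%N isT; have d2 := hp 2%N isT.
  have s0 := Hsq_split Hf Hp (isT : (0 <= 2)%N).
  have s1 := Hsq_split Hf Hp (isT : (1 <= 2)%N).
  have s2 : Hsq 2 phi <= 2 * Hsq 2 (fun x => f x - phi x) + 2 * Hsq 2 f.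
    rewrite {1}(_ : phi = fun x => f x - (f x - phi x)); last by apply/funext => x; ring.
    have h := Hsq_sub Hf (Hspace_sub Hf Hp) (isT : (2 <= 2)%N).
    rewrite addrC; exact: h.
  move: h0 h1 d0 d1 d2 s0 s1 s2.
  generalize (Hsq 0 phi) (Hsq 1 phi) (Hsq 2 phi) (Hsq 0 f) (Hsq 1 f) (Hsq 2 f)
    (Hsq 0 (fun x => f x - phi x)) (Hsq 1 (fun x => f x - phi x))
    (Hsq 2 (fun x => f x - phi x)) => p0 p1 p2 f0 f1 f2 e0 e1 e2 h0 h1 d0 d1 d2 s0 s1 s2.
  have h2 : p2 <= 2 * c + 2 * f2 by lra.
  have h1' : p1 <= 4 * L ^+ 2 * (2 * c + 2 * f2).
    by apply: le_trans h1 _; rewrite ler_wpM2l // mulr_ge0.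
  have h0' : p0 <= 4 * L ^+ 2 * (4 * L ^+ 2 * (2 * c + 2 * f2)).
    by apply: le_trans h0 _; rewrite ler_wpM2l // mulr_ge0.
  have E : 4 * L ^+ 2 * (4 * L ^+ 2 * (2 * c + 2 * f2)) = 32 * (L ^+ 4 * c) + 32 * (L ^+ 4 * f2) by ring.
  rewrite E in h0'.
  by split; lra.
have aux (a b d : R) : 0 <= b -> (forall c : R, 0 < c -> a <= b * c + d) -> a <= d.
  move=> b0 h; rewrite leNgt; apply/negP => da.
  (* With this [c] the error [b * c] is at most half of the gap [a - d]. *)
  have c0 : 0 < (a - d) / (b + 1) / 2 by rewrite !divr_gt0 ?subr_gt0 // ltr_wpDl.
  have := h _ c0; apply/negP; rewrite -ltNge.
  have b1 : 0 < b + 1 by rewrite ltr_wpDl.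
  have : b * ((a - d) / (b + 1) / 2) <= (a - d) / 2.
    rewrite mulrA ler_pM2r ?invr_gt0 // mulrA ler_pdivrMr // mulrC ler_pM2l ?subr_gt0 //.
    by rewrite lerDl.
  by move: (b * _) => z; lra.
split; [apply: (aux _ (2 + 16 * L ^+ 2))|apply: (aux _ (2 + 64 * L ^+ 4))].
- by rewrite addr_ge0 // mulr_ge0.
- by move=> c /main [].
- by rewrite addr_ge0 // mulr_ge0.
- by move=> c /main [].
Qed.

Lemma aform_sym f g : aform D f g = aform D g f.
Proof.
rewrite /aform; apply: eq_Rintegral => x _; apply: eq_bigr => i _; apply: eq_bigr => j _.
exact: mulrC.
Qed.

Lemma aformE f g : Hspace D 2 f -> Hspace D 2 g ->
  aform D f g = \sum_(i < 2) \sum_(j < 2)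
    \int[mu2]_(x in D) (weakD D [:: i; j] f x * weakD D [:: i; j] g x).
Proof.
move=> hf hg; have hi i j := Hspace_cross_integrable hf hg
  (isT : (size [:: i; j] <= 2)%N) (isT : (size [:: i; j] <= 2)%N).
rewrite /aform Rintegral_sum //; last by move=> i; apply: integrable_sum_R.
by apply: eq_bigr => i _; rewrite Rintegral_sum.
Qed.

Lemma aform_diag f : Hspace D 2 f -> aform D f f = Hsq 2 f.
Proof.
move=> hf; rewrite aformE // Hsq2E; apply: eq_bigr => i _; apply: eq_bigr => j _.
by rewrite energyE.
Qed.

Lemma aform_linl (c : R) f g w : Hspace D 2 f -> Hspace D 2 g -> Hspace D 2 w ->
  aform D (fun x => c * f x + g x) w = c * aform D f w + aform D g w.
Proof.
move=> hf hg hw; have hh := Hspace_lin c hf hg.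
rewrite !aformE // mulr_sumr -big_split; apply: eq_bigr => i _ /=.
rewrite mulr_sumr -big_split; apply: eq_bigr => j _ /=.
pose s : seq 'I_2 := [:: i; j]; have s2 : (size s <= 2)%N by [].
have i1 := Hspace_cross_integrable hf hw s2 s2.
have i2 := Hspace_cross_integrable hg hw s2 s2.
have m1 := Hspace_measurable hf s2; have m2 := Hspace_measurable hg s2.
have mw := Hspace_measurable hw s2; have mh := Hspace_measurable hh s2.
rewrite -RintegralZl // -RintegralD //; last exact: integrable_scale.
apply: ae_eq_Rintegral => //.
- exact: measurable_funM.
- by apply: measurable_funD; [apply: measurable_funM => //|]; exact: measurable_funM.
- have wf := Hspace_weakly_derivable hf s2; have wg := Hspace_weakly_derivable hg s2.
  by apply: ae2_sub (weakD_lin c oD wf wg) => x h Dx; rewrite h //; ring.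
Qed.

Lemma Hspace_sum (I : Type) (r : seq I) m (f : I -> plane R -> R) :
  (forall i, Hspace D m (f i)) -> Hspace D m (fun x => \sum_(i <- r) f i x).
Proof.
move=> hf; elim: r => [|i r IH].
  rewrite (_ : (fun _ => _) = fun=> 0); first by apply: test_Hspace; exact: test0.
  by apply/funext => x; rewrite big_nil.
rewrite (_ : (fun _ => _) = fun x => 1 * f i x + \sum_(j <- r) f j x); first exact: Hspace_lin.
by apply/funext => x; rewrite big_cons mul1r.
Qed.

Lemma weakD_sum (I : Type) (r : seq I) m s (f : I -> plane R -> R) : (size s <= m)%N ->
  (forall i, Hspace D m (f i)) ->
  \forall x \ae mu2, D x ->
    weakD D s (fun x => \sum_(i <- r) f i x) x = \sum_(i <- r) weakD D s (f i) x.
Proof.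
move=> sm hf; elim: r => [|i r IH].
  rewrite (_ : (fun _ => _) = fun=> 0); last by apply/funext => x; rewrite big_nil.
  have w0 : weakly_derivable D s (fun=> 0).
    by apply: (Hspace_weakly_derivable (m := m)) => //; apply: test_Hspace; exact: test0.
  by apply: ae2_sub (weakD_local oD oD (@subset_refl _ D) w0 (fun _ _ => erefl)) => x h Dx;
    rewrite h // big_nil.
rewrite (_ : (fun _ => _) = fun x => 1 * f i x + \sum_(j <- r) f j x); last first.
  by apply/funext => x; rewrite big_cons mul1r.
have wi := Hspace_weakly_derivable (hf i) sm.
have wr := Hspace_weakly_derivable (Hspace_sum r hf) sm.
apply: ae2_sub (ae2_and IH (weakD_lin 1 oD wi wr)) => x [h1 h2] Dx.
by rewrite h2 // h1 // big_cons mul1r.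
Qed.

Lemma sum_sqr_card (I : finType) (A : {pred I}) (g : I -> R) :
  (\sum_(i in A) g i) ^+ 2 <= #|A|%:R * \sum_(i in A) g i ^+ 2.
Proof.
rewrite expr2 mulr_suml.
have -> : #|A|%:R * \sum_(i in A) g i ^+ 2 =
    \sum_(i in A) \sum_(j in A) (2^-1 * g i ^+ 2 + 2^-1 * g j ^+ 2).
  pose S := \sum_(i in A) g i ^+ 2.
  rewrite [RHS](eq_bigr (fun i => #|A|%:R * 2^-1 * g i ^+ 2 + 2^-1 * S)); last first.
    by move=> i _; rewrite big_split /= sumr_const -mulr_sumr -mulr_natl -/S; ring.
  by rewrite big_split /= sumr_const -mulr_sumr -mulr_natl -/S; field.
apply: ler_sum => i _; rewrite mulr_sumr; apply: ler_sum => j _.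
by have := sqr_ge0 (g i - g j); rewrite !expr2; nra.
Qed.

Lemma energy_sqr s f : energy s f = \int[mu2]_(x in D) (weakD D s f x ^+ 2).
Proof. by rewrite energyE; apply: eq_Rintegral => x _; rewrite expr2. Qed.

(** Replacing [g] by the maximum of [f] and [g] changes it on a null set only and makes the
    inequality hold everywhere. *)
Lemma le_Rintegral_ae (A : set T2) (f g : T2 -> R) : measurable A ->
  mu2.-integrable A (EFin \o f) -> mu2.-integrable A (EFin \o g) ->
  (\forall x \ae mu2, A x -> f x <= g x) ->
  \int[mu2]_(x in A) f x <= \int[mu2]_(x in A) g x.
Proof.
move=> mA fi gi fg.
have mf : measurable_fun A f by have /integrableP [/measurable_EFinP] := fi.
have mg : measurable_fun A g by have /integrableP [/measurable_EFinP] := gi.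
pose h x := Num.max (f x) (g x).
have mh : measurable_fun A h by exact: measurable_maxr.
have gh : \forall x \ae mu2, A x -> g x = h x.
  by apply: ae2_sub fg => x fg Ax; rewrite /h max_r // fg.
rewrite (ae_eq_Rintegral mA mg mh gh); apply: le_Rintegral => //.
  exact: (ae_integrable mA gi mh gh).
by move=> x _; rewrite /h le_max lexx.
Qed.

Lemma sum_sqr_le_card (I : finType) (g : I -> R) (M : nat) :
  (#|[pred i | (g i != 0)%R]| <= M)%N -> (\sum_i g i) ^+ 2 <= M%:R * \sum_i g i ^+ 2.
Proof.
move=> hM; pose A := [pred i | g i != 0].
have E (F : R -> R) : F 0 = 0 -> \sum_i F (g i) = \sum_(i in A) F (g i).
  move=> F0; rewrite [RHS]big_mkcond /=; apply: eq_bigr => i _; rewrite inE.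
  by case: eqP => //= ->.
have E1 : \sum_i g i = \sum_(i in A) g i by exact: (E id).
have E2 : \sum_i g i ^+ 2 = \sum_(i in A) g i ^+ 2 by apply: (E (fun t => t ^+ 2)); rewrite expr0n.
rewrite E1 E2; apply: le_trans (sum_sqr_card A g) _.
apply: ler_wpM2r; last by rewrite ler_nat.
by apply: sumr_ge0 => i _; exact: sqr_ge0.
Qed.

(** Cauchy-Schwarz at almost every point, over the non-zero terms only; the factor is the
    multiplicity [M], not the number of functions. *)
Lemma Hsq_sum_le (I : finType) (f : I -> plane R -> R) (M : nat) k :
  (forall i, Hspace D k (f i)) ->
  (forall s, size s = k ->
    \forall x \ae mu2, D x -> (#|[pred i | (weakD D s (f i) x != 0)%R]| <= M)%N) ->
  Hsq k (fun x => \sum_i f i x) <= M%:R * \sum_i Hsq k (f i).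
Proof.
move=> hf hM; rewrite /Hsq exchange_big /= mulr_sumr; apply: ler_sum => s _.
have sk : (size s <= k)%N by rewrite size_tuple.
have ss : size s = k by rewrite size_tuple.
rewrite energy_sqr.
have hi i := Hspace_integrable (hf i) sk.
have hS : Hspace D k (fun x => \sum_i f i x) by exact: Hspace_sum.
have -> : M%:R * \sum_i energy s (f i) =
    \int[mu2]_(x in D) (M%:R * \sum_i (weakD D s (f i) x ^+ 2)).
  rewrite RintegralZl //; last exact: integrable_sum_R.
  rewrite Rintegral_sum //; congr (_ * _); apply: eq_bigr => i _.
apply: le_Rintegral_ae => //.
- exact: Hspace_integrable hS sk.
- exact: (integrable_scale M%:R mD (integrable_sum_R (index_enum I) mD hi)).
have hW := ae2_and (weakD_sum (index_enum I) sk hf) (hM s ss).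
apply: ae2_sub hW => x [h1 h2] Dx; rewrite (h1 Dx); have {}h2 := h2 Dx.
exact: sum_sqr_le_card h2.
Qed.

End Energy.
Opaque energy.

(** * A Hoelder inequality for test functions *)

Definition other (i : 'I_2) : 'I_2 := if i == ord0 then lift ord0 ord0 else ord0.

Definition put (i : 'I_2) (t u : R) : plane R := if i == ord0 then (t, u) else (u, t).

(** Tonelli's theorem; it turns a pointwise bound by integrals across the axis into a bound by an
    integral over the plane. *)
Lemma marginal_le (E : plane R -> R) (L : R) (i : 'I_2) (u : R -> R) :
  continuous E -> (forall x, 0 <= E x) ->
  (forall x, ~ cbox (- L, - L) (L, L) x -> E x = 0) -> continuous u ->
  (forall t, 0 <= u t) ->
  (forall t, u t <= \int[lebesgue_measure]_v E (put i t v)) ->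
  (\int[lebesgue_measure]_t (u t)%:E <= (\int[mu2]_x E x)%:E)%E.
Proof.
move=> cE E0 Eout cu u0 uE.
have iE : mu2.-integrable setT (EFin \o E).
  by apply: cc_integrable Eout _ => //; exact: cbox_compact.
have mE : measurable_fun setT (EFin \o (E : T2 -> R)) by have /integrableP [] := iE.
have E0' (x : T2) : (0 <= (EFin \o E) x)%E by rewrite lee_fin.
have mu : measurable_fun setT (fun t : R => (u t)%:E).
  by apply/measurable_EFinP; exact: continuous_measurable_fun.
have fE (t : R) : (\int[lebesgue_measure]_v (E (put i t v))%:E)%E =
    (\int[lebesgue_measure]_v E (put i t v))%:E.
  rewrite /Rintegral fineK //.
  have cs := @slice_continuous R E (other i) (t, t) cE.
  have := @cc1_integrable R _ (- L) L cs; rewrite /slice /other /put.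
  have := integrable_fin_num; case: (eqVneq i ord0) => [i0|i0] /= fin.
    move=> /(_ _) H; apply: fin => //; apply: H => v hv; apply: Eout => /cboxP /= [] //.
  move=> /(_ _) H; apply: fin => //; apply: H => v hv; apply: Eout => /cboxP /= [] //.
have -> : ((\int[mu2]_x E x)%:E = \int[mu2]_x (E x)%:E)%E.
  by rewrite /Rintegral fineK //; exact: integrable_fin_num.
have T1 : (\int[mu2]_x (E x)%:E =
    \int[lebesgue_measure]_s \int[lebesgue_measure]_t (E (s, t))%:E)%E.
  exact: (@fubini_tonelli1 _ _ _ _ R lebesgue_measure lebesgue_measure _ mE E0').
have T2' : (\int[lebesgue_measure]_s \int[lebesgue_measure]_t (E (s, t))%:E =
    \int[lebesgue_measure]_t \int[lebesgue_measure]_s (E (s, t))%:E)%E.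
  exact: (@fubini_tonelli _ _ _ _ R lebesgue_measure lebesgue_measure _ mE E0').
have uE' t : ((u t)%:E <= \int[lebesgue_measure]_v (E (put i t v))%:E)%E.
  by rewrite fE lee_fin.
rewrite /put in uE'; case: (eqVneq i ord0) => [i0|i0]; rewrite ?i0 ?(negbTE i0) ?eqxx in uE'.
  rewrite [leRHS]T1; apply: ge0_le_integral => //.
  - by move=> t _; rewrite lee_fin.
  - exact: (@measurable_fun_fubini_tonelli_F _ _ _ _ R lebesgue_measure _ mE E0').
rewrite [leRHS]T1 T2'; apply: ge0_le_integral => //.
- by move=> t _; rewrite lee_fin.
- exact: (@measurable_fun_fubini_tonelli_G _ _ _ _ R lebesgue_measure _ mE E0').
Qed.

Lemma put_slice i (F : plane R -> R) x t : F (put i t (if i == ord0 then x.2 else x.1)) = slice i F x t.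
Proof. by rewrite /put /slice; case: (i == ord0). Qed.

(** A trace inequality. With f the derivative of [phi] along axis [i], f^2 is the integral of 2 f df
    along the other axis, starting outside the support, and Young's inequality with weight [h]
    separates the factors. The weight will be the mesh size, for which both terms scale alike under
    inverse estimates. *)
Lemma test_slice_sqr D (phi : plane R -> R) (i : 'I_2) (h : R) (x : plane R) (t : R) :
  test_function D phi -> 0 < h ->
  'D_(e i) phi (put i t (if i == ord0 then x.2 else x.1)) ^+ 2 <=
  \int[lebesgue_measure]_v
    (h^-1 * 'D_(e i) phi (put i t v) ^+ 2 + h * 'D_(e (other i)) ('D_(e i) phi) (put i t v) ^+ 2).
Proof.
move=> tp h0.
pose j := other i.
pose f := 'D_(e i) phi; have tf : test_function D f by exact: test_derive.
pose g := 'D_(e j) f; have tg : test_function D g by exact: test_derive.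
have [sf _ _] := tf; have [sg _ _] := tg.
pose y : plane R := put i t 0.
have pE (F : plane R -> R) v : F (put i t v) = slice j F y v.
  by rewrite /put /slice /y /put /j /other; case: (eqVneq i ord0).
set a : R := if i == ord0 then x.2 else x.1.
pose E z := h^-1 * f z ^+ 2 + h * g z ^+ 2.
have tE : test_function D E.
  by apply: test_add; apply: test_scale; [exact: (test_sqr [:: i] tp)|exact: (test_sqr [:: j; i] tp)].
have [sE _ _] := tE.
have cE : continuous (slice j E y) by apply: slice_continuous; exact: smooth_continuous.
have E0 z : 0 <= E z by rewrite addr_ge0 // mulr_ge0 ?sqr_ge0 // ?invr_ge0 ltW.
pose u z := f z * f z.
have tu : test_function D u by exact: test_mul.
have [su _ _] := tu.
have [L L0 hL] := test_cbox tE.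
have [L' L'0 hL'] := test_cbox tu.
have out M (F : plane R -> R) v : (forall z, ~ cbox (- M, - M) (M, M) z -> F z = 0) ->
    ~ (- M <= v <= M) -> slice j F y v = 0.
  by move=> F0 hv; rewrite /slice; case: (j == ord0); apply: F0 => /cboxP /= [].
have gE z : 'D_(e j) f z = g z by [].
have iE := cc1_integrable cE (fun v => out L E v (hL [::])).
have -> : \int[lebesgue_measure]_v (h^-1 * f (put i t v) ^+ 2 + h * g (put i t v) ^+ 2) =
    \int[lebesgue_measure]_v slice j E y v by apply: eq_Rintegral => v _; rewrite -pE.
have -> : f (put i t a) ^+ 2 = slice j u y a by rewrite expr2 -pE.
(* Left of the support the value is 0 and the right-hand side is nonnegative. *)
have [aL|aL] := leP a (- L' - 1).
  rewrite (out L') //; [|exact: (hL' [::])|by move=> /andP[h1 h2]; lra].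
  by apply: Rintegral_ge0 => v _; rewrite -pE.
have uE : slice j u y a = \int[lebesgue_measure]_(v in `[- L' - 1, a]) slice j ('D_(e j) u) y v.
  rewrite (FTC2_Rintegral aL (fun v => is_derive_slice j y v su)).
    by rewrite (out L' u (- L' - 1)) ?subr0 //; [exact: (hL' [::])|move=> /andP[h1 h2]; lra].
  by apply: slice_continuous; apply: smooth_continuous; exact: smooth_derive.
rewrite uE; apply: (@le_trans _ _ (\int[lebesgue_measure]_(v in `[- L' - 1, a]) slice j E y v)).
  apply: le_Rintegral => //.
  - apply: continuous_compact_integrable; first exact: segment_compact.
    apply: continuous_subspaceT; apply: slice_continuous; apply: smooth_continuous.
    exact: smooth_derive.
  - by apply: (@integrableS _ _ _ _ setT).
  - move=> v _; rewrite -!pE (derive_smoothM _ _ sf sf) /E (gE _).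
    move: (f _) (g _) => p q.
    have h1 : 0 <= (h^-1) * (p - h * q) ^+ 2 by rewrite mulr_ge0 ?sqr_ge0 // invr_ge0 ltW.
    have h2 : h^-1 * (p - h * q) ^+ 2 = h^-1 * p ^+ 2 + h * q ^+ 2 - 2 * p * q.
      by field; rewrite gt_eqF.
    lra.
rewrite Rintegral_mkcond; apply: le_Rintegral => //.
  have : lebesgue_measure.-integrable `[- L' - 1, a] (EFin \o slice j E y).
    by apply: (@integrableS _ _ _ _ setT).
  move=> /integrable_mkcond - /(_ (measurable_itv _)).
  by apply: eq_integrable => // v _; rewrite /patch /=; case: ifP.
by move=> v _; rewrite /patch; case: ifP => // _; rewrite -pE.
Qed.

Definition strip_energy (phi : plane R -> R) (i : 'I_2) (h : R) (z : plane R) : R :=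
  h^-1 * 'D_(e i) phi z ^+ 2 + h * 'D_(e (other i)) ('D_(e i) phi) z ^+ 2.

Lemma test_slice_energy D (phi : plane R -> R) (i : 'I_2) (h : R) (x : plane R) :
  test_function D phi -> 0 < h ->
  (\int[lebesgue_measure]_t (slice i ('D_(e i) phi) x t ^+ 2)%:E <=
   (\int[mu2]_z strip_energy phi i h z)%:E)%E.
Proof.
move=> tp h0.
have tE : test_function D (strip_energy phi i h).
  by apply: test_add; apply: test_scale;
    [exact: (test_sqr [:: i] tp)|exact: (test_sqr [:: other i; i] tp)].
have [sE _ _] := tE; have [L L0 hL] := test_cbox tE.
apply: (@marginal_le _ L i).
- exact: smooth_continuous.
- by move=> z; rewrite addr_ge0 // mulr_ge0 ?sqr_ge0 // ?invr_ge0 ltW.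
- exact: (hL [::]).
- have := test_sqr [:: i] tp => -[sq _ _].
  have -> : (fun t => slice i ('D_(e i) phi) x t ^+ 2) =
      slice i (fun z => 'D_(e i) phi z ^+ 2) x.
    by apply/funext => t; rewrite /slice; case: (i == ord0).
  by apply: slice_continuous; exact: smooth_continuous.
- by move=> t; exact: sqr_ge0.
- by move=> t; rewrite -put_slice; exact: (test_slice_sqr i x t tp h0).
Qed.

(** The inequality |p| <= k p^2 + 1/k replaces Cauchy-Schwarz; keeping [k] free instead of optimal
    avoids square roots. *)
Lemma test_slice_holder_lt D (phi : plane R -> R) (i : 'I_2) (h k : R) (x : plane R) (s t : R) :
  test_function D phi -> 0 < h -> 0 < k -> s < t ->
  `|slice i phi x t - slice i phi x s| <=
  k * \int[mu2]_z strip_energy phi i h z + (t - s) / k.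
Proof.
move=> tp h0 k0 st; have [sp _ _] := tp.
have sf : smooth ('D_(e i) phi) by exact: smooth_derive.
have cw : continuous (slice i ('D_(e i) phi) x) by apply: slice_continuous; exact: smooth_continuous.
rewrite -(FTC2_Rintegral st (fun v => is_derive_slice i x v sp) cw).
have iw : lebesgue_measure.-integrable `[s, t] (EFin \o slice i ('D_(e i) phi) x).
  by apply: continuous_compact_integrable; [exact: segment_compact|exact: continuous_subspaceT].
have cw2 : continuous (slice i (fun z => 'D_(e i) phi z ^+ 2) x).
  by apply: slice_continuous; apply: smooth_continuous; have [] := test_sqr [:: i] tp.
have w2E v : slice i (fun z => 'D_(e i) phi z ^+ 2) x v = slice i ('D_(e i) phi) x v ^+ 2.
  by rewrite /slice; case: (i == ord0).
have iw2 : lebesgue_measure.-integrable `[s, t] (EFin \o slice i (fun z => 'D_(e i) phi z ^+ 2) x).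
  by apply: continuous_compact_integrable; [exact: segment_compact|exact: continuous_subspaceT].
have mst : measurable (`[s, t] : set (measurableTypeR R)) by exact: measurable_itv.
have fst' : (lebesgue_measure (`[s, t] : set R) < +oo)%E.
  by rewrite lebesgue_measure_itv; case: ifP; rewrite ?ltry // -EFinB ltry.
have ic : lebesgue_measure.-integrable `[s, t] (EFin \o (fun _ : R => k^-1)).
  apply: continuous_compact_integrable; first exact: segment_compact.
  by apply: continuous_subspaceT => v; exact: cvg_cst.
have nb := le_normr_Rintegral mst iw; apply: (le_trans nb) => {nb}.
apply: (@le_trans _ _ (\int[lebesgue_measure]_(v in `[s, t])
    (k * slice i (fun z => 'D_(e i) phi z ^+ 2) x v + k^-1))).
  apply: le_Rintegral => //.
  - by have := integrable_abse iw; apply: eq_integrable.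
  - have := integrableD mst (integrableZl mst k iw2) ic.
    by apply: eq_integrable => // v _; rewrite /= EFinD EFinM.
  move=> v _; rewrite w2E -real_normK ?num_real //.
  move: (`|_|) (normr_ge0 (slice i ('D_(e i) phi) x v)) => p p0.
  have h1 : 0 <= k * (p - k^-1) ^+ 2 by rewrite mulr_ge0 ?sqr_ge0 // ltW.
  have h2 : k * (p - k^-1) ^+ 2 = k * p ^+ 2 - 2 * p + k^-1.
    by field; rewrite gt_eqF.
  lra.
have ik : lebesgue_measure.-integrable `[s, t] (EFin \o (fun v => k * slice i (fun z => 'D_(e i) phi z ^+ 2) x v)).
  by have := integrableZl mst k iw2; apply: eq_integrable => // v _; rewrite /= EFinM.
rewrite RintegralD // RintegralZl // Rintegral_cst //.
have -> : fine (lebesgue_measure (`[s, t] : set R)) = t - s.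
  by rewrite lebesgue_measure_itv /= lte_fin st.
rewrite [k^-1 * _]mulrC lerD2r ler_pM2l //.
rewrite -lee_fin /Rintegral fineK; last exact: integrable_fin_num.
apply: le_trans (test_slice_energy i x tp h0).
under [leRHS]eq_integral do rewrite -w2E.
apply: ge0_subset_integral => //.
- by apply/measurable_EFinP; exact: continuous_measurable_fun.
- by move=> v _; rewrite lee_fin w2E sqr_ge0.
Qed.

Lemma test_slice_holder D (phi : plane R -> R) (i : 'I_2) (h k : R) (x : plane R) (s t : R) :
  test_function D phi -> 0 < h -> 0 < k ->
  `|slice i phi x t - slice i phi x s| <=
  k * \int[mu2]_z strip_energy phi i h z + `|t - s| / k.
Proof.
move=> tp h0 k0; have [ts|st|->] := ltgtP t s.
- rewrite distrC [X in _ + X / _]distrC (gtr0_norm (x := s - t)) ?subr_gt0 //.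
  exact: test_slice_holder_lt tp h0 k0 ts.
- rewrite (gtr0_norm (x := t - s)) ?subr_gt0 //; exact: test_slice_holder_lt tp h0 k0 st.
rewrite !subrr normr0 mul0r addr0 mulr_ge0 ?(ltW k0) //; apply: Rintegral_ge0 => z _.
by rewrite addr_ge0 // mulr_ge0 ?sqr_ge0 // ?invr_ge0 ltW.
Qed.

Lemma ler_bigsum (I : finType) (F : I -> R) i : (forall j, 0 <= F j) -> F i <= \sum_j F j.
Proof. by move=> F0; rewrite (bigD1 i) //= lerDl; apply: sumr_ge0. Qed.

Lemma strip_energy_le D (phi : plane R -> R) (i : 'I_2) (h : R) : open D ->
  test_function D phi -> 0 < h ->
  \int[mu2]_z strip_energy phi i h z <= h^-1 * Hsq D 1 phi + h * Hsq D 2 phi.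
Proof.
move=> oD tp h0; rewrite /strip_energy.
have i1 := test_integrable (test_sqr [:: i] tp) measurableT.
have i2 := test_integrable (test_sqr [:: other i; i] tp) measurableT.
rewrite RintegralD //; [|exact: integrable_scale i1|exact: integrable_scale i2].
rewrite RintegralZl // RintegralZl //.
have E1 : \int[mu2]_x ('D_(e i) phi x ^+ 2) = energy D [:: i] phi.
  exact/esym/(energy_test oD [:: i] tp).
have E2 : \int[mu2]_x ('D_(e (other i)) ('D_(e i) phi) x ^+ 2) = energy D [:: i; other i] phi.
  exact/esym/(energy_test oD [:: i; other i] tp).
have e0 s' : 0 <= energy D s' phi by exact: energy_ge0.
have e1 : energy D [:: i] phi <= Hsq D 1 phi.
  by rewrite Hsq1E; apply: (@ler_bigsum _ (fun j => energy D [:: j] phi)).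
have e2 : energy D [:: i; other i] phi <= Hsq D 2 phi.
  rewrite Hsq2E.
  apply: (le_trans (@ler_bigsum _ (fun j => energy D [:: i; j] phi) (other i) _)) => //.
  apply: (@ler_bigsum _ (fun i => \sum_j energy D [:: i; j] phi) i) => k.
  exact: sumr_ge0.
rewrite E1 E2.
by apply: lerD; apply: ler_wpM2l => //; rewrite ?invr_ge0 ltW.
Qed.

Let holder_aux (k a b c A B : R) : 0 < k -> a <= c -> b <= c ->
  k * a + A / k + (k * b + B / k) <= 2 * k * c + (A + B) / k.
Proof. by move=> k0 ac bc; rewrite mulrDl; nra. Qed.

(** The points are joined by a horizontal and a vertical segment through (q1, p2). The path may
    leave [D], but the test function is smooth on the whole plane. *)
Lemma test_holder D (phi : plane R -> R) (h k : R) (p q : plane R) : open D ->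
  test_function D phi -> 0 < h -> 0 < k ->
  `|phi p - phi q| <= 2 * k * (h^-1 * Hsq D 1 phi + h * Hsq D 2 phi) +
    (`|p.1 - q.1| + `|p.2 - q.2|) / k.
Proof.
move=> oD tp h0 k0.
have -> : phi p - phi q = (slice ord0 phi p p.1 - slice ord0 phi p q.1) +
    (slice (lift ord0 ord0) phi (q.1, p.2) p.2 - slice (lift ord0 ord0) phi (q.1, p.2) q.2).
  rewrite /slice /=; case: p q => [p1 p2] [q1 q2] /=; ring.
apply: le_trans (ler_normD _ _) _.
have h1 := test_slice_holder ord0 p q.1 p.1 tp h0 k0.
have h2 := test_slice_holder (lift ord0 ord0) (q.1, p.2) q.2 p.2 tp h0 k0.
apply: le_trans (lerD h1 h2) _.
have e1 := strip_energy_le ord0 oD tp h0.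
have e2 := strip_energy_le (lift ord0 ord0) oD tp h0.
exact: holder_aux k0 e1 e2.
Qed.

End WeakDerivatives.

Opaque energy.

(** * Convolution with a test function *)

Section Mollify.
Variable R : realType.
Implicit Types (D : set (plane R)) (f : plane R -> R) (i : 'I_2) (x y z v : plane R).
Local Notation e := (unit_dir R).
Local Notation T2 := (measurableTypeR R * measurableTypeR R)%type.

(** A quadratic increment is o(v), so the zero map is the differential. *)
Lemma quadratic_diff (V W : normedModType R) (E : V -> W) (x : V) (C : R) : 0 <= C ->
  (forall v : V, `|v| <= 1 -> `|E (v + x) - E x| <= C * `|v| ^+ 2) ->
  differentiable E x /\ forall v : V, 'D_v E x = 0.
Proof.
move=> C0 hE.
have n0 (a : R) : 0 < a -> \forall v \near (0 : V), `|v| <= a.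
  by move=> a0; apply/nbhs_norm0P; exists a => // v /ltW.
have c0 : continuous (\0 : {linear V -> W}) by move=> y; exact: cvg_cst.
have h : E \o shift x = cst (E x) + (\0 : {linear V -> W}) +o_ 0 id.
  apply/eqaddoP => eps eps0; near=> v.
  have v1 : `|v| <= 1 by near: v; exact: n0.
  have v2 : `|v| <= eps / (C + 1).
    by near: v; apply: n0; rewrite divr_gt0 // ltr_wpDl.
  rewrite /= !fctE /= /shift /= addr0.
  apply: le_trans (hE v v1) _; rewrite expr2 mulrA ler_wpM2r //.
  apply: le_trans (ler_wpM2l C0 v2) _.
  by rewrite mulrCA ler_piMr ?(ltW eps0) // ler_pdivrMr ?mul1r ?lerDl // ltr_wpDl.
have d0 := diff_unique c0 h.
have dE : differentiable E x by apply/diff_locallyP; rewrite d0.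
by split=> // v; rewrite deriveE // d0.
Unshelve. all: end_near.
Qed.

Lemma smooth_mean_value (F : plane R -> R) x y : smooth F ->
  exists xi eta : plane R, [/\ `|xi - x| <= `|y - x|, `|eta - x| <= `|y - x| &
    F y - F x = (y.1 - x.1) * 'D_(e ord0) F xi + (y.2 - x.2) * 'D_(e (lift ord0 ord0)) F eta].
Proof.
move=> sF.
have mv (G g : R -> R) (a b : R) : (forall t : R, is_derive t 1 G (g t)) ->
    exists2 c, `|c - a| <= `|b - a| & G b - G a = (b - a) * g c.
  move=> dG; have [ab|/ltW ab] := leP a b.
    have [c /andP[h1 h2] ->] := MVT_ex ab dG; exists c; last by rewrite mulrC.
    by rewrite !ger0_norm ?subr_ge0 // lerB.
  have [c /andP[h1 h2] h] := MVT_ex ab dG; exists c; last by rewrite -opprB h; lra.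
  by rewrite !ler0_norm ?subr_le0 // lerN2 lerB.
have [c1 h1 e1] := mv _ _ x.1 y.1 (fun t => is_derive_slice ord0 x t sF).
have [c2 h2 e2] := mv _ _ x.2 y.2 (fun t => is_derive_slice (lift ord0 ord0) y t sF).
exists (c1, x.2), (y.1, c2); split.
- by rewrite !prod_normE /= subrr normr0 ge_max le_max h1 /= le_max normr_ge0.
- by rewrite !prod_normE /= ge_max !le_max lexx h2 orbT.
move: e1 e2; rewrite /slice /= -!surjective_pairing => <- <-.
by rewrite [RHS]addrC addrA subrK.
Qed.

Lemma test_bounded D F s : test_function D F -> exists2 M : R, 0 <= M & forall x, `|pderiv s F x| <= M.
Proof.
move=> tF; have [L L0 hL] := test_cbox tF.
have [sF _ _] := test_pderiv s tF.
have : compact (pderiv s F @` cbox (- L, - L) (L, L)).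
  apply: continuous_compact; last exact: cbox_compact.
  exact/continuous_subspaceT/smooth_continuous.
move=> /compact_bounded [M [Mr hM]]; exists (`|M| + 1); first by rewrite addr_ge0.
have M1 : M < `|M| + 1 by rewrite (le_lt_trans (ler_norm M)) // ltrDl.
move=> x; have [xL|xL] := pselect (cbox (- L, - L) (L, L) x).
  by apply: (hM _ M1); exists x.
by rewrite hL // normr0 addr_ge0.
Qed.

Let taylor_aux (a b p q A B n : R) : `|a| <= n -> `|b| <= n ->
  `|p| <= A * n -> `|q| <= B * n -> `|a * p + b * q| <= (A + B) * n ^+ 2.
Proof.
move=> an bn pn qn; apply: le_trans (ler_normD _ _) _; rewrite !normrM mulrDl expr2.
by apply: lerD; rewrite mulrCA ler_pM.
Qed.

Let lip_aux (a b p q A B n : R) : `|a| <= n -> `|b| <= n ->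
  `|p| <= A -> `|q| <= B -> `|a * p + b * q| <= (A + B) * n.
Proof.
move=> an bn pn qn; apply: le_trans (ler_normD _ _) _; rewrite !normrM mulrDl.
by apply: lerD; rewrite mulrC ler_pM.
Qed.

(** The first derivatives of a test function are Lipschitz because its second derivatives are
    bounded. Uniformity of the remainder in [z] is what permits integration against [f]. *)
Lemma test_taylor D F : test_function D F -> exists2 M : R, 0 <= M & forall z v,
  `|F (v + z) - F z - (v.1 * 'D_(e ord0) F z + v.2 * 'D_(e (lift ord0 ord0)) F z)| <= M * `|v| ^+ 2.
Proof.
move=> tF; have [sF _ _] := tF.
have lip i : exists2 M : R, 0 <= M & forall z y, `|'D_(e i) F y - 'D_(e i) F z| <= M * `|y - z|.
  have [M0 M00 h0] := test_bounded [:: ord0; i] tF.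
  have [M1 M10 h1] := test_bounded [:: lift ord0 ord0; i] tF.
  exists (M0 + M1) => [|z y]; first exact: addr_ge0.
  have [xi [eta [_ _ ->]]] := smooth_mean_value z y (smooth_derive i sF).
  have l1 : `|y.1 - z.1| <= `|y - z| by rewrite prod_normE /= le_max lexx.
  have l2 : `|y.2 - z.2| <= `|y - z| by rewrite prod_normE /= le_max lexx orbT.
  by apply: lip_aux => //; [exact: h0|exact: h1].
have [M0 M00 h0] := lip ord0.
have [M1 M10 h1] := lip (lift ord0 ord0).
exists (M0 + M1) => [|z v]; first exact: addr_ge0.
have [xi [eta [b1 b2 ->]]] := smooth_mean_value z (v + z) sF.
have vz : v + z - z = v by rewrite addrK.
rewrite vz in b1 b2.
have -> : ((v + z).1 - z.1) * 'D_(e ord0) F xi + ((v + z).2 - z.2) * 'D_(e (lift ord0 ord0)) F eta -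
  (v.1 * 'D_(e ord0) F z + v.2 * 'D_(e (lift ord0 ord0)) F z) =
  v.1 * ('D_(e ord0) F xi - 'D_(e ord0) F z) +
  v.2 * ('D_(e (lift ord0 ord0)) F eta - 'D_(e (lift ord0 ord0)) F z).
  rewrite /= !addrK; move: ('D_ _ _ _) ('D_ _ _ _) ('D_ _ _ _) ('D_ _ _ _) => p1 p2 p3 p4.
  by rewrite !mulrBr opprD addrACA.
have l1 : `|v.1| <= `|v| by rewrite prod_normE /= le_max lexx.
have l2 : `|v.2| <= `|v| by rewrite prod_normE /= le_max lexx orbT.
apply: taylor_aux => //; first exact: le_trans (h0 _ _) (ler_wpM2l M00 b1).
exact: le_trans (h1 _ _) (ler_wpM2l M10 b2).
Qed.

Lemma integrable_sub (A : set T2) (f g : T2 -> R) : measurable A ->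
  mu2.-integrable A (EFin \o f) -> mu2.-integrable A (EFin \o g) ->
  mu2.-integrable A (EFin \o (fun x => f x - g x)).
Proof. by move=> mA hf hg; have := integrableB mA hf hg; apply: eq_integrable. Qed.

Definition conv f (rho : plane R -> R) x : R := \int[mu2]_y (f y * rho (x - y)).

Lemma conv_integrable f rho x : continuous f -> test_function setT rho ->
  mu2.-integrable setT (EFin \o (fun y : T2 => f y * rho (x - y))).
Proof.
move=> cf tr; have [L L0 hL] := test_cbox tr.
have [sr _ _] := tr.
apply: (@cc_integrable R _ (cbox (x.1 - L, x.2 - L) (x.1 + L, x.2 + L))) => //.
- exact: cbox_compact.
- move=> y; apply: cvgM; first exact: cf.
  apply: (@continuous_comp _ _ _ (fun y : plane R => x - y) rho); last exact: smooth_continuous.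
  by apply: cvgB; [exact: cvg_cst|exact: cvg_id].
move=> y yx; rewrite (_ : rho _ = 0) ?mulr0 //; apply: (hL [::]).
move=> /cboxP /= [/andP[h1 h2] /andP[h3 h4]]; apply: yx; apply/cboxP => /=; split; apply/andP; split; lra.
Qed.

(** The Taylor remainder of [rho] is integrated against [f]. It vanishes outside the box [B], whose
    margin 1 allows for |v| <= 1, and the continuous [f] is integrable on [B]. *)
Lemma conv_quadratic f rho x : continuous f -> test_function setT rho ->
  exists2 C : R, 0 <= C & forall v, `|v| <= 1 ->
  `|conv f rho (v + x) - conv f rho x -
    (v.1 * conv f ('D_(e ord0) rho) x + v.2 * conv f ('D_(e (lift ord0 ord0)) rho) x)|
  <= C * `|v| ^+ 2.
Proof.
move=> cf tr; have [L L0 hL] := test_cbox tr.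
have [M M0 hM] := test_taylor tr.
pose B : set (plane R) := cbox (x.1 - (L + 1), x.2 - (L + 1)) (x.1 + (L + 1), x.2 + (L + 1)).
have mB : measurable (B : set T2) by exact: cbox_measurable.
pose I := \int[mu2]_(y in B) `|f y|.
exists (M * I) => [|v v1].
  by apply: mulr_ge0 => //; apply: Rintegral_ge0.
pose T (z : plane R) := rho (v + z) - rho z -
  (v.1 * 'D_(e ord0) rho z + v.2 * 'D_(e (lift ord0 ord0)) rho z).
have iv := conv_integrable (v + x) cf tr.
have i0 := conv_integrable x cf tr.
have iD i := conv_integrable x cf (test_derive i tr).
have iZ (c : R) i := integrable_scale c (measurableT : measurable (setT : set T2)) (iD i).
have dD : mu2.-integrable setT (EFin \o (fun y : T2 =>
    v.1 * (f y * 'D_(e ord0) rho (x - y)) + v.2 * (f y * 'D_(e (lift ord0 ord0)) rho (x - y)))).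
  by apply: integrable_add => //; exact: iZ.
have dB := integrable_sub measurableT iv i0.
have TE y : f y * T (x - y) = (f y * rho (v + x - y) - f y * rho (x - y)) -
    (v.1 * (f y * 'D_(e ord0) rho (x - y)) + v.2 * (f y * 'D_(e (lift ord0 ord0)) rho (x - y))).
  rewrite /T addrA; move: (rho _) (rho _) ('D_ _ _ _) ('D_ _ _ _) => p1 p2 p3 p4; ring.
have iT : mu2.-integrable B (EFin \o (fun y : T2 => f y * T (x - y))).
  apply: (@integrableS _ _ _ _ setT) => //.
  by have := integrable_sub measurableT dB dD; apply: eq_integrable => // y _; rewrite /= TE.
have -> : conv f rho (v + x) - conv f rho x -
    (v.1 * conv f ('D_(e ord0) rho) x + v.2 * conv f ('D_(e (lift ord0 ord0)) rho) x) =
    \int[mu2]_y (f y * T (x - y)).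
  rewrite -!RintegralZl //; [|exact: iD..].
  rewrite -RintegralD //; [|exact: iZ..].
  rewrite -RintegralB // -RintegralB //; apply: eq_Rintegral => y _; exact: esym (TE _).
have T0 y : ~ B y -> T (x - y) = 0.
  move=> By; have v1' : `|v.1| <= 1 by apply: le_trans v1; rewrite prod_normE /= le_max lexx.
  have v2' : `|v.2| <= 1 by apply: le_trans v1; rewrite prod_normE /= le_max lexx orbT.
  move: v1' v2'; rewrite !ler_norml => /andP[? ?] /andP[? ?].
  have a1 : ~ cbox (- L, - L) (L, L) (v + (x - y)).
    move=> /cboxP /= [/andP[? ?] /andP[? ?]]; apply: By; apply/cboxP => /=.
    by split; apply/andP; split; lra.
  have a2 : ~ cbox (- L, - L) (L, L) (x - y).
    move=> /cboxP /= [/andP[? ?] /andP[? ?]]; apply: By; apply/cboxP => /=.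
    by split; apply/andP; split; lra.
  have := hL [::] _ a1; have := hL [::] _ a2; have := hL [:: ord0] _ a2.
  have := hL [:: lift ord0 ord0] _ a2; rewrite /T /= => -> -> -> ->.
  by rewrite !mulr0 addr0 !subr0.
have iB : mu2.-integrable B (EFin \o (fun y : T2 => `|f y|)).
  by apply: compact_integrable; [exact: cbox_compact|move=> y; apply: cvg_norm; exact: cf].
rewrite (_ : \int[mu2]_y (f y * T (x - y)) = \int[mu2]_(y in B) (f y * T (x - y))); last first.
  rewrite [RHS]Rintegral_mkcond; apply: eq_Rintegral => y _; rewrite /patch.
  by case: ifPn => // /negP yB; rewrite T0 ?mulr0 // => h; apply: yB; rewrite inE.
apply: le_trans (le_normr_Rintegral mB iT) _.
rewrite mulrAC -RintegralZl //; apply: le_Rintegral => //.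
- by have := integrable_abse iT; apply: eq_integrable.
- by apply: integrable_scale.
by move=> y _; rewrite normrM mulrC ler_wpM2r // hM.
Qed.

Lemma smooth_linear_form (a b : R) : smooth (fun z : plane R => a * z.1 + b * z.2).
Proof.
have l1 (c : R) : smooth1 (fun t : R => c * t) by apply: smooth1Z; exact: smooth1_id.
have := smoothD (smooth_tensor (l1 a) (smooth1_cst 1)) (smooth_tensor (smooth1_cst 1) (l1 b)).
by congr smooth; apply/funext => z; rewrite mulr1 mul1r.
Qed.

Lemma derive_linear_form (a b : R) i x :
  'D_(e i) (fun z : plane R => a * z.1 + b * z.2) x = if i == ord0 then a else b.
Proof.
have dl (c d t : R) : derive1 (fun s : R => c * s + d) t = c.
  by rewrite derive1E deriveD // deriveM // !derive_cst derive_id scaler0 !addr0 /GRing.scale /= mulr1.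
rewrite derive_slice /slice /coord; case: (i == ord0) => /=; first exact: dl.
rewrite (_ : (fun t => _) = fun t : R => b * t + a * x.1) ?dl //.
by apply/funext => t; rewrite addrC.
Qed.

Lemma ord2_neq0 i : i != ord0 -> i = lift ord0 ord0.
Proof. by case: i => [[|[|]]] // hi _; apply/val_inj. Qed.

Lemma conv_derive f rho x : continuous f -> test_function setT rho ->
  differentiable (conv f rho) x /\
  forall i, 'D_(e i) (conv f rho) x = conv f ('D_(e i) rho) x.
Proof.
move=> cf tr; have [C C0 hC] := conv_quadratic x cf tr.
move: hC; set a := conv f ('D_(e ord0) rho) x; set b := conv f ('D_(e (lift ord0 ord0)) rho) x.
have ab i : conv f ('D_(e i) rho) x = if i == ord0 then a else b.
  by rewrite /a /b; have [->//|/ord2_neq0 ->] := eqVneq i ord0.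
move: a b ab => a b ab hC.
(* Subtracting the candidate differential [G] leaves a function with quadratic increments at [x]. *)
pose G (z : plane R) := a * z.1 + b * z.2.
have [dE E0] : differentiable (fun z => conv f rho z - G z) x /\
    forall v : plane R, 'D_v (fun z => conv f rho z - G z) x = 0.
  apply: (quadratic_diff C0) => v /hC; apply: le_trans.
  have GE : G (v + x) - G x = v.1 * a + v.2 * b.
    by rewrite /G /=; move: (v.1) (v.2) (x.1) (x.2) => v1 v2 x1 x2; ring.
  rewrite -GE le_eqVlt; apply/orP; left; apply/eqP; congr (`|_|).
  by move: (G _) (G _) (conv _ _ _) (conv _ _ _) => p1 p2 p3 p4; ring.
have dG : differentiable G x by exact: smooth_differentiable (smooth_linear_form a b).
have fE : conv f rho = (fun z => (conv f rho z - G z) + G z) by apply/funext => z; rewrite subrK.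
have dF : differentiable (conv f rho) x by rewrite fE; exact: differentiableD.
split=> // i; rewrite ab -(derive_linear_form a b i x) fE deriveD; [|exact: diff_derivable..].
by rewrite E0 add0r.
Qed.

Lemma pderiv_conv f rho s : continuous f -> test_function setT rho ->
  pderiv s (conv f rho) = conv f (pderiv s rho).
Proof.
move=> cf tr; elim: s => //= i s ->; apply/funext => x.
by have [_ ->] := conv_derive x cf (test_pderiv s tr).
Qed.

Lemma smooth_conv f rho : continuous f -> test_function setT rho -> smooth (conv f rho).
Proof.
move=> cf tr s x; rewrite pderiv_conv //.
by have [] := conv_derive x cf (test_pderiv s tr).
Qed.

Lemma derive_reflect (F : plane R -> R) x i y : smooth F ->
  'D_(e i) (fun y => F (x - y)) y = - 'D_(e i) F (x - y).
Proof.
move=> sF; rewrite derive_slice.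
have := is_derive_affine (is_derive_slice i (x - y) (-1 * coord i y + coord i x) sF).
rewrite (_ : (fun t => _) = slice i (fun y => F (x - y)) y); last first.
  apply/funext => t; rewrite /slice /coord.
  have h (a b : R) : -1 * a + b = b - a by rewrite mulN1r addrC.
  by case: (i == ord0) => /=; rewrite h; case: x y => ? ? [].
move=> h; rewrite derive1E (@derive_val _ _ _ _ _ _ _ h).
have {}h (a b : R) : - a + b = b - a by rewrite addrC.
rewrite !mulN1r.
by rewrite /slice /coord; case: (i == ord0) => /=; rewrite h; case: x y => ? ? [].
Qed.

Lemma smooth_reflect (F : plane R -> R) x : smooth F -> smooth (fun y => F (x - y)).
Proof.
move=> sF; apply/smoothP => n; elim: n F sF => [|n IH] F sF; (split; first move=> y) => //.
- apply: (@differentiable_comp _ _ _ _ (fun y : plane R => x - y) F); last exact: smooth_differentiable.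
  by apply: differentiableB.
- apply: (@differentiable_comp _ _ _ _ (fun y : plane R => x - y) F); last exact: smooth_differentiable.
  by apply: differentiableB.
move=> i; rewrite (_ : 'D_(e i) _ = fun y => -1 * 'D_(e i) F (x - y)).
  exact: (IH (fun z => -1 * 'D_(e i) F z) (smoothZ (-1) (smooth_derive i sF))).
by apply/funext => y; rewrite derive_reflect // mulN1r.
Qed.

Lemma pderiv_reflect (F : plane R -> R) x s : smooth F ->
  pderiv s (fun y => F (x - y)) = fun y => (-1) ^+ size s * pderiv s F (x - y).
Proof.
move=> sF; elim: s => [|i s IH] /=; first by apply/funext => y; rewrite expr0 mul1r.
have sp := smooth_pderiv s sF.
rewrite IH; apply/funext => y.
have -> : 'D_(e i) (fun y => (-1) ^+ size s * pderiv s F (x - y)) y =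
   (-1) ^+ size s * 'D_(e i) (fun y => pderiv s F (x - y)) y.
  have := congr1 (fun G : plane R -> R => G y) (pderivZ [:: i] ((-1) ^+ size s) (smooth_reflect x sp)).
  by [].
by rewrite derive_reflect // exprS mulrN mulN1r mulNr.
Qed.

(** The reflection y -> x - y and the definition of the weak derivative each contribute
    [(-1) ^+ size s], and these cancel. The kernel at [x] has to be supported in [D], where the weak
    derivative lives. *)
Lemma conv_weakD D f rho s x : open D -> continuous f -> weakly_derivable D s f ->
  test_function setT rho -> test_function D (fun y => rho (x - y)) ->
  pderiv s (conv f rho) x = \int[mu2]_(y in D) (weakD D s f y * rho (x - y)).
Proof.
move=> oD cf wf tr tD; have [sr _ _] := tr; rewrite pderiv_conv //.
have [_ _ /(_ _ tD)] := weakDP wf; rewrite pderiv_reflect //.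
have -> : \int[mu2]_(y in D) (f y * ((-1) ^+ size s * pderiv s rho (x - y))) =
    (-1) ^+ size s * \int[mu2]_(y in D) (f y * pderiv s rho (x - y)).
  rewrite -RintegralZl; first by apply: eq_Rintegral => y _; rewrite mulrCA.
    exact: open_measurable2.
  apply: (@integrableS _ _ _ _ setT) => //; first exact: open_measurable2.
  exact: (conv_integrable x cf (test_pderiv s tr)).
have s0 : (-1) ^+ size s != 0 :> R by rewrite signr_eq0.
move/(mulfI s0) => <-; rewrite /conv [RHS]Rintegral_mkcond; apply: eq_Rintegral => y _.
rewrite /patch; case: ifPn => // /negP yD.
have tDs := test_pderiv s tD; have Dy : ~ D y by move=> h; apply: yD; rewrite inE.
have := test_out tDs Dy; rewrite pderiv_reflect //= => /eqP.
by rewrite mulf_eq0 (negbTE s0) /= => /eqP ->; rewrite mulr0.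
Qed.

Lemma nondecreasing_is_derive_ge0 (f : R -> R) (df t : R) :
  {homo f : s t / s <= t} -> (forall s : R, derivable f s 1) -> is_derive t 1 f df -> 0 <= df.
Proof.
move=> hf dF h; rewrite leNgt; apply/negP => df0.
(* Adding the identity makes the function strictly increasing, and the factor is chosen for [g] to
   have derivative -1 at [t]. *)
pose g (s : R) := (- 2 / df) * f s + s.
have c0 : 0 < - 2 / df by rewrite mulNr -mulrN -invrN divr_gt0 // oppr_gt0.
have dg s : derivable g s 1.
  apply: (@derivableD _ _ _ (fun s => - 2 / df * f s) id) => //.
  exact: (@derivableM _ _ (cst (- 2 / df)) f).
have := @incr_derive1_ge0 _ g setT t; rewrite interiorT => /(_ _ _ I) h1.
suff : 0 <= derive1 g t.
  have -> : derive1 g t = - 1.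
    rewrite derive1E (@deriveD _ _ _ (fun s => - 2 / df * f s) id) //.
    rewrite (@deriveM _ _ (cst (- 2 / df)) f) // derive_cst scaler0 addr0 derive_id.
    have -> : 'D_1 f t = df := @derive_val _ _ _ _ _ _ _ h.
    rewrite /cst /GRing.scale /= mulfVK ?lt_eqF //.
    by rewrite (_ : -2 + 1 = -1 :> R) //; lra.
  by rewrite leNgt ltrN10.
apply: h1 => [s _|s r _ _ sr] //.
by rewrite /g ler_ltD // ler_pM2l // hf // ltW.
Qed.

(** * The mollifier and the mollified partition of unity *)

Definition fstep (r t : R) : R := step (r^-1 * t + 0).
(** Derivative of [fstep r]: for positive [r], a smooth density of mass one carried by [0, r]. The
    summand 0 fits the lemmas on affine substitutions. *)
Definition dens (r t : R) : R := r^-1 * derive1 (@step R) (r^-1 * t + 0).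

Lemma smooth1_fstep r : smooth1 (fstep r).
Proof. exact: smooth1_affine (@smooth1_step R). Qed.

Lemma derive1_fstep r : derive1 (fstep r) = dens r.
Proof. exact: derive1_affine (@smooth1_step R). Qed.

Lemma smooth1_dens r : smooth1 (dens r).
Proof. by rewrite -derive1_fstep; apply: smooth1_derive1; exact: smooth1_fstep. Qed.

Lemma derive1_const (f : R -> R) (c t : R) :
  (\forall s \near t, f s = c) -> derive1 f t = 0.
Proof.
move=> h; have h0 := @is_derive_cst _ R R c t 1.
have h1 : is_derive t 1 f (0 : R).
  by apply: near_eq_is_derive h0; apply: filterS h => s ->.
by rewrite derive1E; have -> := @derive_val _ _ _ _ _ _ _ h1.
Qed.

Lemma derive1_step_out t : ~ (0 <= t <= 1) -> derive1 (@step R) t = 0.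
Proof.
move=> ht; have [t0|t0] := ltP t 0.
  apply: (@derive1_const _ 0); near=> s; apply: step_le0; apply: ltW; near: s; exact: lt_nbhsl.
have [t1|t1] := ltP 1 t; last by exfalso; apply: ht; rewrite t0.
apply: (@derive1_const _ 1); near=> s; apply: step_ge1; apply: ltW; near: s; exact: lt_nbhsr.
Unshelve. all: end_near.
Qed.

Section Dens.
Variable r : R.
Hypothesis r0 : 0 < r.

Let affE t : r^-1 * t + 0 = t / r.
Proof. by rewrite addr0 mulrC. Qed.

Lemma dens_out t : ~ (0 <= t <= r) -> dens r t = 0.
Proof.
move=> ht; rewrite /dens derive1_step_out ?mulr0 //; rewrite affE => /andP[h1 h2].
by apply: ht; move: h1 h2; rewrite ler_pdivrMr // mul1r ler_pdivlMr // mul0r => -> ->.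
Qed.

Lemma dens_ge0 t : 0 <= dens r t.
Proof.
apply: (@nondecreasing_is_derive_ge0 (fstep r) _ t).
- by move=> s u su; apply: step_homo; rewrite lerD2r ler_pM2l // invr_gt0.
- by move=> s; apply: (@ex_derive _ _ _ _ _ _ _ (smooth1_is_derive s (smooth1_fstep r))).
by rewrite -derive1_fstep; apply: smooth1_is_derive; exact: smooth1_fstep.
Qed.

Lemma Rintegral_dens a : \int[lebesgue_measure]_t dens r (a - t) = 1.
Proof.
have ar : a - r < a by rewrite ltrBlDr ltrDl.
rewrite (@Rintegral_support _ _ (a - r) a); last first.
  by move=> t ht; apply: dens_out => /andP[h1 h2]; apply: ht; apply/andP; split; lra.
have dF (t : R) : is_derive t 1 (fun t => (-1) * fstep r (-1 * t + a)) (dens r (a - t)).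
  have h := is_derive_affine (smooth1_is_derive (-1 * t + a) (smooth1_fstep r)).
  have := is_derive_mul (@is_derive_cst _ R R (-1) t 1) h.
  rewrite derive1_fstep /cst mulrA mulrNN !mul1r mul0r addr0 mulN1r.
  by rewrite [- t + a]addrC.
rewrite (FTC2_Rintegral ar dF); last first.
  move=> t; apply: (@continuous_comp _ _ _ (fun t : R => a - t) (dens r)).
    by apply: cvgB; [exact: cvg_cst|exact: cvg_id].
  exact: smooth1_continuous (smooth1_dens r) _.
rewrite /fstep !affE step_le0; last by rewrite mulN1r addNr mul0r.
by rewrite step_ge1 ?mulr0 ?mulr1 ?sub0r ?opprK // mulN1r opprB subrK divff // gt_eqF.
Qed.

(** The support lies in the one-sided square [0, r]^2, so averages at [x] use the box with upper
    corner [x]; this is the origin of the boxes [cbox (x.1 - r, x.2 - r) x]. *)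
Definition mol (z : plane R) : R := dens r z.1 * dens r z.2.

Lemma mol_ge0 z : 0 <= mol z.
Proof. by rewrite mulr_ge0 // dens_ge0. Qed.

Lemma smooth_mol : smooth mol.
Proof. by apply: smooth_tensor; exact: smooth1_dens. Qed.

Lemma mol_out z : ~ cbox (0, 0) (r, r) z -> mol z = 0.
Proof.
move=> hz; rewrite /mol; have [h|/dens_out ->] := pselect (0 <= z.1 <= r); last by rewrite mul0r.
rewrite [dens r z.2]dens_out ?mulr0 // => h2; apply: hz; exact/cboxP.
Qed.

Lemma test_mol : test_function setT mol.
Proof.
by apply: (@test_tensor R setT (0, 0) (r, r)) => //; [exact: smooth1_dens..|exact: dens_out|exact: dens_out].
Qed.

Lemma test_mol_reflect D x : cbox (x.1 - r, x.2 - r) x `<=` D ->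
  test_function D (fun y => mol (x - y)).
Proof.
move=> xD; have h : supp_fun (fun y => mol (x - y)) `<=` cbox (x.1 - r, x.2 - r) x.
  apply: supp_fun_sub.
    by apply: compact_closed; [exact: norm_hausdorff|exact: cbox_compact].
  move=> y hy; apply: mol_out => /cboxP /= [/andP[h1 h2] /andP[h3 h4]]; apply: hy.
  by apply/cboxP => /=; split; apply/andP; split; lra.
split; first exact: smooth_reflect smooth_mol.
- apply: subclosed_compact h; [exact: supp_fun_closed|exact: cbox_compact].
- exact: subset_trans xD.
Qed.

Lemma Rintegral_mol x : \int[mu2]_y mol (x - y) = 1.
Proof.
have tm : test_function setT (fun y => mol (x - y)) by exact: test_mol_reflect.
have [sm _ _] := tm; have [L L0 hL] := test_cbox tm.
rewrite (Rfubini12 (smooth_continuous sm) (hL [::])).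
rewrite -[RHS](Rintegral_dens x.1); apply: eq_Rintegral => s _; rewrite /mol /=.
rewrite RintegralZl //; first by rewrite Rintegral_dens mulr1.
apply: (@cc1_integrable R _ (x.2 - r) x.2); last first.
  by move=> t ht; apply: dens_out => /andP[h1 h2]; apply: ht; apply/andP; split; lra.
move=> t; apply: (@continuous_comp _ _ _ (fun t : R => x.2 - t) (dens r)).
  by apply: cvgB; [exact: cvg_cst|exact: cvg_id].
exact: smooth1_continuous (smooth1_dens r) _.
Qed.

End Dens.

(** Duality. With c_j the derivatives at [x] and w_j the weak derivatives, the sum S of the squares
    of the c_j is the integral of the kernel against the sum of the c_j w_j, whose absolute value is
    at most the root of Nc M^2 S almost everywhere. The kernel has mass one, so S^2 <= Nc M^2 S. The
    number of convolutions that overlap at [x] never enters. *)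
Lemma sum_sqr_conv (D : set (plane R)) (J : nat) (psi : 'I_J -> plane R -> R) (M : R) (Nc : nat) rho s x :
  open D -> 0 <= M ->
  (forall j, continuous (psi j)) -> (forall j, weakly_derivable D s (psi j)) ->
  (\forall y \ae mu2, D y -> forall j, `|weakD D s (psi j) y| <= M) ->
  (\forall y \ae mu2, D y -> (#|[pred j | weakD D s (psi j) y != 0%R]| <= Nc)%N) ->
  test_function setT rho -> test_function D (fun y => rho (x - y)) ->
  (forall z, 0 <= rho z) -> \int[mu2]_y rho (x - y) = 1 ->
  \sum_j (pderiv s (conv (psi j) rho) x) ^+ 2 <= Nc%:R * M ^+ 2.
Proof.
move=> oD M0 cp wp bM bN tr tD r0 r1.
pose w j := weakD D s (psi j).
pose c j := pderiv s (conv (psi j) rho) x.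
have cE j : c j = \int[mu2]_(y in D) (w j y * rho (x - y)) by exact: conv_weakD.
set S := (X in X <= _); have S0 : 0 <= S by apply: sumr_ge0 => j _; exact: sqr_ge0.
have mD : measurable (D : set T2) by exact: open_measurable2.
have iw j : mu2.-integrable D (EFin \o (fun y : T2 => w j y * rho (x - y))).
  by apply: loc_integrable_mul_test tD mD; have [] := weakDP (wp j).
have icw j := integrable_scale (c j) mD (iw j).
have SE : S = \int[mu2]_(y in D) (\sum_j c j * (w j y * rho (x - y))).
  rewrite Rintegral_sum //; apply: eq_bigr => j _.
  by rewrite RintegralZl // -cE expr2.
pose B := Num.sqrt (Nc%:R * M ^+ 2 * S).
have ir : mu2.-integrable D (EFin \o (fun y : T2 => rho (x - y))) by exact: test_integrable tD mD.
have SB : S <= B.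
  have -> : B = \int[mu2]_(y in D) (B * rho (x - y)).
    by rewrite RintegralZl // (Rintegral_test_sub tD) // r1 mulr1.
  rewrite SE; apply: le_Rintegral_ae => //; first exact: integrable_sum_R.
    exact: integrable_scale.
  have := ae2_and bM bN; apply: ae2_sub => y [h1 h2] Dy.
  rewrite (_ : \sum_j _ = (\sum_j c j * w j y) * rho (x - y)); last first.
    by rewrite mulr_suml; apply: eq_bigr => j _; rewrite mulrA.
  apply: ler_wpM2r => //; apply: le_trans (ler_norm _) _; rewrite -sqrtr_sqr ler_wsqrtr //.
  have cN : (#|[pred j | (c j * w j y != 0)%R]| <= Nc)%N.
    apply: leq_trans (h2 Dy); apply: subset_leq_card; apply/fintype.subsetP => j.
    by rewrite !inE mulf_eq0 negb_or => /andP[].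
  apply: le_trans (sum_sqr_le_card cN) _; rewrite -mulrA ler_wpM2l // /S mulr_sumr.
  apply: ler_sum => j _; rewrite exprMn mulrC ler_wpM2r ?sqr_ge0 //.
  by rewrite -[M ^+ 2]ger0_norm ?sqr_ge0 // -[w j y ^+ 2]ger0_norm ?sqr_ge0 // !normrX lerXn2r // ?nnegrE ?normr_ge0 // [`|M|]ger0_norm // h1.
have h : S ^+ 2 <= Nc%:R * M ^+ 2 * S.
  rewrite -[leRHS]sqr_sqrtr; last by rewrite !mulr_ge0 // sqr_ge0.
  by rewrite lerXn2r // nnegrE // sqrtr_ge0.
have [S00|Sn] := eqVneq S 0; first by rewrite S00 mulr_ge0 // sqr_ge0.
by move: h; rewrite expr2 ler_pM2r // lt_def Sn.
Qed.

Lemma conv_near (f : plane R -> R) (rho : plane R -> R) x (c : R) : continuous f ->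
  test_function setT rho -> (forall z, 0 <= rho z) -> \int[mu2]_y rho (x - y) = 1 ->
  (forall y, rho (x - y) != 0 -> `|f y - f x| <= c) -> `|conv f rho x - f x| <= c.
Proof.
move=> cf tr r0 r1 h.
have ir : mu2.-integrable setT (EFin \o (fun y : T2 => rho (x - y))).
  have c1 : continuous ((fun=> 1) : plane R -> R) by move=> y; exact: cvg_cst.
  have := @conv_integrable (fun=> 1) rho x c1 tr.
  by apply: eq_integrable => // y _; rewrite /= mul1r.
have ifr := conv_integrable x cf tr.
have iZ (a : R) := integrable_scale a measurableT ir.
have -> : conv f rho x - f x = \int[mu2]_y (f y * rho (x - y) - f x * rho (x - y)).
  by rewrite RintegralB // RintegralZl // r1 mulr1.
have iB := integrable_sub measurableT ifr (iZ (f x)).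
apply: le_trans (le_normr_Rintegral _ iB) _ => //.
rewrite -[c]mulr1 -r1 -RintegralZl //; apply: le_Rintegral => //.
  by have := integrable_abse iB; apply: eq_integrable.
move=> y _; rewrite -mulrBl normrM [`|rho _|]ger0_norm //.
by have [->|/h hc] := eqVneq (rho (x - y)) 0; rewrite ?mulr0 // ler_wpM2r.
Qed.

Lemma ae2_forall (I : finType) (P : I -> plane R -> Prop) :
  (forall i : I, \forall x \ae mu2, P i x) -> \forall x \ae mu2, forall i : I, P i x.
Proof.
move=> h.
have hb : \forall x \ae mu2, forall i : I, i \in enum I -> P i x.
  elim: (enum I) => [|i r IH]; first by apply: (@nearW T2 (almost_everywhere mu2)).
  apply: ae2_sub (ae2_and (h i) IH) => x [h1 h2] j; rewrite inE => /orP[/eqP -> //|]; exact: h2.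
by apply: ae2_sub hb => x hx i; apply: hx; rewrite mem_enum.
Qed.

Lemma Wsemi_weakD_le D k f (c : R) s : (Wsemi D k f <= c%:E)%E -> size s = k ->
  \forall x \ae mu2, D x -> `|weakD D s f x| <= c.
Proof.
move=> hc hs; have ss : size s == k by rewrite hs.
have : (ess_sup mu2 (fun x => `|patch (cst 0%R) D (weakD D (Tuple ss) f) x|%:E) <= c%:E)%E.
  by apply: le_trans hc; rewrite /Wsemi (bigD1 (Tuple ss)) //= le_max lexx.
move=> /ess_supP; apply: ae2_sub => x; rewrite lee_fin => h Dx; apply: le_trans h.
by rewrite /patch mem_set.
Qed.

Lemma ae_not_line i (a : R) : \forall x \ae mu2, coord i x != a.
Proof.
pose A : set T2 := if i == ord0 then [set a] `*` setT else setT `*` [set a].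
have mA : measurable A.
  by rewrite /A; case: (i == ord0); apply: measurableX => //; exact: measurable_set1.
have A0 : mu2 A = 0%E.
  rewrite /A; case: (i == ord0).
    have -> : mu2 ([set a] `*` setT : set T2) =
      (lebesgue_measure ([set a] : set (measurableTypeR R)) *
       lebesgue_measure (setT : set (measurableTypeR R)))%E.
      by apply: product_measure1E => //; exact: measurable_set1.
    by rewrite lebesgue_measure_set1 mul0e.
  have -> : mu2 (setT `*` [set a] : set T2) =
    (lebesgue_measure (setT : set (measurableTypeR R)) *
     lebesgue_measure ([set a] : set (measurableTypeR R)))%E.
    by apply: product_measure1E => //; exact: measurable_set1.
  by rewrite lebesgue_measure_set1 mule0.
exists A; split => // x /= /negP; rewrite negbK => /eqP; rewrite /A /coord.
by case: (i == ord0).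
Qed.

Lemma open_rect_open (a b : plane R) : open (open_rect a b).
Proof.
rewrite (_ : open_rect a b = (fst @^-1` `]a.1, b.1[) `&` (snd @^-1` `]a.2, b.2[)).
  by apply: openI; apply: open_comp; try exact: interval_open; move=> x _;
    [exact: cvg_fst|exact: cvg_snd].
by rewrite open_rectE.
Qed.

(** The boundary lies on the four lines through the sides, each of which is a null set. *)
Lemma ae_not_rect_boundary (a b : plane R) :
  \forall x \ae mu2, ~ boundary (open_rect a b) x.
Proof.
have h (i : 'I_2) (p : plane R) := ae_not_line i (coord i p).
have := ae2_and (ae2_and (h ord0 a) (h ord0 b)) (ae2_and (h (lift ord0 ord0) a) (h (lift ord0 ord0) b)).
apply: ae2_sub => -[x1 x2] [[/= /eqP h1 /eqP h2] [/eqP h3 /eqP h4]] [cx ix].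
have : cbox a b (x1, x2).
  have -> : cbox a b = closure (cbox a b).
    by apply/closure_id; apply: compact_closed; [exact: norm_hausdorff|exact: cbox_compact].
  exact: closure_subset (@open_rect_sub_cbox R a b) _ cx.
move=> /cboxP /= [/andP[l1 l2] /andP[l3 l4]]; apply: ix.
have -> : (open_rect a b)° = open_rect a b by apply/interior_id; exact: open_rect_open.
rewrite /open_rect /= !lt_def l1 l2 l3 l4 !andbT [b.1 == _]eq_sym [b.2 == _]eq_sym.
by move/eqP: h1 => ->; move/eqP: h2 => ->; move/eqP: h3 => ->; move/eqP: h4 => ->.
Qed.

Lemma derive2_mul (F G : plane R -> R) i l x : smooth F -> smooth G ->
  pderiv [:: l; i] (fun y => F y * G y) x =
  F x * pderiv [:: l; i] G x + pderiv [:: l] F x * pderiv [:: i] G x +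
  (pderiv [:: i] F x * pderiv [:: l] G x + pderiv [:: l; i] F x * G x).
Proof.
move=> sF sG; have sFi := smooth_derive i sF; have sGi := smooth_derive i sG.
rewrite /= [X in 'D_(e l) X x](_ : _ =
  fun y => F y * 'D_(e i) G y + 'D_(e i) F y * G y); last first.
  by apply/funext => y; rewrite derive_smoothM.
have := congr1 (fun H : plane R -> R => H x)
  (pderivD [:: l] (smoothM sF sGi) (smoothM sFi sG)).
by rewrite /= => ->; rewrite !derive_smoothM.
Qed.

Let sqr4 (a b c d : R) : (a + b + (c + d)) ^+ 2 <= 4 * (a ^+ 2 + b ^+ 2 + (c ^+ 2 + d ^+ 2)).
Proof.
have := sqr_ge0 (a - b); have := sqr_ge0 (c - d).
have := sqr_ge0 (a + b - (c + d)); rewrite !expr2; nra.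
Qed.

(** Over the four pairs (i, l) each first-order energy is counted four times in all, and so is the
    energy of order zero; 16 is this 4 times the 4 of [sqr4]. *)
Let words_aux (N : seq 'I_2 -> R) (b0 b1 b2 : R) : 0 <= b0 -> 0 <= b1 -> 0 <= b2 -> (forall s, 0 <= N s) ->
  \sum_i \sum_l 4 * (b0 * N [:: l; i] + b1 * N [:: i] + (b1 * N [:: l] + b2 * N [::])) <=
  16 * (b0 * (\sum_i \sum_l N [:: l; i]) + b1 * (\sum_i N [:: i]) + b2 * N [::]).
Proof.
move=> h0 h1 h2 N0.
have -> : \sum_i \sum_l 4 * (b0 * N [:: l; i] + b1 * N [:: i] + (b1 * N [:: l] + b2 * N [::])) =
  4 * (b0 * (\sum_i \sum_l N [:: l; i]) + 4 * (b1 * (\sum_i N [:: i])) + 4 * (b2 * N [::])).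
  under eq_bigr do rewrite -mulr_sumr !big_split /= -!mulr_sumr !sumr_const card_ord.
  rewrite -mulr_sumr !big_split /= -!mulr_sumr !sumr_const card_ord ?sumrMnl.
  move: (\sum_(i < 2) \sum_(l < 2) N [:: l; i]) (\sum_(i < 2) N [:: i]) (N [::]) => x y z.
  ring.
have p0 : 0 <= b0 * (\sum_i \sum_l N [:: l; i]) by rewrite mulr_ge0 // !sumr_ge0 // => i _; rewrite sumr_ge0.
have p1 : 0 <= b1 * (\sum_i N [:: i]) by rewrite mulr_ge0 // sumr_ge0.
have p2 : 0 <= b2 * N [::] by rewrite mulr_ge0.
move: p0 p1 p2; move: (b0 * _) (b1 * _) (b2 * _) => a b c ? ? ?; lra.
Qed.

(** The bounds on [Psi] are asked on the support of [phi] only, since mollified functions obey them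
    at some distance from the boundary of [D]. They are bounds for sums over [j], so no factor [J]
    appears. *)
Lemma Hsq_test_mul_sum D (J : nat) (Psi : 'I_J -> plane R -> R) (phi : plane R -> R) (B : nat -> R) :
  open D -> test_function D phi -> (forall j, smooth (Psi j)) -> (forall k, 0 <= B k) ->
  (forall x s, supp_fun phi x -> (size s <= 2)%N -> \sum_j pderiv s (Psi j) x ^+ 2 <= B (size s)) ->
  \sum_j Hsq D 2 (fun x => Psi j x * phi x) <=
  16 * (B 0%N * Hsq D 2 phi + B 1%N * Hsq D 1 phi + B 2%N * Hsq D 0 phi).
Proof.
move=> oD tp sP B0 hB; have [sp _ _] := tp.
have tP j := test_mul (sP j) tp.
pose N (s : seq 'I_2) := \int[mu2]_x (pderiv s phi x ^+ 2).
have iN (c : R) s : mu2.-integrable setT (EFin \o (fun x : T2 => c * pderiv s phi x ^+ 2)).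
  by apply: integrable_scale => //; exact: test_integrable (test_sqr s tp) measurableT.
have iP j s := test_integrable (test_sqr s (tP j)) measurableT.
have key i l : \sum_j energy D [:: i; l] (fun x => Psi j x * phi x) <=
    4 * (B 0%N * N [:: l; i] + B 1%N * N [:: i] + (B 1%N * N [:: l] + B 2%N * N [::])).
  under eq_bigr do rewrite (energy_test oD _ (tP _)).
  rewrite -Rintegral_sum //.
  have -> : 4 * (B 0%N * N [:: l; i] + B 1%N * N [:: i] + (B 1%N * N [:: l] + B 2%N * N [::])) =
    \int[mu2]_x (4 * (B 0%N * pderiv [:: l; i] phi x ^+ 2 + B 1%N * pderiv [:: i] phi x ^+ 2 +
     (B 1%N * pderiv [:: l] phi x ^+ 2 + B 2%N * pderiv [::] phi x ^+ 2))).
    have i1 := integrable_add measurableT (iN (B 0%N) [:: l; i]) (iN (B 1%N) [:: i]).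
    have i2 := integrable_add measurableT (iN (B 1%N) [:: l]) (iN (B 2%N) [::]).
    have i3 := integrable_add measurableT i1 i2.
    rewrite RintegralZl // RintegralD // RintegralD // RintegralD //.
    by rewrite !RintegralZl //; exact: test_integrable (test_sqr _ tp) measurableT.
  apply: le_Rintegral => //; first exact: integrable_sum_R.
    apply: integrable_scale => //; apply: integrable_add => //; exact: integrable_add.
  move=> x _; rewrite [rev _]/(rev [:: i; l]) /rev /=.
  have [xs|xs] := pselect (supp_fun phi x); last first.
    rewrite big1 => [|j _].
      by rewrite mulr_ge0 // !addr_ge0 // mulr_ge0 // sqr_ge0.
    have := derive2_mul i l x (sP j) sp; rewrite /= => ->.
    have z s : pderiv s phi x = 0.
      by apply: supp_fun0 => h; apply: xs; elim: s h => //= a s IH /supp_derive.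
    have := z [:: l; i]; have := z [:: i]; have := z [:: l]; have := z [::].
    by rewrite /= => -> -> -> ->; rewrite !mulr0 !addr0 expr0n.
  apply: (@le_trans _ _ (\sum_j 4 * ((Psi j x * pderiv [:: l; i] phi x) ^+ 2 +
     (pderiv [:: l] (Psi j) x * pderiv [:: i] phi x) ^+ 2 +
     ((pderiv [:: i] (Psi j) x * pderiv [:: l] phi x) ^+ 2 +
      (pderiv [:: l; i] (Psi j) x * phi x) ^+ 2)))).
    by apply: ler_sum => j _; have := derive2_mul i l x (sP j) sp; rewrite /= => ->; exact: sqr4.
  rewrite -mulr_sumr ler_wpM2l // !big_split /=.
  have c s (a : R) : (size s <= 2)%N ->
      \sum_j (pderiv s (Psi j) x * a) ^+ 2 <= B (size s) * a ^+ 2.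
    move=> hs; under eq_bigr do rewrite exprMn.
    by rewrite -mulr_suml ler_wpM2r ?sqr_ge0 // hB.
  by apply: lerD; apply: lerD; [exact: (c [::])|exact: (c [:: l])|exact: (c [:: i])|exact: (c [:: l; i])].
have E0 : Hsq D 0 phi = N [::] by rewrite Hsq0E energy_test.
have E1 : Hsq D 1 phi = \sum_i N [:: i].
  by rewrite Hsq1E; apply: eq_bigr => i _; rewrite energy_test.
have E2 : Hsq D 2 phi = \sum_i \sum_l N [:: l; i].
  by rewrite Hsq2E; apply: eq_bigr => i _; apply: eq_bigr => l _; rewrite energy_test.
under eq_bigr do rewrite Hsq2E.
rewrite exchange_big /=; under eq_bigr do rewrite exchange_big /=.
apply: (@le_trans _ _ (\sum_i \sum_l
  4 * (B 0%N * N [:: l; i] + B 1%N * N [:: i] + (B 1%N * N [:: l] + B 2%N * N [::])))).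
  by apply: ler_sum => i _; apply: ler_sum => l _; exact: key.
have N0 s : 0 <= N s by apply: Rintegral_ge0 => x _; exact: sqr_ge0.
by rewrite E0 E1 E2; apply: words_aux.
Qed.

(** If psi_j were non-zero at [p], it would be so in a neighbourhood, which would lie in the closure
    of the subdomain; but a subdomain is the interior of its closure. *)
Lemma psi_out D K Nc H delta (P : pum R) J sub psi : open D ->
  @overlapping_decomposition R D K Nc H delta P J sub psi ->
  forall j p, D p -> ~ sub j p -> psi j p = 0.
Proof.
move=> oD [hsub _ _ _ [_ _ psi0 hW]] j p Dp sp.
have [[_ _ _ _ [rsub _]] _] := hsub j.
have [[cpsi _] _] := hW j.
apply: contrapT => /eqP pn.
have U : \forall y \near p, psi j y != 0.
  have := cpsi p; move/(_ [set t | t != 0]); apply.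
  by apply: open_nbhs_nbhs; split => //; exact: open_neq.
apply: sp; rewrite -rsub; have DU := open_nbhs_nbhs (conj oD Dp).
rewrite /interior; near=> y; apply: contrapT => yc.
have : psi j y != 0 by near: y.
by rewrite psi0 ?eqxx //; near: y.
Unshelve. all: end_near.
Qed.

(** For the multiplicity: the weak derivative vanishes almost everywhere off the closure of the
    subdomain, and inside [D] the boundary of the subdomain lies on finitely many patch boundaries,
    a null set. The covering bound [Nc] thus holds at almost every point. *)
Lemma psi_weakD D K Nc H delta (P : pum R) J sub psi : open D ->
  @overlapping_decomposition R D K Nc H delta P J sub psi ->
  forall s, (size s <= 2)%N ->
  [/\ forall j, weakly_derivable D s (psi j),
    \forall y \ae mu2, D y -> forall j, `|weakD D s (psi j) y| <= K * delta ^- size s &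
    \forall y \ae mu2, D y -> (#|[pred j | (weakD D s (psi j) y != 0)%R]| <= Nc)%N].
Proof.
move=> oD hd s hs; have [hsub _ hN hal [_ _ psi0 hW]] := hd.
have wd j : weakly_derivable D s (psi j).
  have [[_ /(_ _ hs) [/(_ s erefl) [g hg] _]] _] := hW j.
  by exists g; apply: is_weak_deriv_sub hg => //; exact: openT.
split => //.
  have : \forall y \ae mu2, forall j, D y -> `|weakD D s (psi j) y| <= K * delta ^- size s.
    by apply: ae2_forall => j; have [_ /(_ _ hs) /Wsemi_weakD_le] := hW j; apply.
  by apply: ae2_sub => y h Dy j; exact: h.
have oU j : open (D `&` ~` closure (sub j)) by apply: openI => //; apply: closed_openC; exact: closed_closure.
have h1 : \forall y \ae mu2, forall j, (D `&` ~` closure (sub j)) y -> weakD D s (psi j) y = 0.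
  apply: ae2_forall => j; apply: (weakD_local oD (oU j)) => //.
  by move=> y [Dy cy]; exact: psi0.
have h2 : \forall y \ae mu2, forall i : 'I_(npatch P), ~ boundary (pum_patch i) y.
  by apply: ae2_forall => i; exact: ae_not_rect_boundary.
have := ae2_and h1 h2; apply: ae2_sub => y [{}h1 {}h2] Dy.
apply: leq_trans (hN y Dy); apply: subset_leq_card; apply/fintype.subsetP => j.
rewrite !inE => /eqP wn; apply/asboolP/asboolP; apply: contrapT => sy; apply: wn; apply: h1.
split=> // cy.
have osub : open (sub j) by have [[]] := hsub j.
have /interior_id io := osub.
have : boundary (sub j) y by split => //; rewrite io.
move=> /hal [[_]|[i _ /h2 //]]; apply.
by have /interior_id -> := oD.
Qed.

Lemma psi_conv_sum D K Nc H delta (P : pum R) J sub psi r x s : open D -> 0 <= K -> 0 < delta -> 0 < r ->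
  @overlapping_decomposition R D K Nc H delta P J sub psi -> (size s <= 2)%N ->
  cbox (x.1 - r, x.2 - r) x `<=` D ->
  \sum_j pderiv s (conv (psi j) (mol r)) x ^+ 2 <= Nc%:R * (K * delta ^- size s) ^+ 2.
Proof.
move=> oD K0 d0 r0 hd hs xD; have [w1 w2 w3] := psi_weakD oD hd hs.
have [_ _ _ _ [_ _ _ hW]] := hd.
apply: (@sum_sqr_conv D) => //.
- by rewrite mulr_ge0 // invr_ge0 exprn_ge0 // ltW.
- by move=> j; have [[]] := hW j.
- exact: test_mol.
- exact: test_mol_reflect.
- exact: mol_ge0.
- exact: Rintegral_mol.
Qed.

(** One radius serves all points of a compact set, here the support of the test function. *)
Lemma compact_shift_sub (A D : set (plane R)) : compact A -> open D -> A `<=` D ->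
  \forall r \near 0^'+, forall x, A x -> cbox (x.1 - r, x.2 - r) x `<=` D.
Proof.
move=> /compact_near_coveringP cA oD AD.
pose P (r : R) x := cbox (x.1 - r, x.2 - r) x `<=` D.
have := cA R (0^'+) P; apply => x /AD Dx.
have [eps eps0 hb] : exists2 eps : R, 0 < eps & forall y : plane R, `|x - y| < eps -> D y.
  have /nbhs_normP [eps eps0 hb] := open_nbhs_nbhs (conj oD Dx).
  by exists eps => // y hy; exact: hb.
have e2 : 0 < eps / 2 by rewrite divr_gt0.
have xe : \forall z \near (x : plane R), `|x - z| < eps / 2.
  by apply/nbhs_normP; exists (eps / 2).
near=> z r => y /cboxP /= [/andP[h1 h2] /andP[h3 h4]].
have zx : `|x - z| < eps / 2 by near: z; exact: xe.
have re : r < eps / 2 by near: r; exact: nbhs_right_lt.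
apply: hb; move: zx; rewrite !prod_normE /= !gt_max => /andP[].
rewrite !ltr_norml => /andP[? ?] /andP[? ?]; apply/andP; split; apply/andP; split; lra.
Unshelve. all: end_near.
Qed.

(** The radius of mollification depends on [phi], [pts] and [eps], but the last bound does not
    involve it. The list [pts] will hold all nodes. *)
Lemma mollified_partition D K Nc H delta (P : pum R) J sub psi (phi : plane R -> R)
    (pts : seq (plane R)) (eps : R) : open D -> 0 <= K -> 0 < delta ->
  @overlapping_decomposition R D K Nc H delta P J sub psi ->
  test_function D phi -> 0 < eps ->
  exists Psi : 'I_J -> plane R -> R,
  [/\ forall j, smooth (Psi j),
      forall j p, p \in pts -> `|Psi j p - psi j p| <= eps &
      \sum_j Hsq D 2 (fun x => Psi j x * phi x) <=
      16 * (Nc%:R * K ^+ 2) * (Hsq D 2 phi + delta ^- 2 * Hsq D 1 phi + delta ^- 4 * Hsq D 0 phi)].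
Proof.
move=> oD K0 d0 hd tp eps0; have [sp cp pD] := tp.
have [_ _ _ _ [_ _ _ hW]] := hd.
have cpsi j : continuous (psi j) by have [[]] := hW j.
have h1 := compact_shift_sub cp oD pD.
have h2 : \forall r \near 0^'+, forall j p, p \in pts ->
    forall y, cbox (p.1 - r, p.2 - r) p y -> `|psi j y - psi j p| <= eps.
  apply: filter_forall => j; elim: pts => [|p pts IH]; first exact: nearW.
  have /cvgrPdist_le /(_ _ eps0) /nbhs_normP [e1 e10 he] := cpsi j p.
  near=> r => q; rewrite inE => /orP[/eqP -> y /cboxP /= [/andP[a1 a2] /andP[a3 a4]]|hq y].
    rewrite distrC; apply: he => /=; rewrite prod_normE /= gt_max !ltr_norml.
    have : r < e1 by near: r; exact: nbhs_right_lt.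
    by move=> ?; apply/andP; split; apply/andP; split; lra.
  by move: q hq y; near: r.
have [r [r0 {}h1 {}h2]] : exists r : R, [/\ 0 < r,
   forall x, supp_fun phi x -> cbox (x.1 - r, x.2 - r) x `<=` D &
   forall j p, p \in pts -> forall y, cbox (p.1 - r, p.2 - r) p y -> `|psi j y - psi j p| <= eps].
  have := @filter_ex R (0^'+) _ _ (filterI (nbhs_right_gt (0 : R)) (filterI h1 h2)).
  by move=> [r [? [? ?]]]; exists r.
exists (fun j => conv (psi j) (mol r)); split.
- by move=> j; apply: smooth_conv => //; exact: test_mol.
- move=> j p hp; apply: conv_near => //; [exact: test_mol|exact: mol_ge0|exact: Rintegral_mol|].
  move=> y my; apply: h2 => //; apply: contrapT => hy; move/eqP: my; apply.
  apply: mol_out => // /cboxP /= [/andP[? ?] /andP[? ?]]; apply: hy.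
  by apply/cboxP => /=; split; apply/andP; split; lra.
pose B (k : nat) := Nc%:R * (K * delta ^- k) ^+ 2.
have := @Hsq_test_mul_sum D J (fun j => conv (psi j) (mol r)) phi B oD tp.
have B0 k : 0 <= B k by rewrite mulr_ge0 // sqr_ge0.
have sj j : smooth (conv (psi j) (mol r)) by apply: smooth_conv => //; exact: test_mol.
move=> /(_ sj B0) h; apply: le_trans (h _) _.
  by move=> x s /h1 xs hs; apply: psi_conv_sum hd hs xs.
rewrite /B expr0 invr1 mulr1 expr1 !exprMn -!exprVn -!exprM -[16 * _ * _]mulrA.
by rewrite ler_wpM2l // !mulrDr !mulrA.
Unshelve. all: end_near.
Qed.

End Mollify.

(** * Bilinear forms and Rayleigh quotients *)

Section Bilinear.
Variables (R : realType) (n : nat) (A : 'M[R]_n).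
Implicit Types u v w : 'rV[R]_n.

Definition bil u v : R := (u *m A *m v^T) 0 0.

Lemma bilDl u v w : bil (u + v) w = bil u w + bil v w.
Proof. by rewrite /bil !mulmxDl mxE. Qed.

Lemma bilZl c u w : bil (c *: u) w = c * bil u w.
Proof. by rewrite /bil -!scalemxAl mxE. Qed.

Lemma bilDr u v w : bil u (v + w) = bil u v + bil u w.
Proof. by rewrite /bil linearD mulmxDr mxE. Qed.

Lemma bilZr c u w : bil u (c *: w) = c * bil u w.
Proof. by rewrite /bil linearZ /= -scalemxAr mxE. Qed.

Lemma bil0l w : bil 0 w = 0.
Proof. by rewrite /bil !mul0mx mxE. Qed.

Lemma bil_suml (I : Type) (r : seq I) (F : I -> 'rV[R]_n) w :
  bil (\sum_(i <- r) F i) w = \sum_(i <- r) bil (F i) w.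
Proof. by rewrite /bil !mulmx_suml summxE. Qed.

Lemma bil_sumr (I : Type) (r : seq I) (F : I -> 'rV[R]_n) w :
  bil w (\sum_(i <- r) F i) = \sum_(i <- r) bil w (F i).
Proof. by rewrite /bil linear_sum mulmx_sumr summxE. Qed.

Lemma bilE u v : bil u v = \sum_i \sum_j u 0 i * A i j * v 0 j.
Proof.
rewrite /bil mxE exchange_big /=; apply: eq_bigr => j _.
by rewrite !mxE mulr_suml.
Qed.

Lemma bil_nondegenerate u : (forall w, bil u w = 0) -> u *m A = 0.
Proof.
move=> h; apply/rowP => j; rewrite [RHS]mxE.
by rewrite -[RHS](h (delta_mx 0 j)) /bil trmx_delta -colE [RHS]mxE.
Qed.

Lemma bil_continuous : continuous (fun v => bil v v).
Proof.
have c i : continuous (fun v : 'rV[R]_n => v 0 i) by exact: coord_continuous.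
rewrite (_ : (fun v => _) = fun v => \sum_i \sum_j v 0 i * A i j * v 0 j); last first.
  by apply/funext => w; exact: bilE.
apply: continuous_big => [|i _]; first exact: add_continuous.
apply: continuous_big => [|j _ v]; first exact: add_continuous.
have ci : continuous_at v (fun x : 'rV[R]_n => x 0 i * A i j).
  by apply: continuousM; [exact: c|exact: cst_continuous].
have cj : continuous_at v (fun x : 'rV[R]_n => x 0 i * A i j * x 0 j).
  exact: (@continuousM _ _ (fun x : 'rV[R]_n => x 0 i * A i j) (fun x => x 0 j) v ci (@c j v)).
exact: cj.
Qed.

End Bilinear.

Section RayleighQuotient.
Variables (R : realType) (n : nat).
Implicit Types (A B : 'M[R]_n) (u v w : 'rV[R]_n).

Lemma unit_sphere_compact : compact [set v : 'rV[R]_n | bil 1%:M v v = 1].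
Proof.
have c1 : compact [set v : 'rV[R]_n | forall i, `[(-1 : R), 1]%classic (v ord0 i)].
  exact: (@rV_compact R n (fun=> `[(-1 : R), 1]%classic) (fun=> @segment_compact R (-1) 1)).
have cl : closed [set v : 'rV[R]_n | bil 1%:M v v = 1].
  rewrite (_ : [set v | _] = (fun v => bil 1%:M v v) @^-1` [set 1]) //.
  by apply: closed_comp; [move=> v _; exact: bil_continuous|exact: closed_eq].
apply: subclosed_compact cl c1 _ => v /= hv i; rewrite in_itv /= -ler_norml.
have : v 0 i ^+ 2 <= 1.
  rewrite -hv /bil mulmx1 mxE (bigD1 i) //= mxE -expr2 lerDl.
  by apply: sumr_ge0 => j _; rewrite mxE -expr2 sqr_ge0.
by rewrite -real_normK ?num_real // expr_le1 // normr_ge0.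
Qed.

(* A minimizer of a Rayleigh quotient is an eigenvector because a positive
   semidefinite form vanishing at [v] has [v] in its kernel. *)
Lemma rayleigh_min A B : (0 < n)%N ->
  (forall v, v != 0 -> 0 < bil A v v) -> (forall u v, bil A u v = bil A v u) ->
  (forall u v, bil B u v = bil B v u) ->
  exists l v, [/\ v != 0, v *m B = l *: (v *m A) & forall u, l * bil A u u <= bil B u u].
Proof.
move=> n0 A0 sA sB; pose S := [set v : 'rV[R]_n | bil 1%:M v v = 1].
have q1 v : v != 0 -> 0 < bil 1%:M v v.
  move=> v0; have [i vi] : exists i, v 0 i != 0.
    apply: contrapT => h; move/eqP: v0; apply; apply/rowP => i; rewrite mxE.
    by apply: contrapT => /eqP hi; apply: h; exists i.
  rewrite /bil mulmx1 mxE (bigD1 i) //= mxE -expr2 ltr_wpDr //.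
    by apply: sumr_ge0 => j _; rewrite mxE -expr2 sqr_ge0.
  by rewrite exprn_even_gt0.
have Sn v : S v -> v != 0.
  by move=> Sv; apply/eqP => v0; move: Sv; rewrite /S /= v0 bil0l => /esym/eqP; rewrite oner_eq0.
pose f v := bil B v v / bil A v v.
have fZ (c : R) v : c != 0 -> f (c *: v) = f v.
  by move=> c0; rewrite /f !bilZl !bilZr !mulrA -!expr2 -mulf_div divff ?mul1r // sqrf_eq0.
have S0 : S !=set0.
  exists (delta_mx 0 (Ordinal n0)); rewrite /S /= /bil mulmx1 trmx_delta mul_delta_mx mxE.
  by rewrite !eqxx.
have cf : {within S, continuous f}.
  apply/continuous_in_subspaceT => v /set_mem Sv.
  have cA : continuous_at v (fun u : 'rV[R]_n => (bil A u u)^-1).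
    apply: (@continuousV _ _ (fun u : 'rV[R]_n => bil A u u) v _ (@bil_continuous _ _ A v)).
    by rewrite gt_eqF // A0 // Sn.
  exact: (@continuousM _ _ (fun u : 'rV[R]_n => bil B u u) _ v (@bil_continuous _ _ B v) cA).
have [v /set_mem Sv fv] := EVT_min_rV S0 unit_sphere_compact cf.
pose l := f v; have Av : 0 < bil A v v by rewrite A0 // Sn.
have lmin u : l * bil A u u <= bil B u u.
  have [->|u0] := eqVneq u 0; first by rewrite !bil0l mulr0.
  rewrite -ler_pdivlMr; last exact: A0.
  pose c := Num.sqrt (bil 1%:M u u); have c0 : c != 0 by rewrite gt_eqF // sqrtr_gt0 q1.
  rewrite -/(f u) -(fZ c^-1) ?invr_eq0 //; apply: fv; apply/mem_set.
  rewrite /S /= bilZl bilZr mulrA -expr2 exprVn sqr_sqrtr ?mulVf // ?gt_eqF ?q1 //.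
  by rewrite ltW // q1.
exists l, v; split => //; first exact: Sn.
pose C := B - l *: A.
have bC u w : bil C u w = bil B u w - l * bil A u w.
  by rewrite /bil /C mulmxBr -scalemxAr mulmxBl -scalemxAl !mxE.
have C0 u : 0 <= bil C u u by rewrite bC subr_ge0.
have Cv : bil C v v = 0 by rewrite bC /l /f divfK ?subrr // gt_eqF.
have sC u w : bil C u w = bil C w u by rewrite !bC sA sB.
have Cw w : bil C v w = 0.
  have h t : 0 <= t * 2 * bil C v w + bil C w w.
    have := C0 (t *: v + w); rewrite !bilDl !bilDr !bilZl !bilZr Cv [bil C w v]sC.
    by move: (bil C v w) (bil C w w) => p q; rewrite !mulr0 add0r addrA; congr (0 <= _); ring.
  apply: contrapT => /eqP b0.
  (* For this [t] the affine function of [t] takes the value -1. *)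
  have := h (- (bil C w w + 1) / (2 * bil C v w)).
  by rewrite -mulrA divfK ?mulf_neq0 // opprD addrAC addNr add0r leNgt ltrN10.
have := bil_nondegenerate Cw; rewrite /C mulmxBr -scalemxAr => /eqP.
by rewrite subr_eq0 => /eqP.
Qed.

End RayleighQuotient.

(** * Abstract additive Schwarz theory in coordinates *)

Section AdditiveSchwarz.
Variables (R : realType) (n : nat).
Implicit Types (A U : 'M[R]_n) (u v w : 'rV[R]_n).

(** Take a matrix of maximal rank whose row space lies in [S]: a vector of [S] outside that row
    space would raise the rank. *)
Lemma subspace_mx (S : 'rV[R]_n -> Prop) : S 0 ->
  (forall c u v, S u -> S v -> S (c *: u + v)) ->
  exists U : 'M[R]_n, forall v, S v <-> (v <= U)%MS.
Proof.
move=> S0 Sl.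
pose Q (r : nat) := `[< exists U : 'M[R]_n, (forall v, (v <= U)%MS -> S v) /\ \rank U = r >].
have Q0 : exists r, Q r.
  exists 0%N; apply/asboolP; exists 0; split; last exact: mxrank0.
  by move=> v; rewrite submx0 => /eqP ->.
have Qn r : Q r -> (r <= n)%N by move=> /asboolP [U [_ <-]]; exact: rank_leq_col.
case: (ex_maxnP Q0 Qn) => r /asboolP [U [US Ur]] rmax.
exists U => v; split=> [Sv|]; last exact: US.
have QW : Q (\rank (U + v)%MS).
  apply/asboolP; exists (U + v)%MS; split=> // w /sub_addsmxP [[a b] -> /=].
  rewrite addrC [b]mx11_scalar mul_scalar_mx; apply: Sl => //.
  by apply: US; exact: submxMl.
have := mxrank_leqif_sup (addsmxSl U v); rewrite /Order.leif Ur.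
move=> [h1 h2]; have := rmax _ QW => h3.
have : (U + v <= U)%MS by rewrite -h2 eqn_leq h1 h3.
by apply: submx_trans; exact: addsmxSr.
Qed.

Lemma orthogonal_projection (A U : 'M[R]_n) : (forall v, v != 0 -> 0 < bil A v v) ->
  exists P : 'M[R]_n, forall v, (v *m P <= U)%MS /\
    forall z : 'rV[R]_n, (z <= U)%MS -> bil A (v *m P) z = bil A v z.
Proof.
move=> A0.
have [B [Bf BU]] : exists B : 'M[R]_(\rank U, n),
    row_free B /\ forall w, (w <= B)%MS = (w <= U)%MS.
  by exists (row_base U); split; [exact: row_base_free|move=> w; rewrite eq_row_base].
pose G := B *m A *m B^T.
have Gu : G \in unitmx.
  rewrite -row_free_unit; apply: inj_row_free => x xG.
  have h : bil A (x *m B) (x *m B) = 0.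
    rewrite /bil trmx_mul (_ : _ *m (B^T *m x^T) = x *m G *m x^T); last by rewrite /G !mulmxA.
    by rewrite xG mul0mx mxE.
  have xB : x *m B = 0 by apply/eqP; apply: contraT => /A0; rewrite h ltxx.
  by move/(row_free_inj Bf): (etrans xB (esym (mul0mx _ B))).
(* The usual formula, with Gram matrix [G], for the projection onto the row space of [B] that is
   orthogonal for [A]; vectors are rows and matrices act from the right. *)
exists (A *m B^T *m invmx G *m B) => v; split.
  by rewrite mulmxA -BU; exact: submxMl.
move=> z zU; have /submxP [y ->] : (z <= B)%MS by rewrite BU.
rewrite /bil trmx_mul.
rewrite (_ : _ *m _ *m (B^T *m y^T) = v *m A *m B^T *m (invmx G *m G) *m y^T); last by rewrite /G !mulmxA.
by rewrite mulVmx // mulmx1 mulmxA.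
Qed.

(** The sum T of the projections is self-adjoint for [A]. The decomposition gives a(v,v) <= C0
    a(Tv,v), and the hypothesis on sums, applied to the components P_i v of Tv, gives a(Tv,Tv) <= M
    a(Tv,v); every eigenvalue then lies between 1/C0 and M. *)
Lemma additive_schwarz_spectrum (A : 'M[R]_n) (I : finType) (U : I -> 'M[R]_n) (C0 M : R) : (0 < n)%N ->
  (forall v, v != 0 -> 0 < bil A v v) -> (forall u v, bil A u v = bil A v u) ->
  0 < C0 ->
  (forall v, exists w : I -> 'rV[R]_n, [/\ forall i, (w i <= U i)%MS, v = \sum_i w i &
     \sum_i bil A (w i) (w i) <= C0 * bil A v v]) ->
  (forall w : I -> 'rV[R]_n, (forall i, (w i <= U i)%MS) ->
     bil A (\sum_i w i) (\sum_i w i) <= M * \sum_i bil A (w i) (w i)) ->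
  exists P : I -> 'M[R]_n,
    (forall i v, (v *m P i <= U i)%MS /\
      forall z : 'rV[R]_n, (z <= U i)%MS -> bil A (v *m P i) z = bil A v z) /\
    exists lmax lmin : R,
    [/\ exists2 v : 'rV[R]_n, v != 0 & \sum_i v *m P i = lmax *: v,
        exists2 v : 'rV[R]_n, v != 0 & \sum_i v *m P i = lmin *: v,
        forall l (v : 'rV[R]_n), v != 0 -> \sum_i v *m P i = l *: v -> lmin <= l <= lmax,
        1 <= C0 * lmin & lmax <= M].
Proof.
move=> n0 A0 sA C00 hdec hup.
have [P hP] : exists P : I -> 'M[R]_n, forall i v, (v *m P i <= U i)%MS /\
    forall z : 'rV[R]_n, (z <= U i)%MS -> bil A (v *m P i) z = bil A v z.
  by have [P hP] := choice (fun i => orthogonal_projection (U i) A0); exists P.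
exists P; split => //.
have A00 v : 0 <= bil A v v by have [->|/A0/ltW //] := eqVneq v 0; rewrite bil0l.
pose T := \sum_i P i.
have TE v : v *m T = \sum_i v *m P i by rewrite mulmx_sumr.
have PP i u v : bil A (u *m P i) v = bil A (u *m P i) (v *m P i).
  by rewrite sA -(proj2 (hP i v) _ (proj1 (hP i u))) sA.
have sT u v : bil A (u *m T) v = bil A (v *m T) u.
  rewrite !TE !bil_suml; apply: eq_bigr => i _; by rewrite PP sA -PP.
have lT v : bil A v v <= C0 * bil A (v *m T) v.
  have [->|v0] := eqVneq v 0; first by rewrite mul0mx !bil0l mulr0.
  have [w [wU vw hw]] := hdec v.
  (* Young's inequality for P_i v and w_i, with weight [C0] chosen so that the sum over [i] leaves
     C0 a(v,v) <= C0^2 a(Tv,v). *)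
  have h i : 2 * C0 * bil A v (w i) <= C0 ^+ 2 * bil A (v *m P i) v + bil A (w i) (w i).
    have := A00 (C0 *: (v *m P i) + (- 1) *: w i).
    have pw : bil A (v *m P i) (w i) = bil A v (w i) by apply: (proj2 (hP i v)).
    rewrite !bilDl !bilDr !bilZl !bilZr [bil A (w i) (v *m _)]sA pw -PP.
    move: (bil A _ _) (bil A _ _) (bil A _ _) => x y z; nra.
  have : \sum_i (2 * C0 * bil A v (w i)) <= \sum_i (C0 ^+ 2 * bil A (v *m P i) v + bil A (w i) (w i)).
    by apply: ler_sum => i _; exact: h.
  rewrite -mulr_sumr -bil_sumr -vw big_split /= -mulr_sumr -bil_suml -TE => h1.
  rewrite -(ler_pM2l C00); move: h1 hw.
  by move: (bil A _ _) (bil A _ _) (\sum_i _) => x y z h1 hw; nra.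
have uT v : bil A (v *m T) (v *m T) <= M * bil A (v *m T) v.
  rewrite TE; apply: le_trans (hup _ (fun i => proj1 (hP i v))) _.
  by rewrite bil_suml; under [X in _ <= _ * X]eq_bigr do rewrite PP.
have eig l v : v != 0 -> v *m T = l *: v -> 1 <= C0 * l /\ l <= M.
  move=> v0 vl; have Av := A0 v v0; have := lT v; have := uT v.
  rewrite vl !bilZl bilZr mulrA => h1 h2.
  have l1 : 1 <= C0 * l by rewrite -(ler_pM2r Av) mul1r -mulrA.
  split=> //; have l0 : 0 < l.
    by rewrite -(pmulr_rgt0 _ C00); apply: lt_le_trans l1.
  by move: h1; rewrite mulrA !ler_pM2r.
have symB u v : bil (T *m A) u v = bil A (u *m T) v by rewrite /bil !mulmxA.
have Ainj u v : u *m A = v *m A -> u = v.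
  move=> h; apply/eqP; rewrite -subr_eq0; apply: contraT => /A0.
  by rewrite /bil mulmxBl h subrr mul0mx mxE ltxx.
have [lmin [vmin [vmin0 emin hmin]]] := rayleigh_min n0 A0 sA (B := T *m A)
  (fun u v => etrans (symB u v) (etrans (sT u v) (esym (symB v u)))).
have symN u v : bil (- (T *m A)) u v = - bil A (u *m T) v.
  by rewrite -symB /bil mulmxN mulNmx mxE.
(* The largest eigenvalue is minus the smallest one of the opposite form. *)
have [lmax [vmax [vmax0 emax hmax]]] := rayleigh_min n0 A0 sA (B := - (T *m A))
  (fun u v => etrans (symN u v) (etrans (congr1 -%R (sT u v)) (esym (symN v u)))).
have {}emin : vmin *m T = lmin *: vmin by apply: Ainj; rewrite -mulmxA emin scalemxAl.
have {}emax : vmax *m T = (- lmax) *: vmax.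
  by apply: Ainj; rewrite -mulmxA -[LHS]opprK -mulmxN emax scaleNr mulNmx scalemxAl.
exists (- lmax), lmin; split.
- by exists vmax => //; rewrite -TE.
- by exists vmin => //; rewrite -TE.
- move=> l v v0; rewrite -TE => vl; have Av := A0 v v0.
  have := hmin v; rewrite symB vl bilZl ler_pM2r // => ->.
  by have := hmax v; rewrite symN vl bilZl -mulNr ler_pM2r // lerNr.
- exact: (proj1 (eig _ _ vmin0 emin)).
- exact: (proj2 (eig _ _ vmax0 emax)).
Qed.

End AdditiveSchwarz.

Opaque energy.

(** * Nodal interpolation in the discrete space *)

Section GeneralizedFiniteElements.
Variables (R : realType) (D : set (plane R)) (K h : R) (P : pum R).
Hypothesis oD : open D.
Hypothesis hP : is_pum D K h P.
Implicit Types (v w c f : plane R -> R) (p x : plane R) (i j : 'I_(npatch P)).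

Let gfe := gfe_space D P.

Lemma gfe_H20 v : gfe v -> H20 D v.
Proof. by case: hP => _ _ _ _ [_]; exact. Qed.

(** A node lies in a flat region: there one function of the partition is 1, and the others,
    nonnegative with total 1, must vanish. Hence the nodal values of a discrete function are those
    of its local polynomials. *)
Lemma pu_node i j p : p \in locnodes i -> pu j p = (j == i)%:R.
Proof.
case: hP => _ _ hpu hsum [hloc _] pi.
have [_ _ _ /(_ _ pi) [[_ pi1] Dp] _] := hloc i.
have [->//|ji] := eqVneq j i.
have := hsum p Dp; rewrite (bigD1 i) //= pi1 => /eqP.
rewrite -subr_eq0 addrAC subrr add0r psumr_eq0 => [/allP /(_ j)|k _]; last by case: (hpu k).
by rewrite mem_index_enum => /(_ isT); rewrite ji => /eqP.
Qed.

Lemma node_in i p : p \in locnodes i -> D p.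
Proof. by case: hP => _ _ _ _ [hloc _] pi; have [_ _ _ /(_ _ pi) []] := hloc i. Qed.

Lemma nodes_sub p : nodes P p -> D p.
Proof. by move=> [i /node_in]. Qed.

Definition blend (q : 'I_(npatch P) -> plane R -> R) : plane R -> R :=
  patch (cst 0) D (fun x => \sum_i pu i x * q i x).

Lemma blend_node q i p : p \in locnodes i -> blend q p = q i p.
Proof.
move=> pi; rewrite /blend /patch mem_set; last exact: node_in pi.
rewrite (bigD1 i) //= (pu_node _ pi) eqxx mul1r big1 ?addr0 // => j ji.
by rewrite (pu_node _ pi) (negbTE ji) mul0r.
Qed.

Lemma gfe_lin (a : R) v w : gfe v -> gfe w -> gfe (fun x => a * v x + w x).
Proof.
case: hP => _ _ _ _ [hloc _] [q hq ->] [q' hq' ->].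
exists (fun i => a *: q i + q' i) => [i|]; first by have [[_ hl] _ _ _ _] := hloc i; exact: hl.
apply/funext => x; rewrite /patch; case: ifP => _; last by rewrite mulr0 addr0.
by rewrite mulr_sumr -big_split /=; apply: eq_bigr => i _; rewrite !fctE mulrDr mulrCA.
Qed.

Lemma gfe0 : gfe (fun=> 0).
Proof.
case: hP => _ _ _ _ [hloc _]; exists (fun=> 0) => [i|]; first by have [[h0 _] _ _ _ _] := hloc i.
by apply/funext => x; rewrite /patch; case: ifP => // _; rewrite big1 // => i _; rewrite mulr0.
Qed.

Lemma gfe_sum (I : Type) (r : seq I) (F : I -> plane R -> R) :
  (forall k : I, gfe (F k)) -> gfe (fun x => \sum_(i <- r) F i x).
Proof.
move=> hF; elim: r => [|i r IH].
  by rewrite (_ : (fun _ => _) = fun=> 0); [exact: gfe0|apply/funext => x; rewrite big_nil].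
rewrite (_ : (fun _ => _) = fun x => 1 * F i x + \sum_(j <- r) F j x); first exact: gfe_lin.
by apply/funext => x; rewrite big_cons mul1r.
Qed.

Lemma gfe_eq v w : gfe v -> gfe w -> (forall p, nodes P p -> v p = w p) -> v = w.
Proof.
case: hP => _ _ _ _ [hloc _] [q hq ->] [q' hq' ->] e; congr patch.
apply/funext => x; apply: eq_bigr => i _; congr (_ * _).
have [_ _ _ _ [_ /(_ (q i)) [r [_ hr]]]] := hloc i.
rewrite -(hr (q i)) // -(hr (q' i)) //; split=> // p pi.
rewrite -(blend_node q pi) -(blend_node q' pi); apply/esym/e.
by exists i.
Qed.

Lemma loc_interpP i c : locspace i (loc_interp i c) /\ {in locnodes i, loc_interp i c =1 c}.
Proof.
case: hP => _ _ _ _ [hloc _]; have [_ _ _ _ [_ /(_ c) [r [hr _]]]] := hloc i.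
exact: (@xgetPex _ (cst 0) [set q | locspace i q /\ {in locnodes i, q =1 c}] (ex_intro _ r hr)).
Qed.

Lemma interpE c : interp D P c = blend (fun i => loc_interp i c).
Proof.
by congr patch; apply/funext => x; apply: eq_bigr => i _; rewrite mulrC.
Qed.

Lemma interp_gfe c : gfe (interp D P c).
Proof. by rewrite interpE; exists (fun i => loc_interp i c) => // i; case: (loc_interpP i c). Qed.

Lemma interp_node c p : nodes P p -> interp D P c p = c p.
Proof.
by move=> [i pi]; rewrite interpE (blend_node _ pi); have [_ ->] := loc_interpP i c.
Qed.

(** Both sides lie in V_h with the same nodal values. Since interpolation reads nodal values only,
    [c] and [f] are arbitrary functions. *)
Lemma interp_lin (a : R) c f :
  interp D P (fun x => a * c x + f x) = fun x => a * interp D P c x + interp D P f x.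
Proof.
apply: gfe_eq; [exact: interp_gfe|exact: gfe_lin (interp_gfe c) (interp_gfe f)|].
by move=> p hp; rewrite !interp_node.
Qed.

(** This replaces the choice operator in [truncation] by the interpolation of cut-off nodal values,
    from which linearity follows. *)
Lemma truncationE (N : set (plane R)) v :
  truncation D P N v = interp D P (patch (cst 0) N v).
Proof.
rewrite /truncation; set S := [set w | _].
have hS : S (interp D P (patch (cst 0) N v)).
  split=> [|p hp]; first exact: interp_gfe.
  by rewrite interp_node // /patch; split=> Np; [rewrite mem_set|rewrite memNset].
have [gw hw] : S (xget (cst 0) S) by apply: xgetPex; exists (interp D P (patch (cst 0) N v)).
have [gi hi] := hS; apply: gfe_eq => // p hp; have [w1 w2] := hw p hp; have [i1 i2] := hi p hp.
by have [Np|Np] := pselect (N p); [rewrite w1 ?i1|rewrite w2 ?i2].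
Qed.

Definition node_seq : seq (plane R) := undup (flatten [seq locnodes i | i : 'I_(npatch P)]).

Lemma node_seqP p : reflect (nodes P p) (p \in node_seq).
Proof.
rewrite mem_undup; apply: (iffP flattenP) => [[s /mapP [i _ ->] ps]|[i pi]]; first by exists i.
by exists (locnodes i) => //; apply: map_f; rewrite mem_enum.
Qed.

Lemma fsbig_nodes (F : plane R -> R) : \sum_(p \in nodes P) F p = \sum_(p <- node_seq) F p.
Proof.
have -> : nodes P = [set` node_seq].
  by apply/seteqP; split => p /=; [move/node_seqP|move=> /node_seqP].
by rewrite -fsbig_seq ?undup_uniq.
Qed.

End GeneralizedFiniteElements.

(** * Estimates in terms of nodal values *)

Section Estimates.
Variables (R : realType) (D : set (plane R)) (K h : R) (P : pum R).
Hypothesis oD : open D.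
Hypothesis h0 : 0 < h.
Hypothesis K0 : 0 < K.
Hypothesis hP : is_pum D K h P.
Hypothesis hE : pum_estimates D K h P.
Implicit Types (v w c f g : plane R -> R) (p x : plane R).

(** The discrete L_2 norm, squared. It accepts any function, in particular products such as psi_j v
    that need not lie in V_h. *)
Definition nodal_sq c : R := h ^+ 2 * \sum_(p <- node_seq P) c p ^+ 2.

Lemma nodal_sq_ge0 c : 0 <= nodal_sq c.
Proof. by rewrite mulr_ge0 ?sqr_ge0 // sumr_ge0 // => p _; exact: sqr_ge0. Qed.

Lemma nodal_sq_le c f : (forall p, nodes P p -> c p ^+ 2 <= f p ^+ 2) -> nodal_sq c <= nodal_sq f.
Proof.
move=> hc; rewrite ler_wpM2l ?sqr_ge0 // big_seq [leRHS]big_seq.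
by apply: ler_sum => p /node_seqP /hc.
Qed.

Lemma Hsq0_L2norm v : H20 D v -> Hsq D 0 v = L2norm D v ^+ 2.
Proof.
move=> Hv; have hv := H20_Hspace Hv.
rewrite Hsq0E energy_sqr /L2norm sqr_sqrtr; last by apply: Rintegral_ge0 => x _; exact: sqr_ge0.
have mD := open_measurable2 oD.
have w0 := weakD_ae oD (is_weak_deriv_nil (H20_loc_integrable Hv)).
have mw := @Hspace_measurable R D oD 2 v [::] hv isT.
have mv := loc_integrable_measurable oD (H20_loc_integrable Hv).
apply: ae_eq_Rintegral => //; [exact: measurable_funX|exact: measurable_funX|].
by apply: ae2_sub w0 => x e Dx; rewrite e.
Qed.

Let le_sqrr (a b k : R) : 0 <= a -> 0 <= b -> a <= k * b -> a ^+ 2 <= k ^+ 2 * b ^+ 2.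
Proof. by move=> a0 b0 ab; rewrite -exprMn lerXn2r // nnegrE // (le_trans a0). Qed.

Lemma gfe_Hsq0_le v : gfe_space D P v -> Hsq D 0 v <= K * nodal_sq v.
Proof.
move=> gv; rewrite Hsq0_L2norm; last exact: gfe_H20 hP _ gv.
by case: hE => _ /(_ _ gv) [+ _] _; rewrite (fsbig_nodes P).
Qed.

Lemma gfe_nodal_sq_le v : gfe_space D P v -> nodal_sq v <= K * Hsq D 0 v.
Proof.
move=> gv; rewrite Hsq0_L2norm; last exact: gfe_H20 hP _ gv.
by case: hE => _ /(_ _ gv) [_ +] _; rewrite (fsbig_nodes P).
Qed.

(** The squared inverse estimate contributes K^2, the passage to the discrete norm one more K. *)
Lemma gfe_inverse v m : gfe_space D P v -> (1 <= m <= 2)%N ->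
  Hsq D m v <= K ^+ 3 * h ^- (2 * m) * nodal_sq v.
Proof.
move=> gv hm; case: hE => _ _ /(_ _ gv m hm) hi.
have Hv := gfe_H20 hP gv.
have : Hsq D m v <= (K * h ^- m) ^+ 2 * Hsq D 0 v.
  by rewrite -Hsemi_sqr Hsq0_L2norm // le_sqrr // sqrtr_ge0.
move=> /le_trans; apply; apply: le_trans (ler_wpM2l (sqr_ge0 _) (gfe_Hsq0_le gv)) _.
rewrite exprMn -exprVn -exprM -exprVn mulnC; move: (nodal_sq v) (h^-1 ^+ _) => a b.
by rewrite le_eqVlt; apply/orP; left; apply/eqP; ring.
Qed.

Lemma interp_Hsq2 f : H20 D f -> Hsq D 2 (interp D P f) <= K ^+ 2 * Hsq D 2 f.
Proof.
move=> Hf; case: hE => /(_ _ Hf) + _ _; set s := \sum_(m < 2) _ => hs.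
have s0 : 0 <= s by apply: sumr_ge0 => m _; rewrite mulr_ge0 ?sqrtr_ge0 // exprn_ge0 // ltW.
rewrite -!Hsemi_sqr; apply: le_sqrr; rewrite ?sqrtr_ge0 //.
have h2 : 0 < h ^+ 2 by rewrite exprn_gt0.
rewrite -(ler_pM2l h2) mulrA [h ^+ 2 * K]mulrC; apply: le_trans hs.
by rewrite lerDr.
Qed.

Lemma interp_Hsq0 f : H20 D f ->
  Hsq D 0 (fun x => f x - interp D P f x) <= K ^+ 2 * h ^+ 4 * Hsq D 2 f.
Proof.
move=> Hf; case: hE => /(_ _ Hf) + _ _; rewrite !big_ord_recl big_ord0 /= => hs.
rewrite -!Hsemi_sqr (_ : K ^+ 2 * h ^+ 4 = (K * h ^+ 2) ^+ 2); last by rewrite exprMn -exprM.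
apply: le_sqrr; rewrite ?sqrtr_ge0 //; apply: le_trans hs; rewrite expr0 mul1r -addrA lerDl.
by rewrite addr0 addr_ge0 // mulr_ge0 ?sqrtr_ge0 // ?exprn_ge0 // ltW.
Qed.

(** [f] and its interpolant share nodal values, and for the interpolant the discrete norm is
    equivalent to the L_2 norm; the interpolation error pays for the difference. *)
Lemma H20_nodal_sq f : H20 D f ->
  nodal_sq f <= 2 * K * (Hsq D 0 f + K ^+ 2 * h ^+ 4 * Hsq D 2 f).
Proof.
move=> Hf; have gi := interp_gfe hP f.
apply: (@le_trans _ _ (nodal_sq (interp D P f))).
  by apply: nodal_sq_le => p hp; rewrite (interp_node hP).
apply: le_trans (gfe_nodal_sq_le gi) _.
have Hi := gfe_H20 hP gi.
have := @Hsq_sub R D oD 2 0 f (fun x => f x - interp D P f x) (H20_Hspace Hf)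
  (H20_Hspace (H20_sub oD Hf Hi)) isT.
rewrite (_ : (fun x => f x - (f x - interp D P f x)) = interp D P f); last first.
  by apply/funext => x; rewrite opprB addrC subrK.
have := interp_Hsq0 Hf.
move: (Hsq _ _ _) (Hsq _ _ _) (Hsq _ _ _) (Hsq _ _ _) => a b c d h1 h2.
rewrite -mulrA mulrCA ler_pM2l //; lra.
Qed.

End Estimates.

(** * Distance between nodes *)

Section NodeSeparation.
Variables (R : realType) (D : set (plane R)) (K h : R) (P : pum R).
Hypothesis oD : open D.
Hypothesis h0 : 0 < h.
Hypothesis K0 : 0 < K.
Hypothesis hP : is_pum D K h P.
Hypothesis hE : pum_estimates D K h P.
Implicit Types (v w c f g : plane R -> R) (p q x : plane R).

Let sep_aux (a1 a2 k : R) : a1 <= 4 * K ^+ 3 -> a2 <= 4 * K ^+ 3 * h ^- 2 -> 0 < k ->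
  2 * k * (h^-1 * a1 + h * a2) <= 16 * K ^+ 3 * (k / h).
Proof.
move=> h1 h2 k0.
have e1 : h^-1 * a1 <= h^-1 * (4 * K ^+ 3) by rewrite ler_pM2l // invr_gt0.
have e2 : h * a2 <= h^-1 * (4 * K ^+ 3).
  apply: le_trans (ler_wpM2l (ltW h0) h2) _.
  by rewrite le_eqVlt; apply/orP; left; apply/eqP; field; rewrite gt_eqF.
apply: (@le_trans _ _ (2 * k * (h^-1 * (4 * K ^+ 3) + h^-1 * (4 * K ^+ 3)))).
  by rewrite ler_wpM2l ?mulr_ge0 ?(ltW k0) // lerD.
by rewrite le_eqVlt; apply/orP; left; apply/eqP; field; rewrite gt_eqF.
Qed.

Let sep_aux2 (t d H : R) : t * (32 * K * d) <= H -> 2 * K * (t * d) <= H * 4^-1 ^+ 2.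
Proof.
move=> tH; have -> : 2 * K * (t * d) = t * (32 * K * d) / 16 by field.
have -> : H * 4^-1 ^+ 2 = H / 16 by field.
by rewrite ler_pM2r.
Qed.

Let sep_aux3 (l t a fp fq : R) : `|0 - fq| <= 4^-1 -> `|1 - fp| <= 4^-1 -> a <= 4^-1 ->
  `|fp - fq| <= a + l / t -> 0 < t -> 4^-1 * t <= l.
Proof.
rewrite !ler_norml => /andP[h1 h2] /andP[h3 h4] h5 /andP[h6 h7] t0.
by rewrite -ler_pdivlMr //; lra.
Qed.

(* A nodal basis function jumps by 1 between two nodes while its seminorms are
   controlled by the inverse estimates, so the Hoelder bound separates nodes. *)
Lemma node_separation p q : nodes P p -> nodes P q -> p != q ->
  h / (256 * K ^+ 3) <= `|p.1 - q.1| + `|p.2 - q.2|.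
Proof.
move=> np nq pq.
pose z := interp D P (fun x => (x == p)%:R).
have gz : gfe_space D P z by exact: interp_gfe hP _.
have zp : z p = 1 by rewrite /z (interp_node hP) // eqxx.
have zq : z q = 0 by rewrite /z (interp_node hP) // eq_sym (negbTE pq).
have nz : nodal_sq h P z <= h ^+ 2.
  rewrite /nodal_sq ler_piMr ?sqr_ge0 //.
  have ps : p \in node_seq P by apply/node_seqP.
  rewrite (bigD1_seq p) ?undup_uniq //= zp expr1n big_seq_cond big1 ?addr0 // => r /andP[/node_seqP nr rp].
  by rewrite /z (interp_node hP) // (negbTE rp) expr0n.
have K3 : 0 < K ^+ 3 by rewrite exprn_gt0.
have h2 : 0 < h ^+ 2 by rewrite exprn_gt0.
have e1 : Hsq D 1 z <= K ^+ 3.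
  have := gfe_inverse oD hP hE gz (isT : (1 <= 1 <= 2)%N); move/le_trans; apply.
  apply: le_trans (ler_wpM2l _ nz) _; first by rewrite mulr_ge0 ?(ltW K3) // invr_ge0 exprn_ge0 // ltW.
  by rewrite muln1 mulfVK // gt_eqF.
have e2 : Hsq D 2 z <= K ^+ 3 * h ^- 2.
  have := gfe_inverse oD hP hE gz (isT : (1 <= 2 <= 2)%N); move/le_trans; apply.
  apply: le_trans (ler_wpM2l _ nz) _; first by rewrite mulr_ge0 ?(ltW K3) // invr_ge0 exprn_ge0 // ltW.
  by rewrite le_eqVlt; apply/orP; left; apply/eqP; field; rewrite gt_eqF.
have Hz := gfe_H20 hP gz.
(* The first two terms keep the squared seminorms of [phi] within a factor 4 of the bounds for [z];
   the third forces [z] and [phi] to differ by at most 1/4 at the nodes. *)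
pose eta := Num.min (Num.min (K ^+ 3) (K ^+ 3 * h ^- 2)) (h ^+ 2 / (32 * K * (1 + K ^+ 2 * h ^+ 4))).
have den : 0 < 1 + K ^+ 2 * h ^+ 4 by rewrite ltr_pwDl // mulr_ge0 // exprn_ge0 // ltW.
have eta0 : 0 < eta.
  by rewrite !lt_min K3 mulr_gt0 ?invr_gt0 //= divr_gt0 // !mulr_gt0.
have [phi tp hphi] := H20_approx Hz eta0.
have Hp := test_H20 oD tp.
have Hg := H20_sub oD Hz Hp.
have eK : eta <= K ^+ 3 by rewrite !ge_min lexx.
have eK2 : eta <= K ^+ 3 * h ^- 2 by rewrite !ge_min lexx orbT.
have eK3 : eta * (32 * K * (1 + K ^+ 2 * h ^+ 4)) <= h ^+ 2.
  rewrite -ler_pdivlMr; first by rewrite !ge_min lexx orbT.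
  by rewrite !mulr_gt0.
have close r : nodes P r -> `|z r - phi r| <= 4^-1.
  move=> nr.
  have a : nodal_sq h P (fun x => z x - phi x) <= h ^+ 2 * 4^-1 ^+ 2.
    apply: le_trans (H20_nodal_sq oD h0 K0 hP hE Hg) _.
    have b : Hsq D 0 (fun x => z x - phi x) + K ^+ 2 * h ^+ 4 * Hsq D 2 (fun x => z x - phi x) <=
        eta * (1 + K ^+ 2 * h ^+ 4).
      rewrite mulrDr mulr1 lerD //; first exact: hphi.
      by rewrite mulrC ler_wpM2r ?hphi // mulr_ge0 // exprn_ge0 // ltW.
    apply: le_trans (ler_wpM2l _ b) _; first by rewrite mulr_ge0 // ltW.
    exact: sep_aux2.
  have b : h ^+ 2 * (z r - phi r) ^+ 2 <= nodal_sq h P (fun x => z x - phi x).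
    rewrite /nodal_sq ler_pM2l //.
    rewrite (bigD1_seq r) ?undup_uniq //=; last exact/node_seqP.
    by rewrite lerDl sumr_ge0 // => ? _; exact: sqr_ge0.
  have := le_trans b a; rewrite ler_pM2l // -ler_sqrt ?exprn_gt0 ?invr_gt0 //.
  by rewrite !sqrtr_sqr [leRHS]ger0_norm.
have E m (c : R) : (m <= 2)%N -> Hsq D m z <= c -> eta <= c -> Hsq D m phi <= 4 * c.
  move=> m2 hz hc.
  have := @Hsq_sub R D oD 2 m z (fun x => z x - phi x) (H20_Hspace Hz) (H20_Hspace Hg) m2.
  rewrite (_ : (fun x => z x - (z x - phi x)) = phi); last by apply/funext => x; rewrite opprB addrC subrK.
  have := hphi m m2; move: hz hc; move: (Hsq _ _ _) (Hsq _ _ _) (Hsq _ _ _) => a b d ? ? ? ?; lra.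
have E1 := E 1%N _ isT e1 eK; have E2 := E 2%N _ isT e2 eK2.
(* With this [k] the energy term of the Hoelder bound is at most 1/4, while the values of [phi] at
   the two nodes differ by at least 1/2. *)
have k0 : 0 < h / (64 * K ^+ 3) by rewrite divr_gt0 // mulr_gt0.
have := test_holder p q oD tp h0 k0.
rewrite mulrA in E2.
have := sep_aux E1 E2 k0; rewrite (_ : 16 * K ^+ 3 * _ = 4^-1); last by field; rewrite !gt_eqF.
move=> s1 s2; have := close p np; have := close q nq; rewrite zp zq => c1 c2.
have -> : h / (256 * K ^+ 3) = 4^-1 * (h / (64 * K ^+ 3)) by field; rewrite gt_eqF.
exact: sep_aux3 c1 c2 s1 s2 k0.
Qed.

End NodeSeparation.

(** * Overlap of the local components *)

Section Overlap.
Variables (R : realType) (D : set (plane R)) (K h : R) (P : pum R).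
Hypothesis oD : open D.
Hypothesis h0 : 0 < h.
Hypothesis K0 : 0 < K.
Hypothesis hP : is_pum D K h P.
Hypothesis hE : pum_estimates D K h P.
Implicit Types (v w c f g : plane R -> R) (p q x : plane R).

Lemma eucl_diam (a b : plane R) p q : open_rect a b p -> open_rect a b q ->
  eucl p q <= diam (open_rect a b).
Proof.
move=> hp hq; apply: ub_le_sup; last by exists p, q.
exists (Num.sqrt ((b.1 - a.1) ^+ 2 + (b.2 - a.2) ^+ 2)) => _ [x [y [hx hy ->]]].
move: hx hy => /andP[/andP[? ?] /andP[? ?]] /andP[/andP[? ?] /andP[? ?]].
rewrite ler_wsqrtr // lerD // -[leRHS]ger0_norm ?sqr_ge0 // -[leLHS]ger0_norm ?sqr_ge0 //;
  rewrite !normrX lerXn2r ?nnegrE ?normr_ge0 // ler_norml; rewrite ger0_norm; try lra;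
  apply/andP; split; lra.
Qed.

(** A square of side 2 K h is cut into cells of side h / (1024 K^3), that is 2048 K^4 of them along
    each side. *)
Definition node_count : nat := (Num.truncn (2048 * K ^+ 4)).+1 ^ 2.

(** All nodes of any patch that contains [x] are among these, as patch diameters are at most K h. *)
Definition near_nodes x := [seq p <- node_seq P | (`|p.1 - x.1| <= K * h) && (`|p.2 - x.2| <= K * h)].

(* Nodes are sorted into cells of side a quarter of their minimal distance. *)
Lemma size_near_nodes x : (size (near_nodes x) <= node_count)%N.
Proof.
pose m := Num.truncn (2048 * K ^+ 4).
pose s := 4 * (256 * K ^+ 3) / h.
have K3 : 0 < K ^+ 3 by rewrite exprn_gt0.
have s0 : 0 < s by rewrite divr_gt0 // !mulr_gt0.
pose cell (t : R) : 'I_m.+1 := inord (Num.truncn ((t + K * h) * s)).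
have cellP (t u : R) : `|t| <= K * h -> `|u| <= K * h -> cell t = cell u ->
    `|t - u| <= s^-1.
  have b (r : R) : `|r| <= K * h -> 0 <= (r + K * h) * s /\ (Num.truncn ((r + K * h) * s) < m.+1)%N.
    rewrite ler_norml => /andP[r1 r2].
    have p : 0 <= (r + K * h) * s by rewrite mulr_ge0 ?(ltW s0) //; lra.
    split=> //; rewrite ltnS; apply: le_truncn.
    apply: (@le_trans _ _ ((2 * K * h) * s)); first by rewrite ler_pM2r //; lra.
    by rewrite le_eqVlt; apply/orP; left; apply/eqP; rewrite /s; field; rewrite gt_eqF.
  move=> ht hu /(congr1 val); have [t0 tm] := b _ ht; have [u0 um] := b _ hu.
  rewrite /= !inordK // => e.
  have := truncn_itv t0; have := truncn_itv u0; rewrite e => /andP[a1 a2] /andP[a3 a4].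
  rewrite -[s^-1]mul1r ler_pdivlMr // -[s in `|_| * s]gtr0_norm // -normrM.
  rewrite ler_norml; move: a1 a2 a3 a4; rewrite -natr1.
  move: (Num.trunc _)%:R => n; rewrite mulrBl !mulrDl.
  move: (t * s) (u * s) (K * h * s) => a c d ? ? ? ?; apply/andP; split; lra.
have inj : {in near_nodes x &, injective (fun p => (cell (p.1 - x.1), cell (p.2 - x.2)))}.
  move=> p q; rewrite !mem_filter => /andP[/andP[p1 p2] /node_seqP np] /andP[/andP[q1 q2] /node_seqP nq].
  move=> [/(cellP _ _ p1 q1) e1 /(cellP _ _ p2 q2) e2].
  apply: contrapT => /eqP pq; have := node_separation oD h0 K0 hP hE np nq pq.
  rewrite (_ : h / _ = 4 * s^-1); last by rewrite /s; field; rewrite !gt_eqF.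
  move: e1 e2; rewrite !opprB !addrA !subrK.
  have si : 0 < s^-1 by rewrite invr_gt0.
  move: (`|p.1 - q.1|) (`|p.2 - q.2|) si; move: (s^-1) => ? ? ? ? ? ? ?; lra.
have : uniq [seq (cell (p.1 - x.1), cell (p.2 - x.2)) | p <- near_nodes x].
  by rewrite map_inj_in_uniq // filter_uniq // undup_uniq.
move=> /card_uniqP; rewrite size_map => <-.
by apply: leq_trans (max_card _) _; rewrite card_prod !card_ord mulnn.
Qed.

Lemma card_has (J : nat) (Nc : nat) (sub : 'I_J -> set (plane R)) (s : seq (plane R)) :
  (forall p, p \in s -> (#|[pred j | `[< sub j p >]]| <= Nc)%N) ->
  (#|[pred j | has (fun p => `[< sub j p >]) s]| <= size s * Nc)%N.
Proof.
elim: s => [|p s IH] hs /=.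
  by rewrite (eq_card0 (A := [pred j | false])).
rewrite mulSn; apply: (@leq_trans (#|[pred j | `[< sub j p >]]| + #|[pred j | has (fun p => `[< sub j p >]) s]|)).
  by rewrite -cardUI; apply: leq_trans (leq_addr _ _); apply: subset_leq_card; apply/fintype.subsetP => j.
rewrite leq_add //; first by apply: hs; rewrite inE eqxx.
by apply: IH => q qs; apply: hs; rewrite inE qs orbT.
Qed.

(** At almost every [x], second derivatives of w_j can be non-zero only if [x] lies in the support
    of the function of a patch with a node in the subdomain. That node is near [x]; there are at
    most [node_count] such nodes, each in at most [Nc] subdomains. *)
Lemma local_sum_le (N : set (plane R)) (J Nc : nat) (sub : 'I_J -> set (plane R)) (w : 'I_J -> plane R -> R) :
  (forall x, D x -> (#|[pred j | `[< sub j x >]]| <= Nc)%N) ->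
  (forall j, local_trunc_space D P N (sub j) (w j)) ->
  Hsq D 2 (fun x => \sum_j w j x) <= (node_count * Nc)%:R * \sum_j Hsq D 2 (w j).
Proof.
move=> hN hw.
have gw j : gfe_space D P (w j) by have [[]] := hw j.
have Hw j := H20_Hspace (gfe_H20 hP (gw j)).
apply: Hsq_sum_le => // s ss.
(* Interpolation spreads w_j beyond its subdomain: [A j] collects the supports of all patch
   functions with a node there. As a finite union it is closed, so locality applies on its
   complement. *)
pose A j := \bigcup_(i in [set i : 'I_(npatch P) | exists2 p, p \in locnodes i & sub j p]) supp_fun (pu i).
have cA j : closed (A j).
  by apply: closed_bigcup => [|i _]; [exact: finite_finset|exact: supp_fun_closed].
pose U j := D `&` ~` A j.
have oU j : open (U j) by apply: openI => //; exact: closed_openC.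
have w0 j x : U j x -> w j x = 0.
  move=> [Dx Ax]; have [[[q hq wq] _] hv] := hw j.
  rewrite wq /patch mem_set // big1 // => i _.
  have [[p pi sp]|hn] := pselect (exists2 p, p \in locnodes i & sub j p).
    rewrite (@supp_fun0 _ (pu i) x) ?mul0r // => sx; apply: Ax.
    by exists i => //; exists p.
  (* No node of the patch lies in the subdomain, so all nodal values of this local polynomial are 0
     and unisolvence applies. *)
  suff -> : q i = fun=> 0 by rewrite mulr0.
  case: (hP) => _ _ _ _ [hloc _]; have [hl _ _ _ [_ /(_ (fun=> 0)) [r [_ hr]]]] := hloc i.
  have z : locspace i (fun=> 0) by have [] := hl.
  rewrite -(hr (fun=> 0)) //; apply/esym/hr; split=> // p pi.
  rewrite -(blend_node hP q pi) /blend -wq hv //; first by exists i.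
  by move=> sp; apply: hn; exists p.
have : \forall x \ae mu2, forall j, U j x -> weakD D s (w j) x = 0.
  apply: ae2_forall => j; apply: (weakD_local oD (oU j)) => //; last exact: w0.
    by move=> x [].
  by apply: Hspace_weakly_derivable (Hw j) _; rewrite ss.
apply: ae2_sub => x hx Dx.
apply: (@leq_trans (size (near_nodes x) * Nc)); last by rewrite leq_mul2r size_near_nodes orbT.
apply: leq_trans (card_has (sub := sub) _); last first.
  by move=> p; rewrite mem_filter => /andP[_ /node_seqP /(nodes_sub hP) Dp]; exact: (hN _ Dp).
apply: subset_leq_card; apply/fintype.subsetP => j; rewrite !inE => wn.
have : A j x.
  apply: contrapT => Ax; move/eqP: wn; apply; exact: hx.
move=> [i [p pi sp] sx]; apply/hasP; exists p; last exact/asboolP.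
have nps : p \in node_seq P by apply/node_seqP; exists i.
rewrite mem_filter nps andbT.
case: (hP) => _ /(_ i) [hd _] hpu _ [hloc _].
have [_ _ _ /(_ _ pi) [[pp _] _] _] := hloc i.
have [_ _ _ /(_ _ sx) px _] := hpu i.
have := le_trans (eucl_diam pp px) hd; rewrite /eucl => e.
have sq (t : R) : t ^+ 2 <= (p.1 - x.1) ^+ 2 + (p.2 - x.2) ^+ 2 -> `|t| <= K * h.
  by move=> ht; apply: le_trans e; rewrite -sqrtr_sqr ler_wsqrtr.
by rewrite !sq // ?lerDl ?lerDr sqr_ge0.
Qed.

End Overlap.

(** * Stable decomposition with the coarse space *)

Section StableDecomposition.
Variables (R : realType) (D : set (plane R)) (K : R) (Nc : nat) (h H delta : R).
Variables (Ph PH : pum R) (J : nat) (sub : 'I_J -> set (plane R)).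
Variables (psi : 'I_J -> plane R -> R) (N : set (plane R)).
Hypothesis oD : open D.
Hypothesis K0 : 0 < K.
Hypothesis h0 : 0 < h.
Hypothesis hH : h <= H.
Hypothesis hP : is_pum D K h Ph.
Hypothesis hE : pum_estimates D K h Ph.
Hypothesis hPH : is_pum D K H PH.
Hypothesis hEH : pum_estimates D K H PH.
Hypothesis hd : overlapping_decomposition D K Nc H delta Ph sub psi.
Implicit Types (v w c f g : plane R -> R) (p q x : plane R).

Let H0 : 0 < H. Proof. exact: lt_le_trans hH. Qed.

(** Interpolating the product returns it to V_h; vanishing nodal values of [v] or of psi_j persist,
    so truncation and localization are respected at once. *)
Definition local_part v j := interp D Ph (fun p => psi j p * v p).

Lemma local_part_gfe v j : gfe_space D Ph (local_part v j).
Proof. exact: interp_gfe hP _. Qed.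

Lemma local_part_trunc v j : trunc_space D Ph N v ->
  local_trunc_space D Ph N (sub j) (local_part v j).
Proof.
move=> [gv hv]; split; first split; first exact: local_part_gfe.
  by move=> p np Np; rewrite /local_part (interp_node hP) // hv // mulr0.
move=> p np sp; rewrite /local_part (interp_node hP) // (psi_out oD hd) ?mul0r //.
exact: nodes_sub hP _ np.
Qed.

Lemma psi_sum p : D p -> \sum_j psi j p = 1.
Proof. by case: hd => _ _ _ _ [h1 _ _ _] Dp; apply: h1; exact: subset_closure. Qed.

Lemma psi_sqr_sum p : D p -> \sum_j psi j p ^+ 2 <= 1.
Proof.
move=> Dp; have [_ _ _ _ [_ psi0 _ _]] := hd.
rewrite -(psi_sum Dp); apply: ler_sum => j _.
rewrite expr2 ler_piMl // -(psi_sum Dp) (bigD1 j) //= lerDl.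
by apply: sumr_ge0 => i _.
Qed.

Lemma sum_local_part v : gfe_space D Ph v -> (fun x => \sum_j local_part v j x) = v.
Proof.
move=> gv; apply: (gfe_eq hP) => //; first by apply: (gfe_sum hP) => j; exact: local_part_gfe.
move=> p np; under eq_bigr do rewrite /local_part (interp_node hP _ np).
by rewrite -mulr_suml psi_sum ?mul1r //; exact: nodes_sub hP _ np.
Qed.

Lemma nodal_sq_interp f : nodal_sq h Ph (interp D Ph f) = nodal_sq h Ph f.
Proof.
by congr (_ * _); rewrite big_seq [RHS]big_seq; apply: eq_bigr => p /node_seqP np; rewrite (interp_node hP).
Qed.

Lemma nodal_sq_psi v : \sum_j nodal_sq h Ph (fun p => psi j p * v p) <= nodal_sq h Ph v.
Proof.
rewrite -mulr_sumr ler_wpM2l ?sqr_ge0 // exchange_big /= big_seq [leRHS]big_seq.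
apply: ler_sum => p /node_seqP np; under eq_bigr do rewrite exprMn.
by rewrite -mulr_suml ler_piMl ?sqr_ge0 // psi_sqr_sum //; exact: nodes_sub hP _ np.
Qed.

(** The factor in front of H^4 when the discrete norm of v - v_0 is bounded by the energy of [v]: 2
    K comes from [H20_nodal_sq], K^2 from the interpolation error, and h <= H merges the terms. *)
Let a := 2 * K ^+ 3 * (3 + 2 * K ^+ 2).

Let coarse_aux (V g0 g2 : R) : 0 <= V -> g0 <= K ^+ 2 * H ^+ 4 * V -> g2 <= 2 * V + 2 * (K ^+ 2 * V) ->
  2 * K * (g0 + K ^+ 2 * h ^+ 4 * g2) <= a * H ^+ 4 * V.
Proof.
move=> V0 hg0 hg2.
have hH4 : h ^+ 4 <= H ^+ 4 by rewrite lerXn2r // nnegrE ltW.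
have e2 : K ^+ 2 * h ^+ 4 * g2 <= K ^+ 2 * H ^+ 4 * (2 * V + 2 * (K ^+ 2 * V)).
  apply: (@le_trans _ _ (K ^+ 2 * h ^+ 4 * (2 * V + 2 * (K ^+ 2 * V)))).
    by rewrite ler_wpM2l // mulr_ge0 ?exprn_ge0 // ltW.
  rewrite ler_wpM2r //; last by rewrite ler_wpM2l ?sqr_ge0.
  by rewrite addr_ge0 // mulr_ge0 // mulr_ge0 ?sqr_ge0.
have -> : a * H ^+ 4 * V = 2 * K * (K ^+ 2 * H ^+ 4 * V + K ^+ 2 * H ^+ 4 * (2 * V + 2 * (K ^+ 2 * V))).
  by rewrite /a; ring.
by rewrite ler_pM2l ?mulr_gt0 // lerD.
Qed.

Let coarse_aux2 (t V : R) : t <= a * H ^+ 4 * V ->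
  K ^+ 3 * h ^- (2 * 2) * t <= K ^+ 3 * a * (H / h) ^+ 4 * V.
Proof.
move=> ht; have h4 : 0 <= K ^+ 3 * h ^- (2 * 2).
  by rewrite mulr_ge0 ?invr_ge0 // exprn_ge0 // ltW.
apply: le_trans (ler_wpM2l h4 ht) _.
rewrite exprMn exprVn !mulrA; move: (h ^+ 4)^-1 => i.
by rewrite le_eqVlt; apply/orP; left; apply/eqP; ring.
Qed.

Let coarse_aux3 (A rho V s0 s1 e1 : R) : s0 <= 2 * V + 2 * e1 -> e1 <= A * rho * V -> s1 <= A * rho * V ->
  V <= rho * V -> s0 + s1 <= (2 + 3 * A) * rho * V.
Proof.
rewrite -!mulrA; move: (rho * V) => x.
have -> : (2 + 3 * A) * x = 2 * x + 3 * (A * x) by ring.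
move: (A * x) => y *; lra.
Qed.

(** The part 2 + 2 K^3 a bounds the energy of v_0 as the difference of [v] and the remainder; a
    further K^3 a bounds the local components. *)
Definition coarse_constant : R := 2 + 3 * (K ^+ 3 * a).

Lemma coarse_decomposition v : trunc_space D Ph N v ->
  exists v0 (w : 'I_J -> plane R -> R),
  [/\ coarse_trunc_space D Ph PH N v0, forall j, local_trunc_space D Ph N (sub j) (w j),
      v = (fun x => v0 x + \sum_j w j x) &
      Hsq D 2 v0 + \sum_j Hsq D 2 (w j) <= coarse_constant * (H / h) ^+ 4 * Hsq D 2 v].
Proof.
move=> tv; have [gv hv] := tv; have Hv := gfe_H20 hP gv.
pose wH := interp D PH v; have gw : gfe_space D PH wH by exact: interp_gfe hPH _.
have Hw := gfe_H20 hPH gw.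
pose v0 := truncation D Ph N (interp D Ph wH).
have v0E := truncationE hP N (interp D Ph wH).
have g0 : gfe_space D Ph v0 by rewrite /v0 v0E; exact: interp_gfe hP _.
have n0 p : nodes Ph p -> v0 p = if p \in N then wH p else 0.
  by move=> np; rewrite /v0 v0E (interp_node hP) // /patch; case: ifP => // _; rewrite (interp_node hP).
pose r x := v x - v0 x.
have gr : gfe_space D Ph r.
  rewrite (_ : r = fun x => -1 * v0 x + v x); first exact: gfe_lin hP _ _ _ g0 gv.
  by apply/funext => x; rewrite mulN1r addrC.
have Hr := gfe_H20 hP gr; have Hv0 := gfe_H20 hP g0.
have tr : trunc_space D Ph N r.
  by split=> // p np Np; rewrite /r n0 // memNset // hv // subrr.
exists v0, (local_part r); split.
- by exists (interp D Ph wH) => //; exists wH.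
- by move=> j; exact: local_part_trunc.
- apply/funext => x; have /(congr1 (fun f => f x)) -> := sum_local_part gr.
  by rewrite /r addrC subrK.
pose V := Hsq D 2 v.
have V0 : 0 <= V by exact: Hsq_ge0.
(* At nodes in [N] the remainder equals [v] minus its coarse interpolant, and at the others it is 0,
   so truncation only lowers the discrete norm. *)
have nr : nodal_sq h Ph r <= a * H ^+ 4 * V.
  apply: (@le_trans _ _ (nodal_sq h Ph (fun x => v x - wH x))).
    apply: nodal_sq_le => p np; rewrite /r n0 //.
    have [Np|Np] := pselect (N p); first by rewrite mem_set.
    by rewrite memNset // hv // subrr expr0n sqr_ge0.
  apply: le_trans (H20_nodal_sq oD h0 K0 hP hE (H20_sub oD Hv Hw)) _.
  apply: coarse_aux => //; first exact: interp_Hsq0 H0 hEH _ Hv.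
  have := @Hsq_sub R D oD 2 2 v wH (H20_Hspace Hv) (H20_Hspace Hw) isT.
  move/le_trans; apply; rewrite lerD2l ler_pM2l //; exact: interp_Hsq2 H0 hEH _ Hv.
have er : Hsq D 2 r <= K ^+ 3 * a * (H / h) ^+ 4 * V.
  exact: le_trans (gfe_inverse oD hP hE gr (isT : (1 <= 2 <= 2)%N)) (coarse_aux2 nr).
have ew : \sum_j Hsq D 2 (local_part r j) <= K ^+ 3 * a * (H / h) ^+ 4 * V.
  apply: le_trans (coarse_aux2 nr); apply: (@le_trans _ _
     (\sum_j K ^+ 3 * h ^- (2 * 2) * nodal_sq h Ph (local_part r j))).
    by apply: ler_sum => j _; exact: (gfe_inverse oD hP hE (local_part_gfe r j) (isT : (1 <= 2 <= 2)%N)).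
  rewrite -mulr_sumr ler_wpM2l //; first by rewrite mulr_ge0 ?invr_ge0 // exprn_ge0 // ltW.
  by under eq_bigr do rewrite nodal_sq_interp; exact: nodal_sq_psi.
have e0 : Hsq D 2 v0 <= 2 * V + 2 * Hsq D 2 r.
  have := @Hsq_sub R D oD 2 2 v r (H20_Hspace Hv) (H20_Hspace Hr) isT.
  by rewrite (_ : (fun x => v x - r x) = v0) //; apply/funext => x; rewrite /r opprB addrC subrK.
have rho1 : 1 <= (H / h) ^+ 4 by rewrite exprn_ege1 // ler_pdivlMr // mul1r.
have VV : V <= (H / h) ^+ 4 * V by rewrite ler_peMl.
exact: coarse_aux3 e0 er ew VV.
Qed.

End StableDecomposition.

(** * Stable decomposition without the coarse space *)

Section LocalDecomposition.
Variables (R : realType) (D : set (plane R)) (K : R) (Nc : nat) (h H delta L c0 : R).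
Variables (Ph : pum R) (J : nat) (sub : 'I_J -> set (plane R)).
Variables (psi : 'I_J -> plane R -> R) (N : set (plane R)).
Hypothesis oD : open D.
Hypothesis L0 : 0 <= L.
Hypothesis DL : D `<=` cbox (- L, - L) (L, L).
Hypothesis K0 : 0 < K.
Hypothesis h0 : 0 < h.
Hypothesis d0 : 0 < delta.
Hypothesis dc : delta <= c0.
Hypothesis hP : is_pum D K h Ph.
Hypothesis hE : pum_estimates D K h Ph.
Hypothesis hd : overlapping_decomposition D K Nc H delta Ph sub psi.
Implicit Types (v w c f g : plane R -> R) (p q x : plane R).

(** The Poincare inequality reduces all orders to the second, and [delta <= c0] raises the rates 1
    and delta^-2 to delta^-4. *)
Let c1 := c0 ^+ 4 + 4 * L ^+ 2 * c0 ^+ 2 + 16 * L ^+ 4.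

Let poincare_aux (p0 p1 p2 : R) : 0 <= p2 -> p1 <= 4 * L ^+ 2 * p2 -> p0 <= 4 * L ^+ 2 * p1 ->
  p2 + delta ^- 2 * p1 + delta ^- 4 * p0 <= c1 * delta ^- 4 * p2.
Proof.
move=> h2 h1 h3.
have i2 : 0 <= delta ^- 2 by rewrite invr_ge0 exprn_ge0 // ltW.
have i4 : 0 <= delta ^- 4 by rewrite invr_ge0 exprn_ge0 // ltW.
have cd (m : nat) : delta ^+ m <= c0 ^+ m by rewrite lerXn2r ?nnegrE ?(ltW d0) // (le_trans (ltW d0)).
have e2 : 1 <= c0 ^+ 4 * delta ^- 4 by rewrite ler_pdivlMr ?mul1r ?cd // exprn_gt0.
have e1 : delta ^- 2 <= c0 ^+ 2 * delta ^- 4.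
  rewrite ler_pdivlMr ?exprn_gt0 // (_ : delta ^- 2 * _ = delta ^+ 2) ?cd //.
  by field; rewrite gt_eqF.
have k1 : delta ^- 2 * p1 <= c0 ^+ 2 * delta ^- 4 * (4 * L ^+ 2 * p2).
  apply: (le_trans (ler_wpM2l i2 h1)); rewrite ler_wpM2r //.
  by rewrite mulr_ge0 // mulr_ge0 // sqr_ge0.
have k0 : delta ^- 4 * p0 <= delta ^- 4 * (16 * L ^+ 4 * p2).
  rewrite ler_wpM2l //; apply: le_trans h3 _.
  have l2 : 0 <= 4 * L ^+ 2 by rewrite mulr_ge0 // sqr_ge0.
  apply: le_trans (ler_wpM2l l2 h1) _.
  by rewrite le_eqVlt; apply/orP; left; apply/eqP; ring.
have k2 : p2 <= c0 ^+ 4 * delta ^- 4 * p2 by rewrite ler_peMl.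
have -> : c1 * delta ^- 4 * p2 = c0 ^+ 4 * delta ^- 4 * p2 +
    c0 ^+ 2 * delta ^- 4 * (4 * L ^+ 2 * p2) + delta ^- 4 * (16 * L ^+ 4 * p2).
  by rewrite /c1; move: (delta ^- 4) => d; ring.
by rewrite !lerD.
Qed.

(** Splits a u - b v as a (u - v) - (b - a) v: the first part is the error of [phi], the second that
    of mollification. *)
Let sqr_split (a b u v e : R) : `|b - a| <= e -> (a * u - b * v) ^+ 2 <= 2 * (a * (u - v)) ^+ 2 + 2 * (e ^+ 2 * v ^+ 2).
Proof.
move=> ab; have -> : a * u - b * v = a * (u - v) - (b - a) * v by ring.
have : ((b - a) * v) ^+ 2 <= e ^+ 2 * v ^+ 2.
  rewrite exprMn ler_wpM2r ?sqr_ge0 //.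
  by rewrite -[leLHS]ger0_norm ?sqr_ge0 // normrX lerXn2r ?nnegrE ?normr_ge0 // (le_trans _ ab).
move: (a * (u - v)) ((b - a) * v) (e ^+ 2 * v ^+ 2) => x y z yz.
by have := sqr_ge0 (x + y); move: yz; rewrite !expr2; nra.
Qed.

Let final_aux (s1 s2 k3 A B d V eta : R) : k3 * s1 <= k3 * (2 * (A * eta) + 2 * eta) ->
  K ^+ 2 * s2 <= K ^+ 2 * (16 * (Nc%:R * K ^+ 2) * (B * d * (2 * (V + eta)))) ->
  2 * (k3 * s1) + 2 * (K ^+ 2 * s2) <=
  64 * (Nc%:R * K ^+ 4) * B * d * (V + eta) + 4 * k3 * (A + 1) * eta.
Proof.
move=> t1 t2.
have -> : 64 * (Nc%:R * K ^+ 4) * B * d * (V + eta) + 4 * k3 * (A + 1) * eta =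
  2 * (k3 * (2 * (A * eta) + 2 * eta)) +
  2 * (K ^+ 2 * (16 * (Nc%:R * K ^+ 2) * (B * d * (2 * (V + eta))))) by ring.
by rewrite lerD // ler_pM2l.
Qed.

Let sum2 (a b : R) (F : 'I_J -> R) : \sum_j a * (b * F j) = a * (b * \sum_j F j).
Proof. by rewrite !mulr_sumr. Qed.

(** The factor 16 Nc K^2 comes from the mollified partition, K^2 from interpolation, and 4 from two
    splittings, of the component and of [phi]. *)
Definition local_constant : R := 64 * (Nc%:R * K ^+ 4) * c1.

(** The term with h^-4 is multiplied by [eta], the accuracy with which a test function approximates
    [v], and so disappears in the limit. *)
Lemma local_decomposition_eta v (eta : R) : trunc_space D Ph N v -> 0 < eta ->
  \sum_j Hsq D 2 (local_part D Ph psi v j) <=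
  local_constant * delta ^- 4 * (Hsq D 2 v + eta) +
  4 * (K ^+ 3 * h ^- (2 * 2)) * (2 * K * (1 + K ^+ 2 * h ^+ 4) + 1) * eta.
Proof.
move=> [gv _] eta0; have Hv := gfe_H20 hP gv.
have [phi tp hphi] := H20_approx Hv eta0.
have Hp := test_H20 oD tp; have Hg := H20_sub oD Hv Hp.
pose nphi := nodal_sq h Ph phi.
have n0 : 0 <= nphi by exact: nodal_sq_ge0.
(* The accuracy at the nodes depends on [J] and [phi], so that the mollification errors of all [J]
   components sum to at most [eta]; the cap 1 gives eps^2 <= eps. *)
pose eps := Num.min 1 (eta / (J%:R * nphi + 1)).
have den : 0 < J%:R * nphi + 1 by rewrite ltr_wpDl // mulr_ge0.
have eps0 : 0 < eps by rewrite lt_min ltr01 divr_gt0.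
have hJ : J%:R * (eps ^+ 2 * nphi) <= eta.
  apply: (@le_trans _ _ (eps * (J%:R * nphi + 1))); last by rewrite -ler_pdivlMr // ge_min lexx orbT.
  rewrite mulrCA; apply: (@le_trans _ _ (eps * (J%:R * nphi))).
    rewrite ler_wpM2r //; first by rewrite mulr_ge0.
    by rewrite expr2 ler_piMr ?(ltW eps0) // ge_min lexx.
  by rewrite ler_pM2l // lerDl.
have [Psi [sP nP EP]] := mollified_partition (node_seq Ph) oD (ltW K0) d0 hd tp eps0.
pose u j := interp D Ph (fun x => Psi j x * phi x).
(* Nodal mismatch between psi_j v and the smooth product; the inverse estimate bounds the energy of
   its interpolant. *)
pose r j x := psi j x * v x - Psi j x * phi x.
have Hu j : H20 D (fun x => Psi j x * phi x) by apply: test_H20 => //; exact: test_mul.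
have k3 : 0 <= K ^+ 3 * h ^- (2 * 2) by rewrite mulr_ge0 ?invr_ge0 // exprn_ge0 // ltW.
have uE j : Hsq D 2 (local_part D Ph psi v j) <=
    2 * (K ^+ 3 * h ^- (2 * 2) * nodal_sq h Ph (r j)) + 2 * (K ^+ 2 * Hsq D 2 (fun x => Psi j x * phi x)).
  have g1 : gfe_space D Ph (local_part D Ph psi v j) by exact: interp_gfe hP _.
  have g2 : gfe_space D Ph (u j) by exact: interp_gfe hP _.
  apply: le_trans (@Hsq_split R D oD 2 2 _ (u j) (H20_Hspace (gfe_H20 hP g1)) (H20_Hspace (gfe_H20 hP g2)) isT) _.
  apply: lerD; rewrite ler_pM2l //; last exact: interp_Hsq2 h0 hE _ (Hu j).
  have -> : (fun x => local_part D Ph psi v j x - u j x) = interp D Ph (r j).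
    have := interp_lin hP (-1) (fun x => Psi j x * phi x) (fun x => psi j x * v x).
    rewrite (_ : (fun x => -1 * _ + _) = r j); last by apply/funext => x; rewrite mulN1r addrC.
    by move=> ->; apply/funext => x; rewrite mulN1r addrC.
  apply: le_trans (gfe_inverse oD hP hE (interp_gfe hP (r j)) (isT : (1 <= 2 <= 2)%N)) _.
  by rewrite (nodal_sq_interp hP).
have rE : \sum_j nodal_sq h Ph (r j) <= 2 * (2 * K * (1 + K ^+ 2 * h ^+ 4) * eta) + 2 * eta.
  have rj j : nodal_sq h Ph (r j) <=
      2 * nodal_sq h Ph (fun p => psi j p * (v p - phi p)) + 2 * (eps ^+ 2 * nphi).
    rewrite /nphi /nodal_sq !(mulrCA _ (h ^+ 2)) -mulrDr ler_wpM2l ?sqr_ge0 //.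
    rewrite !mulr_sumr -big_split /= big_seq [leRHS]big_seq; apply: ler_sum => p /nP np.
    exact: sqr_split.
  apply: le_trans (ler_sum _ (fun j _ => rj j)) _.
  rewrite big_split /= -mulr_sumr sumr_const card_ord -[_ *+ J]mulr_natl [J%:R * _]mulrCA.
  apply: lerD; rewrite ler_pM2l //.
  apply: le_trans (nodal_sq_psi hP hd (fun p => v p - phi p)) _.
  apply: le_trans (H20_nodal_sq oD h0 K0 hP hE Hg) _.
  rewrite -[leRHS]mulrA ler_wpM2l ?mulr_ge0 ?(ltW K0) // mulrDl mul1r lerD ?hphi //.
  by rewrite ler_wpM2l ?hphi // mulr_ge0 // exprn_ge0 // ltW.
have pE : Hsq D 2 phi <= 2 * (Hsq D 2 v + eta).
  have := @Hsq_sub R D oD 2 2 v (fun x => v x - phi x) (H20_Hspace Hv) (H20_Hspace Hg) isT.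
  rewrite (_ : (fun x => v x - (v x - phi x)) = phi); last by apply/funext => x; rewrite opprB addrC subrK.
  have := hphi 2%N isT; move: (Hsq _ _ _) (Hsq _ _ _) (Hsq _ _ _) => a b c ? ?; lra.
have P1 := test_poincare12 oD L0 DL tp; have P0 := test_poincare01 oD L0 DL tp.
have EP2 := poincare_aux (Hsq_ge0 D 2 phi) P1 P0.
apply: le_trans (ler_sum _ (fun j _ => uE j)) _.
rewrite big_split /= !sum2.
have t1 := ler_wpM2l k3 rE.
have NK : 0 <= 16 * (Nc%:R * K ^+ 2) by rewrite mulr_ge0 // mulr_ge0 // sqr_ge0.
have cd : 0 <= c1 * delta ^- 4.
  by rewrite mulr_ge0 ?invr_ge0 ?exprn_ge0 ?(ltW d0) // /c1 !addr_ge0 ?mulr_ge0 ?exprn_ge0 // (le_trans (ltW d0)).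
have t2 : \sum_j Hsq D 2 (fun x => Psi j x * phi x) <=
    16 * (Nc%:R * K ^+ 2) * (c1 * delta ^- 4 * (2 * (Hsq D 2 v + eta))).
  apply: le_trans EP _; rewrite ler_wpM2l //; apply: le_trans EP2 _.
  by rewrite ler_wpM2l.
have {}t2 := ler_wpM2l (sqr_ge0 K) t2.
exact: final_aux t1 t2.
Qed.

Lemma local_decomposition v : trunc_space D Ph N v ->
  \sum_j Hsq D 2 (local_part D Ph psi v j) <= local_constant * delta ^- 4 * Hsq D 2 v.
Proof.
move=> tv; apply/ler_addgt0Pr => t t0.
pose B := local_constant * delta ^- 4 + 4 * (K ^+ 3 * h ^- (2 * 2)) * (2 * K * (1 + K ^+ 2 * h ^+ 4) + 1).
(* All of [B] is fixed here, h included, so [eta] may be taken small against it. *)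
pose eta := t / (`|B| + 1).
have den : 0 < `|B| + 1 by rewrite ltr_wpDl.
have eta0 : 0 < eta by rewrite divr_gt0.
apply: le_trans (local_decomposition_eta tv eta0) _.
rewrite mulrDr -addrA lerD2l -mulrDl -/B.
apply: (@le_trans _ _ ((`|B| + 1) * eta)); last by rewrite /eta mulrC divfK // gt_eqF.
by rewrite ler_pM2r // (le_trans (ler_norm B)) // lerDl.
Qed.

End LocalDecomposition.

(** * Coordinates on the truncated space *)

Lemma aform0l (R : realType) (D : set (plane R)) (w : plane R -> R) : open D ->
  Hspace D 2 w -> aform D (fun=> 0) w = 0.
Proof.
move=> oD hw; have H0 := @test_Hspace R D oD 2%N _ (@test0 R D).
have := aform_linl oD (-1) H0 H0 hw.
rewrite (_ : (fun x => _) = fun=> 0); last by apply/funext => x; rewrite mulr0 addr0.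
by rewrite mulN1r addNr.
Qed.

Section TruncatedSpace.
Variables (R : realType) (D : set (plane R)) (K h : R) (P : pum R) (N : set (plane R)).
Hypothesis oD : open D.
Hypothesis bD : bounded_set D.
Hypothesis h0 : 0 < h.
Hypothesis hP : is_pum D K h P.
Hypothesis hE : pum_estimates D K h P.
Implicit Types (v w c f g : plane R -> R) (p q x : plane R).

(** The nodes in [N] index a nodal basis of the truncated space, which identifies it with row
    vectors. *)
Definition free_nodes : seq (plane R) := [seq p <- node_seq P | `[< N p >]].
Local Notation n := (size free_nodes).
Definition free_node (i : 'I_n) : plane R := nth 0 free_nodes i.
Definition nodal_basis (i : 'I_n) := interp D P (fun p => (p == free_node i)%:R).
Definition realize (u : 'rV[R]_n) x : R := \sum_i u 0 i * nodal_basis i x.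
Definition coordinates v : 'rV[R]_n := \row_i v (free_node i).

Lemma free_nodeP i : nodes P (free_node i) /\ N (free_node i).
Proof.
have : free_node i \in free_nodes by exact: mem_nth.
by rewrite mem_filter => /andP[/asboolP ? /node_seqP].
Qed.

Lemma nodal_basis_gfe i : gfe_space D P (nodal_basis i).
Proof. exact: interp_gfe hP _. Qed.

Lemma realize_gfe u : gfe_space D P (realize u).
Proof.
apply: (gfe_sum hP) => i.
have := gfe_lin hP (u 0 i) (nodal_basis_gfe i) (gfe0 hP).
by rewrite (_ : (fun x => _ + 0) = fun x => u 0 i * nodal_basis i x) //; apply/funext => x; rewrite addr0.
Qed.

Lemma realize_node u p : nodes P p -> realize u p = \sum_i u 0 i * (p == free_node i)%:R.
Proof. by move=> np; apply: eq_bigr => i _; rewrite /nodal_basis (interp_node hP). Qed.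

Lemma realizeK u : coordinates (realize u) = u.
Proof.
apply/rowP => i; rewrite mxE realize_node; last by case: (free_nodeP i).
rewrite (bigD1 i) //= eqxx mulr1 big1 ?addr0 // => j ji.
rewrite /free_node nth_uniq ?filter_uniq ?undup_uniq // (_ : (val i == j) = false) ?mulr0 //.
by rewrite eq_sym; apply/negbTE.
Qed.

Lemma realize_trunc u : trunc_space D P N (realize u).
Proof.
split; first exact: realize_gfe.
move=> p np Np; rewrite realize_node // big1 // => i _.
case: eqP => [pi|]; last by rewrite mulr0.
by exfalso; apply: Np; rewrite pi; case: (free_nodeP i).
Qed.

Lemma coordinatesK v : trunc_space D P N v -> realize (coordinates v) = v.
Proof.
move=> [gv hv]; apply: (gfe_eq hP) => //; first exact: realize_gfe.
move=> p np; have [Np|Np] := pselect (N p); last first.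
  by rewrite hv //; have [_ ->] := realize_trunc (coordinates v).
have pf : p \in free_nodes by rewrite mem_filter; apply/andP; split; [exact/asboolP|exact/node_seqP].
have pn : (index p free_nodes < n)%N by rewrite index_mem.
have pE : p = free_node (Ordinal pn) by rewrite /free_node /= nth_index.
by have := congr1 (fun u : 'rV[R]_n => u 0 (Ordinal pn)) (realizeK (coordinates v)); rewrite !mxE -pE.
Qed.

Lemma realize_lin (a : R) (u w : 'rV[R]_n) : realize (a *: u + w) = fun x => a * realize u x + realize w x.
Proof.
apply/funext => x; rewrite /realize mulr_sumr -big_split /=; apply: eq_bigr => i _.
by rewrite !mxE mulrDl mulrA.
Qed.

Lemma realize0 : realize 0 = fun=> 0.
Proof. by apply/funext => x; rewrite /realize big1 // => i _; rewrite mxE mul0r. Qed.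

Lemma realizeZ (a : R) (u : 'rV[R]_n) : realize (a *: u) = fun x => a * realize u x.
Proof. by rewrite -[a *: u]addr0 realize_lin realize0; apply/funext => x; rewrite addr0. Qed.

Lemma realize_sum (I : Type) (r : seq I) (F : I -> 'rV[R]_n) :
  realize (\sum_(i <- r) F i) = fun x => \sum_(i <- r) realize (F i) x.
Proof.
elim: r => [|i r IH]; first by rewrite big_nil realize0; apply/funext => x; rewrite big_nil.
rewrite big_cons -[F i]scale1r realize_lin IH.
by apply/funext => x; rewrite big_cons mul1r.
Qed.

Definition stiffness : 'M[R]_n := \matrix_(i, j) aform D (nodal_basis i) (nodal_basis j).

Lemma realize_Hspace u : Hspace D 2 (realize u).
Proof. exact: H20_Hspace (gfe_H20 hP (realize_gfe u)). Qed.

Lemma aform_realizel u w : Hspace D 2 w ->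
  aform D (realize u) w = \sum_i u 0 i * aform D (nodal_basis i) w.
Proof.
move=> hw.
have hb i : Hspace D 2 (nodal_basis i) := H20_Hspace (gfe_H20 hP (nodal_basis_gfe i)).
rewrite /realize; elim: (index_enum _) => [|i r IH].
  rewrite big_nil (_ : (fun x => _) = fun=> 0); last by apply/funext => x; rewrite big_nil.
  exact: aform0l.
have S : Hspace D 2 (fun x => \sum_(j <- r) u 0 j * nodal_basis j x).
  apply: H20_Hspace; apply: (gfe_H20 hP); apply: (gfe_sum hP) => j.
  have := gfe_lin hP (u 0 j) (nodal_basis_gfe j) (gfe0 hP).
  by rewrite (_ : (fun x => _ + 0) = fun x => u 0 j * nodal_basis j x) //; apply/funext => x; rewrite addr0.
rewrite big_cons -IH -(aform_linl oD (u 0 i) (hb i) S hw).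
by congr (aform D _ w); apply/funext => x; rewrite big_cons.
Qed.

Lemma bil_stiffness (u w : 'rV[R]_n) : bil stiffness u w = aform D (realize u) (realize w).
Proof.
rewrite bilE (aform_realizel u (realize_Hspace w)); apply: eq_bigr => i _.
rewrite aform_sym (aform_realizel w); last exact: H20_Hspace (gfe_H20 hP (nodal_basis_gfe i)).
by rewrite mulr_sumr; apply: eq_bigr => j _; rewrite mxE aform_sym; ring.
Qed.

Lemma bil_stiffnessE u : bil stiffness u u = Hsq D 2 (realize u).
Proof. by rewrite bil_stiffness aform_diag //; exact: realize_Hspace. Qed.

(** Definiteness of the energy: the Poincare inequality kills the L_2 norm, and the discrete norm
    then kills every nodal value. *)
Lemma gfe_Hsq2_eq0 v : gfe_space D P v -> Hsq D 2 v = 0 -> v = fun=> 0.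
Proof.
move=> gv v2; have [L L0 DL] := compact_sub_cbox bD.
have [_ +] := H20_poincare oD (ltW L0) DL (gfe_H20 hP gv); rewrite v2 mulr0 => v0.
have e0 : Hsq D 0 v = 0 by apply/eqP; rewrite eq_le v0 Hsq_ge0.
have := gfe_nodal_sq_le oD hP hE gv; rewrite e0 mulr0 => hn.
apply: (gfe_eq hP gv (gfe0 hP)) => p np.
have : h ^+ 2 * v p ^+ 2 <= 0.
  apply: le_trans hn; rewrite /nodal_sq ler_pM2l ?exprn_gt0 //.
  rewrite (bigD1_seq p) ?undup_uniq //=; last exact/node_seqP.
  by rewrite lerDl sumr_ge0 // => ? _; exact: sqr_ge0.
by rewrite pmulr_rle0 ?exprn_gt0 // real_exprn_even_le0 ?num_real //= => /eqP.
Qed.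

Lemma stiffness_pos (u : 'rV[R]_n) : u != 0 -> 0 < bil stiffness u u.
Proof.
move=> u0; rewrite bil_stiffnessE lt_neqAle Hsq_ge0 andbT eq_sym; apply/eqP => e.
move/eqP: u0; apply; rewrite -(realizeK u) (gfe_Hsq2_eq0 (realize_gfe u) e).
by apply/rowP => i; rewrite !mxE.
Qed.

Lemma stiffness_sym (u w : 'rV[R]_n) : bil stiffness u w = bil stiffness w u.
Proof. by rewrite !bil_stiffness aform_sym. Qed.

(* Functionals are compared through their restrictions to [V], so that the
   solution of the projection equations is recovered by the choice operator
   in the pseudo-inverse. *)
Lemma Ainv_projection (V : set (plane R -> R)) v w : V `<=` trunc_space D P N ->
  (forall (a : R) f g, V f -> V g -> V (fun x => a * f x + g x)) ->
  V w -> (forall z, V z -> aform D w z = aform D v z) ->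
  Ainv D V (restr_dual V (Aop D (trunc_space D P N) v)) = w.
Proof.
move=> VT Vlin Vw hw.
have -> : restr_dual V (Aop D (trunc_space D P N) v) = Aop D V w.
  apply/funext => z; rewrite /restr_dual /Aop /restr_dual /patch.
  case: ifPn => // /set_mem Vz; rewrite mem_set; last exact: VT.
  by rewrite hw.
have inj : {in V &, injective (Aop D V)}.
  move=> f g /set_mem Vf /set_mem Vg e.
  have Vr := Vlin (-1) f g Vf Vg; set r := (fun x => _) in Vr.
  have gr := proj1 (VT _ Vr).
  have hf := H20_Hspace (gfe_H20 hP (proj1 (VT _ Vf))).
  have hg := H20_Hspace (gfe_H20 hP (proj1 (VT _ Vg))).
  have hr := H20_Hspace (gfe_H20 hP gr).
  have e2 : aform D f r = aform D g r.
    by have := congr1 (fun F => F r) e; rewrite /Aop /restr_dual /patch mem_set.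
  have e3 : Hsq D 2 r = 0.
    by rewrite -(aform_diag oD hr) (aform_linl oD (-1) hf hg hr) e2 mulN1r addNr.
  apply/funext => x; have := congr1 (fun F => F x) (gfe_Hsq2_eq0 gr e3).
  by rewrite /r mulN1r => /eqP; rewrite addrC subr_eq0 => /eqP.
exact: (pinvKV (fun=> 0) inj (mem_set Vw)).
Qed.

End TruncatedSpace.

Lemma coarse_trunc_space_sub (R : realType) (D : set (plane R)) (K h : R) (P PH : pum R) (N : set (plane R)) :
  is_pum D K h P -> coarse_trunc_space D P PH N `<=` trunc_space D P N.
Proof.
move=> hP _ [f _ <-]; rewrite (truncationE hP).
split; first exact: interp_gfe hP _.
by move=> p np Np; rewrite (interp_node hP) // /patch memNset.
Qed.

(** Truncation acts linearly once it is written as an interpolation. *)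
Lemma coarse_trunc_space_lin (R : realType) (D : set (plane R)) (K h H : R) (P PH : pum R) (N : set (plane R))
    (a : R) f g : is_pum D K h P -> is_pum D K H PH ->
  coarse_trunc_space D P PH N f -> coarse_trunc_space D P PH N g ->
  coarse_trunc_space D P PH N (fun x => a * f x + g x).
Proof.
move=> hP hPH [_ [w gw <-] <-] [_ [w' gw' <-] <-].
exists (interp D P (fun x => a * w x + w' x)).
  by exists (fun x => a * w x + w' x) => //; exact: gfe_lin hPH _ _ _ gw gw'.
rewrite !(truncationE hP) -(interp_lin hP) (interp_lin hP a w w'); congr interp.
by apply/funext => x; rewrite /patch; case: ifP => // _; rewrite mulr0 addr0.
Qed.

Lemma coarse_trunc_space0 (R : realType) (D : set (plane R)) (K h H : R) (P PH : pum R) (N : set (plane R)) :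
  is_pum D K h P -> is_pum D K H PH -> coarse_trunc_space D P PH N (fun=> 0).
Proof.
move=> hP hPH; have c : coarse_trunc_space D P PH N (truncation D P N (interp D P (fun=> 0))).
  by exists (interp D P (fun=> 0)) => //; exists (fun=> 0) => //; exact: gfe0 hPH.
have := coarse_trunc_space_lin (-1) hP hPH c c.
by rewrite (_ : (fun x => _) = fun=> 0) //; apply/funext => x; rewrite mulN1r addNr.
Qed.

Lemma local_trunc_space_lin (R : realType) (D : set (plane R)) (K h : R) (P : pum R) (N S : set (plane R))
    (a : R) f g : is_pum D K h P ->
  local_trunc_space D P N S f -> local_trunc_space D P N S g ->
  local_trunc_space D P N S (fun x => a * f x + g x).
Proof.
move=> hP [[gf f1] f2] [[gg g1] g2]; split; first split; first exact: gfe_lin hP _ _ _ gf gg.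
  by move=> p np Np; rewrite f1 // g1 // mulr0 addr0.
by move=> p np Np; rewrite f2 // g2 // mulr0 addr0.
Qed.

Lemma local_trunc_space0 (R : realType) (D : set (plane R)) (K h : R) (P : pum R) (N S : set (plane R)) :
  is_pum D K h P -> local_trunc_space D P N S (fun=> 0).
Proof. by move=> hP; split => //; split => //; exact: gfe0 hP. Qed.

(** Serves to bound H, and with it delta, by the size of the domain. *)
Lemma diam_sub_cbox (R : realType) (A : set (plane R)) (L : R) : 0 <= L -> A !=set0 ->
  A `<=` cbox (- L, - L) (L, L) -> diam A <= 4 * L.
Proof.
move=> L0 [x Ax] AL; apply: ge_sup; first by exists (eucl x x), x, x.
move=> _ [y [z [/AL /cboxP /= [/andP[? ?] /andP[? ?]] /AL /cboxP /= [/andP[? ?] /andP[? ?]] ->]]].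
have L4 : 0 <= 4 * L by rewrite mulr_ge0.
rewrite -(ger0_norm L4) -sqrtr_sqr ler_wsqrtr //.
have sq (s t : R) : - L <= s <= L -> - L <= t <= L -> (s - t) ^+ 2 <= 4 * L ^+ 2.
  move=> /andP[? ?] /andP[? ?]; rewrite (_ : 4 * L ^+ 2 = (2 * L) ^+ 2); last by rewrite exprMn; ring.
  rewrite -[leLHS]ger0_norm ?sqr_ge0 // normrX lerXn2r ?nnegrE ?normr_ge0 ?mulr_ge0 //.
  by rewrite ler_norml; apply/andP; split; lra.
have a1 : (y.1 - z.1) ^+ 2 <= 4 * L ^+ 2 by apply: sq; apply/andP.
have a2 : (y.2 - z.2) ^+ 2 <= 4 * L ^+ 2 by apply: sq; apply/andP.
rewrite exprMn; apply: le_trans (lerD a1 a2) _; rewrite -mulrDl ler_wpM2r ?sqr_ge0 //.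
by rewrite expr2; lra.
Qed.

(** * Spectrum of the two-level operator *)

Section TwoLevel.
Variables (R : realType) (D : set (plane R)) (K : R) (Nc : nat) (h H delta : R).
Variables (Ph PH : pum R) (J : nat) (sub : 'I_J -> set (plane R)).
Variables (N : set (plane R)) (C0 : R).
Hypothesis oD : open D.
Hypothesis bD : bounded_set D.
Hypothesis K0 : 0 < K.
Hypothesis h0 : 0 < h.
Hypothesis hP : is_pum D K h Ph.
Hypothesis hE : pum_estimates D K h Ph.
Hypothesis hPH : is_pum D K H PH.
Hypothesis hN : forall x, D x -> (#|[pred j | `[< sub j x >]]| <= Nc)%N.
Hypothesis C00 : 0 < C0.
Hypothesis hdec : forall v, trunc_space D Ph N v ->
  exists v0 (w : 'I_J -> plane R -> R),
  [/\ coarse_trunc_space D Ph PH N v0, forall j, local_trunc_space D Ph N (sub j) (w j),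
      v = (fun x => v0 x + \sum_j w j x) &
      Hsq D 2 v0 + \sum_j Hsq D 2 (w j) <= C0 * Hsq D 2 v].
Hypothesis nz : exists2 v, trunc_space D Ph N v & v <> 0.

Local Notation V := (trunc_space D Ph N).
Local Notation n := (size (free_nodes Ph N)).
Local Notation Phi := (@realize R D Ph N).
Local Notation T := (precond_op D Ph PH N sub).

(** Index 0 is the coarse space and index [lift ord0 j] the local space of subdomain [j], so that
    the abstract theory sees one family. *)
Definition subspaces (i : 'I_J.+1) : set (plane R -> R) :=
  if unlift ord0 i is Some j then local_trunc_space D Ph N (sub j)
  else coarse_trunc_space D Ph PH N.

Lemma subspaces_sub i : subspaces i `<=` V.
Proof.
rewrite /subspaces; case: (unlift ord0 i) => [j|]; first by move=> f [].
exact: coarse_trunc_space_sub hP.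
Qed.

Lemma subspaces_lin i (a : R) f g : subspaces i f -> subspaces i g ->
  subspaces i (fun x => a * f x + g x).
Proof.
rewrite /subspaces; case: (unlift ord0 i) => [j|]; first exact: local_trunc_space_lin hP.
exact: coarse_trunc_space_lin hP hPH.
Qed.

Lemma subspaces0 i : subspaces i (fun=> 0).
Proof.
rewrite /subspaces; case: (unlift ord0 i) => [j|]; first exact: local_trunc_space0 hP.
exact: coarse_trunc_space0 hP hPH.
Qed.

(** The coarse component is separated from the local ones at the cost of a factor 2; overlap is
    counted among the local ones alone. *)
Definition upper_constant : R := 2 + 2 * (node_count K * Nc)%:R.

Let m := (node_count K * Nc)%:R : R.

Let upper_aux (a b s c : R) : 0 <= a -> 0 <= s -> c <= 2 * 1 ^+ 2 * a + 2 * b -> b <= m * s ->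
  c <= upper_constant * (a + s).
Proof.
move=> a0 s0; rewrite expr1n mulr1 /upper_constant -/m => h1 h2.
have m0 : 0 <= m * a by rewrite mulr_ge0 // ler0n.
have -> : (2 + 2 * m) * (a + s) = 2 * a + 2 * s + 2 * (m * a) + 2 * (m * s) by ring.
move: (m * a) (m * s) m0 h2 => x y ? ?; lra.
Qed.

Lemma two_level_spectrum : exists lmax lmin : R,
  [/\ is_lambda_max V T lmax, is_lambda_min V T lmin, 1 <= C0 * lmin & lmax <= upper_constant].
Proof.
have PhiK := @realizeK R D K h Ph N hP.
have KPhi := @coordinatesK R D K h Ph N hP.
(* A non-zero function forces a free node; eigenvalues need a space of positive dimension. *)
have n0 : (0 < n)%N.
  rewrite lt0n; apply/eqP => n00; have [v Vv v0] := nz; apply: v0.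
  rewrite -(KPhi _ Vv); apply/funext => x; rewrite /realize big1 // => i _.
  by exfalso; move: (ltn_ord i); rewrite [X in (_ < X)%N]n00.
(* Membership in each subspace is transported to coordinates, where it becomes membership in a row
   space. *)
pose S i (u : 'rV[R]_n) := subspaces i (Phi u).
have [U hU] : exists U : 'I_J.+1 -> 'M[R]_n, forall i u, S i u <-> (u <= U i)%MS.
  have SU i : exists Ui : 'M[R]_n, forall u, S i u <-> (u <= Ui)%MS.
    apply: subspace_mx; first by rewrite /S realize0; exact: subspaces0.
    by move=> a u w; rewrite /S realize_lin; exact: subspaces_lin.
  by have [U hU] := choice SU; exists U.
have dec (u : 'rV[R]_n) : exists w : 'I_J.+1 -> 'rV[R]_n,
    [/\ forall i, (w i <= U i)%MS, u = \sum_i w i &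
     \sum_i bil (stiffness D Ph N) (w i) (w i) <= C0 * bil (stiffness D Ph N) u u].
  have [v0 [w [hv0 hw e le]]] := hdec (realize_trunc hP u).
  pose f (i : 'I_J.+1) : plane R -> R := if unlift ord0 i is Some j then w j else v0.
  have Sf i : subspaces i (f i) by rewrite /subspaces /f; case: (unlift ord0 i).
  exists (fun i => coordinates Ph N (f i)); split.
  - by move=> i; apply/hU; rewrite /S KPhi //; exact: subspaces_sub (Sf i).
  - rewrite -{1}(PhiK u); apply/rowP => k; rewrite mxE e summxE big_ord_recl mxE /f unlift_none.
    by congr (_ + _); apply: eq_bigr => j _; rewrite mxE liftK.
  - rewrite (bil_stiffnessE oD hP) (eq_bigr (fun i => Hsq D 2 (f i))); last first.
      by move=> i _; rewrite (bil_stiffnessE oD hP) KPhi //; exact: subspaces_sub (Sf i).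
    by rewrite big_ord_recl /f unlift_none; under eq_bigr do rewrite liftK.
have up (w : 'I_J.+1 -> 'rV[R]_n) : (forall i, (w i <= U i)%MS) ->
    bil (stiffness D Ph N) (\sum_i w i) (\sum_i w i) <=
    upper_constant * \sum_i bil (stiffness D Ph N) (w i) (w i).
  move=> hw; rewrite (bil_stiffnessE oD hP).
  under [X in _ <= _ * X]eq_bigr do rewrite (bil_stiffnessE oD hP).
  rewrite big_ord_recl [X in _ <= _ * X]big_ord_recl -[w ord0]scale1r realize_lin realize_sum scale1r.
  have Sw j : local_trunc_space D Ph N (sub j) (Phi (w (lift ord0 j))).
    by have /hU := hw (lift ord0 j); rewrite /S /subspaces liftK.
  have hs := local_sum_le oD h0 K0 hP hE hN Sw.
  have h1 : Hspace D 2 (Phi (w ord0)) by exact: realize_Hspace hP _.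
  have h2 : Hspace D 2 (fun x => \sum_j Phi (w (lift ord0 j)) x).
    rewrite -(realize_sum D _ (fun j => w (lift ord0 j))); exact: realize_Hspace hP _.
  have h3 := Hsq_lin oD 1 h1 h2 (leqnn 2).
  apply: upper_aux h3 hs; first exact: Hsq_ge0.
  by apply: sumr_ge0 => j _; exact: Hsq_ge0.
have [P [hPi [lmax [lmin [[umax umax0 emax] [umin umin0 emin] hl l1 l2]]]]] :=
  additive_schwarz_spectrum n0 (stiffness_pos oD bD h0 hP hE) (stiffness_sym oD hP) C00 dec up.
(* In coordinates the preconditioned operator is the sum of the projections: each summand of the
   preconditioner solves the projection equations on its subspace. *)
have TE (u : 'rV[R]_n) : T (Phi u) = Phi (\sum_i u *m P i).
  rewrite /precond_op /B_TL realize_sum; apply/funext => x.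
  have proj i : Ainv D (subspaces i) (restr_dual (subspaces i) (Aop D V (Phi u))) = Phi (u *m P i).
    apply: (Ainv_projection oD bD h0 hP hE).
    - exact: subspaces_sub.
    - by move=> a f g; exact: subspaces_lin.
    - by apply/hU; case: (hPi i u).
    - move=> z Sz; have [_ hz] := hPi i u.
      rewrite -(KPhi z); last exact: subspaces_sub Sz.
      rewrite -!(bil_stiffness oD hP); apply: hz; apply/hU.
      by rewrite /S KPhi //; exact: subspaces_sub Sz.
  rewrite big_ord_recl -!proj {1 2}/subspaces unlift_none /= fct_sumE; congr (_ + _).
  by apply: eq_bigr => j _; rewrite -proj /subspaces liftK.
have eigen (l : R) (u : 'rV[R]_n) : u != 0 -> \sum_i u *m P i = l *: u -> is_eigenvalue V T l.
  move=> u0 e; exists (Phi u); split; first exact: realize_trunc hP u.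
    move=> z; move/eqP: u0; apply; rewrite -(PhiK u) z; apply/rowP => i; by rewrite !mxE.
  by rewrite TE e realizeZ.
have eigenI (l : R) : is_eigenvalue V T l -> lmin <= l <= lmax.
  move=> [v [Vv v0 e]]; apply: (hl l (coordinates Ph N v)).
    apply/eqP => c0; apply: v0; rewrite -(KPhi v Vv) c0; exact: realize0.
  rewrite -(PhiK (\sum_i _)) -TE KPhi // e; apply/rowP => i; by rewrite !mxE.
exists lmax, lmin; split => //.
  by split; [exact: eigen emax|move=> l /eigenI /andP[]].
by split; [exact: eigen emin|move=> l /eigenI /andP[]].
Qed.

End TwoLevel.

(** * The bound on the condition number *)

Theorem theorem6p2 (R : realType) (Om : set (plane R)) (K : R) (Nc : nat)
    (hOm : polygonal_domain Om) (hK : 0 < K) :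
  exists2 C : R, 0 < C &
  forall (h H delta : R) (Ph PH : pum R) (J : nat)
    (sub : 'I_J -> set (plane R)) (psi : 'I_J -> plane R -> R)
    (N : set (plane R)),
  0 < h -> h <= H -> h <= delta -> delta <= K * H ->
  pum_discretization Om K h Ph ->
  pum_discretization Om K H PH ->
  overlapping_decomposition Om K Nc H delta Ph sub psi ->
  N `<=` nodes Ph ->
  (exists2 v, trunc_space Om Ph N v & v <> 0) ->
  exists lmax lmin : R,
    [/\ is_lambda_max (trunc_space Om Ph N) (precond_op Om Ph PH N sub) lmax,
        is_lambda_min (trunc_space Om Ph N) (precond_op Om Ph PH N sub) lmin,
        0 < lmin &
        lmax / lmin <= C * Num.min ((H / h) ^+ 4) (delta ^- 4)].
Proof.
have [oD _ neD bD _] := hOm.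
have [L L0 DL] := compact_sub_cbox bD.
(* A bound for delta independent of the discretization: delta <= K H, H is at most K times the
   diameter of a subdomain, and that diameter is at most 4 L. *)
pose c0 := K * (K * (4 * L)).
have c00 : 0 <= c0 by rewrite !mulr_ge0 // ltW.
(* The sum serves both decompositions, whichever of the two rates is the smaller. *)
pose Cd := coarse_constant K + local_constant K Nc L c0.
have Cc0 : 0 < coarse_constant K.
  by rewrite /coarse_constant ltr_wpDr // !mulr_ge0 ?exprn_ge0 ?addr_ge0 ?mulr_ge0 ?sqr_ge0 // ltW.
have Cl0 : 0 <= local_constant K Nc L c0.
  by rewrite /local_constant !mulr_ge0 ?addr_ge0 ?mulr_ge0 ?exprn_ge0 ?ler0n // ltW.
have Cd0 : 0 < Cd by rewrite ltr_wpDr.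
have M0 : 0 < upper_constant K Nc by rewrite /upper_constant ltr_wpDr // mulr_ge0.
exists (upper_constant K Nc * Cd); first by rewrite mulr_gt0.
move=> h H delta Ph PH J sub psi N h0 hH hdelta dK [hP hE] [hPH hEH] hd _ nz.
have d0 : 0 < delta by exact: lt_le_trans hdelta.
have H0 : 0 < H by exact: lt_le_trans hH.
have dc : delta <= c0.
  have [x Ox] := neD; have [hsub cov _ _ _] := hd.
  have [j _ _] : (\bigcup_j sub j) x by rewrite cov.
  have [[_ _ nej _ _] [_ Hdiam]] := hsub j.
  apply: le_trans dK _; rewrite ler_pM2l //; apply: le_trans Hdiam _; rewrite ler_pM2l //.
  apply: (diam_sub_cbox (ltW L0) nej); apply: subset_trans DL; rewrite -cov.
  exact: bigcup_sup.
pose mn := Num.min ((H / h) ^+ 4) (delta ^- 4).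
have mn0 : 0 < mn by rewrite lt_min invr_gt0 !exprn_gt0 // divr_gt0.
have C00 : 0 < Cd * mn by rewrite mulr_gt0.
have hdec v : trunc_space Om Ph N v -> exists v0 (w : 'I_J -> plane R -> R),
    [/\ coarse_trunc_space Om Ph PH N v0, forall j, local_trunc_space Om Ph N (sub j) (w j),
      v = (fun x => v0 x + \sum_j w j x) &
      Hsq Om 2 v0 + \sum_j Hsq Om 2 (w j) <= Cd * mn * Hsq Om 2 v].
  move=> tv; have V0 := Hsq_ge0 Om 2 v.
  have [mE|mE] : mn = (H / h) ^+ 4 \/ mn = delta ^- 4 by rewrite /mn minEle; case: ifP; [left|right].
    have [v0 [w [h1 h2 h3 h4]]] := coarse_decomposition oD hK h0 hH hP hE hPH hEH hd tv.
    exists v0, w; split=> //; apply: le_trans h4 _; rewrite mE ler_wpM2r // ler_wpM2r ?lerDl //.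
    by rewrite exprn_ge0 // divr_ge0 // ltW.
  exists (fun=> 0), (local_part Om Ph psi v); split.
  - exact: coarse_trunc_space0 hP hPH.
  - by move=> j; exact: local_part_trunc oD hP hd _ _ tv.
  - apply/funext => x; rewrite add0r.
    by have /(congr1 (fun f => f x)) -> := sum_local_part hP hd (proj1 tv).
  have hz := @test_Hspace R Om oD 2%N _ (@test0 R Om).
  rewrite -(aform_diag oD hz) (aform0l oD hz).
  rewrite add0r; apply: le_trans (local_decomposition oD (ltW L0) DL hK h0 d0 dc hP hE hd tv) _.
  by rewrite mE ler_wpM2r // ler_wpM2r ?lerDr ?ltW // invr_gt0 exprn_gt0.
have hN : forall x, Om x -> (#|[pred j | `[< sub j x >]]| <= Nc)%N by case: hd.
have [lmax [lmin [e1 e2 l1 l2]]] := two_level_spectrum oD bD hK h0 hP hE hPH hN C00 hdec nz.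
have l0 : 0 < lmin by rewrite -(pmulr_rgt0 _ C00); apply: lt_le_trans l1.
exists lmax, lmin; split => //.
(* The inequality [1 <= Cd * mn * lmin] turns the bound on [lmax] into one on the quotient. *)
rewrite ler_pdivrMr //; apply: le_trans l2 _; rewrite -/mn.
rewrite (_ : _ * Cd * mn * lmin = upper_constant K Nc * (Cd * mn * lmin)); last by rewrite !mulrA.
by rewrite ler_peMr // ltW.
Qed.
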